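(* Let $\mu$ be a degenerate self-similar probability measure on $[0,1]$ with parameters $n$, $(\alpha_k)$, $(e_k)$, $(d_k)$, $(\beta_k)$, where $m$ is the unique index with $d_m\ne0$ and $a_m=\alpha_{m+1}-\alpha_m$. Let $X$ be one of the following Gaussian processes on $[0,1]$ ($W$ denotes the standard Wiener process): 1) Wiener process $W(t)$; 2) Brownian bridge $B(t)=W(t)-tW(1)$; 3) centered Wiener process $\overline W(t)=W(t)-\int_0^1W(s)\,ds$; 4) centered Brownian bridge $\overline B(t)=B(t)-\int_0^1B(s)\,ds$; 5) ''elongated'' Brownian bridge $W^{(u)}(t)=W(t)-utW(1)$, $u<1$; 6) generalized Slepian process $\widehat W^{[c]}(t)=W(t+c)-W(t)$, $c\ge1$; 7) stationary Ornstein--Uhlenbeck process $U^{(\alpha)}$, $\alpha>0$: the zero-mean Gaussian process with covariance $\frac1{2\alpha}\exp(-\alpha|s-t|)$; 8) Ornstein--Uhlenbeck process starting at zero $U^{(\alpha)}_0$, $\alpha\neq0$: the zero-mean Gaussian process with covariance $\frac1{2\alpha}\bigl(\exp(-\alpha|s-t|)-\exp(-\alpha(s+t))\bigr)$; 9) Bogolyubov process $\mathcal B^{(\alpha)}$, $\alpha>0$: the zero-mean Gaussian process with covariance $\frac1{2\alpha}\,\frac{\exp(\alpha|s-t|)+\exp(\alpha-\alpha|s-t|)}{\exp(\alpha)-1}$. Then $$\ln\mathbf P\{\|X\|_\mu\le\varepsilon\}\sim-(n-1)\,\frac{\ln^2(\frac1\varepsilon)}{\ln\big(\frac1{|d_m|\cdot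 a_m}\big)},\qquad\varepsilon\to+0.$$
   Context: $\|X\|_\mu=\left(\int_0^1X^2(t)\,\mu(dt)\right)^{1/2}$; $g\sim h$ means $g/h\to1$. Degenerate self-similar probability measure. Let $n\ge2$, $0=\alpha_1<\alpha_2<\dots<\alpha_{n+1}=1$, $a_k=\alpha_{k+1}-\alpha_k$; let $e_k\in\{0,1\}$ and $d_k,\beta_k\in\mathbb R$, $k=1,\dots,n$. Put $S_k(t)=a_kt+\alpha_k$ if $e_k=0$ and $S_k(t)=\alpha_{k+1}-a_kt$ if $e_k=1$, so $S_k$ maps $[0,1]$ onto $[\alpha_k,\alpha_{k+1}]$. The similarity operator is $$\mathcal S[f](t)=\sum_{k=1}^n\left(d_k f(S_k^{-1}(t))+\beta_k\right)\chi_{]\alpha_k,\alpha_{k+1}[}(t).$$ Assume exactly one $d_k$ is nonzero, say $d_m$, and $|d_m|<1$. Then $\mathcal S$ is a contraction in $L_\infty]0,1[$ and has a unique fixed point $f=\mathcal S(f)$, which has a piecewise constant representative of bounded variation. Assume that $f$ has jumps at all points $\alpha_k$, $k=2,\dots,n$. Define $f$ at discontinuity points to be left-continuous (with the one-sided limits as the values at the endpoints $0$ and $1$, and $f(1+0)=f(1)$), and define the discrete signed measure $\mu$ by $\mu([a,b])=f(b+0)-f(a)$, $0\le a\le b\le1$. It is assumed that $\mu$ is a probability measure (nonnegative, total mass one). *)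

(* Defs.v *)
From HB Require Import structures.
From mathcomp Require Export all_boot all_order all_algebra.
From mathcomp Require Export all_classical all_reals all_analysis.
Export Order.TTheory GRing.Theory Num.Theory.
Export numFieldNormedType.Exports.

Set Implicit Arguments.
Unset Strict Implicit.
Unset Printing Implicit Defensive.

Local Open Scope classical_set_scope.
Local Open Scope ring_scope.

(* Indices are 0-based: the knots alpha_1 < ... < alpha_{n+1} are the values of
   alpha on 'I_n.+1, and k : 'I_n indexes the interval
   [alpha_{k+1}, alpha_{k+2}] of the 1-based numbering. *)
Section similarity.
Context {R : realType} {n : nat}.
Variables (alpha : 'I_n.+1 -> R) (e : 'I_n -> bool) (d beta : 'I_n -> R).

Definition lknot (k : 'I_n) : R := alpha (widen_ord (leqnSn n) k).
Definition rknot (k : 'I_n) : R := alpha (lift ord0 k).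
Definition gap (k : 'I_n) : R := rknot k - lknot k.

Definition simmap (k : 'I_n) (t : R) : R :=
  if e k then rknot k - gap k * t else gap k * t + lknot k.

Definition simmap_inv (k : 'I_n) (t : R) : R :=
  if e k then (rknot k - t) / gap k else (t - lknot k) / gap k.

Lemma simmapK (k : 'I_n) : lknot k < rknot k ->
  cancel (simmap k) (simmap_inv k).
Proof.
rewrite -subr_gt0 -/(gap k) /simmap /simmap_inv => /lt0r_neq0 g0 t.
by case: (e k); rewrite ?subKr ?addrK mulrC mulKf.
Qed.

Lemma simmap_invK (k : 'I_n) : lknot k < rknot k ->
  cancel (simmap_inv k) (simmap k).
Proof.
rewrite -subr_gt0 -/(gap k) /simmap /simmap_inv => /lt0r_neq0 g0 t.
by case: (e k); rewrite mulrC divfK// ?subKr ?subrK.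
Qed.

Definition simop (f : R -> R) (t : R) : R :=
  \sum_(k < n) (d k * f (simmap_inv k t) + beta k) *
               \1_(`]lknot k, rknot k[%classic) t.

(* f(t+0), with the convention f(1+0) = f(1) *)
Definition right_value (f : R -> R) (t : R) : R :=
  if t < 1 then lim (f x @[x --> t^'+]) else f t.

(* f is the representative on [0,1] of the fixed point of the similarity
   operator in L_oo(]0,1[) that has bounded variation, is left-continuous on
   ]0,1] and takes the value f(0+) at 0; these conditions determine f on
   [0,1]. *)
Definition similarity_fixpoint (f : R -> R) : Prop :=
  [/\ {ae (@lebesgue_measure R), forall t, 0 < t < 1 -> simop f t = f t},
      bounded_variation 0 1 f,
      forall t : R, 0 < t <= 1 -> f x @[x --> t^'-] --> f t
    & f x @[x --> 0^'+] --> f 0].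

(* mu is a probability on the Borel sets of the line carried by [0,1]. *)
Definition degenerate_self_similar (m : 'I_n)
    (mu : probability (measurableTypeR R) R) : Prop :=
  [/\ (2 <= n)%N,
      [/\ alpha ord0 = 0, alpha ord_max = 1
        & forall i j : 'I_n.+1, (i < j)%N -> alpha i < alpha j],
      [/\ d m != 0, forall k, k != m -> d k = 0 & `|d m| < 1],
      mu `[0, 1]%classic = 1%E
    & exists f : R -> R,
      [/\ similarity_fixpoint f,
          forall k : 'I_n.+1, (0 < k < n)%N ->
            right_value f (alpha k) != f (alpha k)
        & forall a b : R, 0 <= a -> a <= b -> b <= 1 ->
            mu `[a, b]%classic = (right_value f b - f a)%:E]].

End similarity.

Section processes.
Context {R : realType} {disp : measure_display} {Omega : measurableType disp}.
Variable P : probability Omega R.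
Implicit Types (X W : R -> Omega -> R) (D : set R).

(* normal_prob is a Gaussian law only for a nonzero standard deviation, so the
   degenerate laws are added separately. *)
Definition gaussian_variable (Y : Omega -> R) : Prop :=
  measurable_fun setT Y /\
  ((exists mean sd : R, 0 < sd /\
      forall A : set (measurableTypeR R), measurable A ->
        pushforward P Y A = normal_prob mean sd A) \/
   (exists c : R, forall A : set (measurableTypeR R), measurable A ->
        pushforward P Y A = dirac c A)).

Definition gaussian_process D X : Prop :=
  forall (k : nat) (t c : 'I_k -> R), (forall i, D (t i)) ->
    gaussian_variable (fun w => \sum_(i < k) c i * X (t i) w).

Definition centered_gaussian_process D (K : R -> R -> R) X : Prop :=
  [/\ gaussian_process D X,
      forall t : R, D t -> ('E_P[X t] = 0)%E
    & forall s t : R, D s -> D t -> covariance P (X s) (X t) = (K s t)%:E].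

Definition wiener_process (T : R) W : Prop :=
  centered_gaussian_process `[0, T]%classic Num.min W /\
  forall w, {within `[0, T]%classic, continuous (fun t => W t w)}.

Definition bridge W : R -> Omega -> R := fun t w => W t w - t * W 1 w.

Definition center_path X : R -> Omega -> R :=
  fun t w => X t w - \int[@lebesgue_measure R]_(s in `[0, 1]) X s w.

Definition ou_cov (a s t : R) : R := expR (- a * `|s - t|) / (2 * a).

Definition ou0_cov (a s t : R) : R :=
  (expR (- a * `|s - t|) - expR (- a * (s + t))) / (2 * a).

Definition bogolyubov_cov (a s t : R) : R :=
  (2 * a)^-1 *
  ((expR (a * `|s - t|) + expR (a - a * `|s - t|)) / (expR a - 1)).

Inductive listed_process : (R -> Omega -> R) -> Prop :=
| Wiener W : wiener_process 1 W -> listed_process W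
| BrownianBridge W : wiener_process 1 W -> listed_process (bridge W)
| CenteredWiener W : wiener_process 1 W -> listed_process (center_path W)
| CenteredBridge W : wiener_process 1 W ->
    listed_process (center_path (bridge W))
| ElongatedBridge W (u : R) : wiener_process 1 W -> u < 1 ->
    listed_process (fun t w => W t w - u * t * W 1 w)
| Slepian W (c : R) : 1 <= c -> wiener_process (1 + c) W ->
    listed_process (fun t w => W (t + c) w - W t w)
| OrnsteinUhlenbeck X (a : R) : 0 < a ->
    centered_gaussian_process `[0, 1]%classic (ou_cov a) X -> listed_process X
| OrnsteinUhlenbeck0 X (a : R) : a != 0 ->
    centered_gaussian_process `[0, 1]%classic (ou0_cov a) X -> listed_process X
| Bogolyubov X (a : R) : 0 < a ->
    centered_gaussian_process `[0, 1]%classic (bogolyubov_cov a) X ->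
    listed_process X.

(* Extended-real valued, since the integral may be infinite on a P-null set *)
Definition path_norm (mu : probability (measurableTypeR R) R) X (w : Omega)
    : \bar R :=
  ((\int[mu]_(t in `[0%R, 1%R]) ((X t w) ^+ 2)%:E) `^ (2^-1)%R)%E.

Definition small_ball_prob (mu : probability (measurableTypeR R) R) X (eps : R)
    : R :=
  fine (P [set w | (path_norm mu X w <= eps%:E)%E]).

End processes.

(* Main.v *)
(* Write [delta = |d_m|], [a = a_m], [q = delta * a]. The measure is carried by
   the points S_m^J (alpha_k), 1 < k <= n, whose masses are of order
   [delta ^ J], and at scale [J] these atoms bound n - 1 nonoverlapping
   intervals of length of order [a ^ J]. The increments of each process over
   short disjoint intervals are those of a Wiener process up to errors of higher
   order, so the squared norm behaves like \sum_J q ^ J * (xi_J1 ^ 2 + ... +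
   xi_J(n-1) ^ 2) with independent standard normal variables xi. Its Laplace
   transform at [lambda] is a product of factors
   (1 + 2 * lambda * q ^ J) ^ (- (n - 1) / 2); for [lambda] close to eps ^ -2
   about 2 * ln (1 / eps) / ln (1 / q) of them matter, and summing the
   arithmetic progression of their logarithms gives the claim.
   For the upper bound only fine scales are used, where the Gram matrix of the
   increments dominates half its diagonal; the lower bound is Hadamard's
   inequality for the determinant computing the Laplace transform. *)
From mathcomp Require Import measurable_realfun ring lra.
Require Import Defs.

Set Implicit Arguments.
Unset Strict Implicit.
Unset Printing Implicit Defensive.

Local Open Scope classical_set_scope.
Local Open Scope ring_scope.

(** * Normal laws *)

(** The law of the energy is never computed and no family is made independent. In a Gaussian space
    the Laplace transform of a sum of squares is a product of factors [(1 + v)^(-1/2)], where [v] is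
    the variance of one variable left over after weighting by the others already treated. Both
    bounds thus reduce to bounds on leftover variances. The upper bound must use increments: all
    values of the process near the accumulation point are strongly correlated, while increments over
    disjoint intervals have covariances of the order of the product of lengths. This is harmless
    only when the total length is small, and dropping the finitely many coarse scales costs
    [O(ln (1 / eps))] in the exponent. With [s = sqrt (ln (1 / eps))], the lower bound takes
    [lambda = eps^-2 * exp s]: the loss in Markov's inequality is then [exp (- exp s)], negligible
    against [exp (- O(s^4))], while the exponent changes only by [O(s^3)]. Paths need not be
    measurable in time, so the integral has to be reduced to a countable set of atoms by hand. *)

Lemma integrable_dominated {d} {T : measurableType d} {R : realType}
    (mu : {measure set T -> \bar R}) (f g : T -> R) :
  measurable_fun setT f -> (forall x, `|f x| <= g x) ->
  mu.-integrable setT (EFin \o g) -> mu.-integrable setT (EFin \o f).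
Proof.
move=> mf fg; apply: (@le_integrable _ _ _ mu setT measurableT).
  exact/measurable_EFinP.
by move=> x _ /=; rewrite lee_fin (le_trans (fg x))// ler_norm.
Qed.

Lemma Rintegral_dominated_cvg {d} {T : measurableType d} {R : realType}
    (mu : {measure set T -> \bar R}) (f_ : nat -> T -> R) (f g : T -> R) :
  (forall n, measurable_fun setT (f_ n)) -> measurable_fun setT f ->
  (forall x, f_ n x @[n --> \oo] --> f x) ->
  mu.-integrable setT (EFin \o g) -> (forall n x, `|f_ n x| <= g x) ->
  \int[mu]_x f_ n x @[n --> \oo] --> \int[mu]_x f x.
Proof.
move=> mf_ mf ff gi fg.
have fi : mu.-integrable setT (EFin \o f).
  apply: (integrable_dominated _ _ gi) => // x.
  have : `|f_ n x| @[n --> \oo] --> `|f x| by apply: cvg_norm; exact: ff.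
  move=> /(@cvg_lim _ _ _) <- //; apply: limr_le.
    by apply: cvgP; apply: cvg_norm; exact: ff.
  by near=> n; exact: fg.
apply: fine_cvg; rewrite fineK; last exact: integrable_fin_num.
apply: (@dominated_cvg _ _ _ mu setT measurableT
  (fun n => EFin \o f_ n) (EFin \o f) (EFin \o g)) => //.
- by move=> n; exact/measurable_EFinP.
- by move=> x _ /=; apply: cvg_EFin; [exact: nearW|exact: ff].
- by move=> n x _ /=; rewrite lee_fin.
Unshelve. all: by end_near. Qed.

Lemma Rintegral_probability_cst {d} {T : measurableType d} {R : realType}
  (P : probability T R) (c : R) : \int[P]__ c = c.
Proof.
rewrite Rintegral_cst// (_ : fine _ = 1) ?mulr1//.
exact: (congr1 fine (probability_setT P)).
Qed.

Section normal_integrals.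
Context {R : realType}.
Local Notation leb := (@lebesgue_measure R).
Implicit Types (m s t x y : R) (f F : R -> R).

(** The Radon-Nikodym derivative of the normal law agrees almost everywhere with [normal_pdf],
    because both have the same integrals over measurable sets. *)
Lemma ge0_integral_normal_prob m s f : measurable_fun setT f ->
  (forall x, 0 <= f x) ->
  (\int[normal_prob m s]_x (f x)%:E =
   \int[leb]_x (f x * normal_pdf m s x)%:E)%E.
Proof.
move=> mf f0; have dom := normal_prob_dominates m s.
rewrite -(Radon_Nikodym_SigmaFinite.change_of_variables dom)//; last exact/measurable_EFinP.
have mpdf : measurable_fun setT (EFin \o normal_pdf m s).
  by apply/measurable_EFinP; exact: measurable_normal_pdf.
apply: ae_eq_integral => //.
- apply: emeasurable_funM; first exact/measurable_EFinP.
  exact: measurable_int (Radon_Nikodym_SigmaFinite.f_integrable dom).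
- apply/measurable_EFinP; apply: measurable_funM => //.
  exact: measurable_normal_pdf.
under [X in ae_eq _ _ _ X]eq_fun do rewrite EFinM.
apply: ae_eqe_mul2l; apply: integral_ae_eq => //.
- exact: Radon_Nikodym_SigmaFinite.f_integrable.
- by move=> A _ mA; rewrite -Radon_Nikodym_SigmaFinite.f_integral.
Qed.

Lemma integrable_normal_probP m s f : measurable_fun setT f ->
  (normal_prob m s).-integrable setT (EFin \o f) <->
  leb.-integrable setT (fun x => (f x * normal_pdf m s x)%:E).
Proof.
move=> mf; have mpdf := @measurable_normal_pdf R m s.
have E : (\int[normal_prob m s]_x `|(f x)%:E| =
          \int[leb]_x `|(f x * normal_pdf m s x)%:E|)%E.
  rewrite (ge0_integral_normal_prob m s (f := fun x => `|f x|))//.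
    by apply: eq_integral => x _; rewrite abse_EFin normrM (ger0_norm (normal_pdf_ge0 _ _ _)).
  exact: measurableT_comp.
split=> /integrableP[_ fi]; apply/integrableP; split.
- by apply/measurable_EFinP; exact: measurable_funM.
- by rewrite -E.
- exact/measurable_EFinP.
- by rewrite E.
Qed.

Lemma Rintegral_normal_prob m s f : measurable_fun setT f ->
  (normal_prob m s).-integrable setT (EFin \o f) ->
  \int[normal_prob m s]_x f x = \int[leb]_x (f x * normal_pdf m s x).
Proof.
move=> mf fi; have pdf0 := @normal_pdf_ge0 R m s.
have fi' := (integrable_normal_probP m s mf).1 fi.
(* Both terms of this difference are nonnegative and integrable, which reduces the claim to the
   nonnegative case. *)
have pn x : f x = `|f x| - (`|f x| - f x) by rewrite subKr.
have mn : measurable_fun setT (fun x => `|f x|) by exact: measurableT_comp.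
have mg : measurable_fun setT (fun x => `|f x| - f x) by exact: measurable_funB.
have ni : (normal_prob m s).-integrable setT (EFin \o (fun x => `|f x|)).
  exact: integrable_norm.
have gi : (normal_prob m s).-integrable setT (EFin \o (fun x => `|f x| - f x)).
  exact: (integrableB measurableT ni fi).
under eq_Rintegral do rewrite pn.
rewrite RintegralB//.
under [RHS]eq_Rintegral do rewrite pn mulrBl.
rewrite [RHS]RintegralB//; try exact/integrable_normal_probP.
rewrite /Rintegral; congr (fine _ - fine _); rewrite ge0_integral_normal_prob//.
by move=> x; rewrite subr_ge0 ler_norm.
Qed.

(* Completing the square: exponential tilting shifts the mean. *)
Lemma expR_normal_pdf m s t x : s != 0 ->
  expR (t * x) * normal_pdf m s x =
  expR (m * t + s ^+ 2 * t ^+ 2 / 2) * normal_pdf (m + s ^+ 2 * t) s x.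
Proof.
move=> s0; rewrite !normal_pdfE// mulrCA [RHS]mulrCA; congr (_ * _).
rewrite /normal_fun -!expRD; congr expR; field.
by rewrite s0.
Qed.

Lemma integrable_expR_normal_prob m s t : s != 0 ->
  (normal_prob m s).-integrable setT (EFin \o (fun x => expR (t * x))).
Proof.
move=> s0; apply/integrable_normal_probP.
  by apply: measurableT_comp => //; exact: mulrl_measurable.
under eq_fun do rewrite expR_normal_pdf// EFinM.
by apply: integrableZl => //; exact: integrable_normal_pdf.
Qed.

Lemma sqr_le_expR (x : R) : x ^+ 2 <= 2 * (expR x + expR (- x)).
Proof.
have half y : 0 <= y -> y ^+ 2 <= 2 * expR y.
  move=> y0; have := expR_ge1Dxn 1 y0; rewrite (_ : (2`!)%:R = 2 :> R)// => h.
  have -> : y ^+ 2 = 2 * (y ^+ 2 / 2) by field.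
  by rewrite ler_pM2l//; lra.
have [x0|x0] := leP 0 x.
  by have := half _ x0; have := expR_gt0 (- x); lra.
have /half : 0 <= - x by lra.
by rewrite sqrrN; have := expR_gt0 x; lra.
Qed.

Lemma integrable_sqr_normal_prob m s : s != 0 ->
  (normal_prob m s).-integrable setT (EFin \o (fun x => x ^+ 2)).
Proof.
move=> s0; apply: (@integrable_dominated _ _ _ _ _
  (fun x : measurableTypeR R => 2 * (expR x + expR (- x)) : R)) => //.
- by move=> x /=; rewrite ger0_norm ?sqr_ge0//; exact: sqr_le_expR.
- have -> : (EFin \o (fun x => 2 * (expR x + expR (- x)))) =
      (fun x => 2%:E * ((EFin \o (fun x => expR (1 * x))) \+ (EFin \o (fun x => expR ((-1) * x)))) x)%E.
    by apply/funext => x /=; rewrite !EFinM mul1r mulN1r EFinD.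
  apply: integrableZl => //; apply: integrableD => //; exact: integrable_expR_normal_prob.
Qed.

Lemma integrable_id_normal_prob m s : s != 0 ->
  (normal_prob m s).-integrable setT (EFin \o (fun x => x)).
Proof.
move=> s0; apply: (@integrable_dominated _ _ _ _ _
  (fun x : measurableTypeR R => 1 + x ^+ 2 : R)) => //.
- move=> x /=; have := sqr_ge0 (`|x| - 1); rewrite sqrrB1 real_normK ?num_real//.
  by have := normr_ge0 x; lra.
- apply: (@integrableD _ _ _ _ _ measurableT (EFin \o cst 1)
    (EFin \o (fun x : measurableTypeR R => x ^+ 2 : R))).
    exact: finite_measure_integrable_cst.
  exact: integrable_sqr_normal_prob.
Qed.

End normal_integrals.

(** * Stein's identity, moments and characteristic function of normal laws *)

Section stein.
Context {R : realType}.
Local Notation leb := (@lebesgue_measure R).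
Implicit Types (m s t x y : R) (f F : R -> R).

(** Since [F] decays like [1 / |x|], the boundary terms of the fundamental theorem of calculus on
    growing symmetric intervals tend to 0. *)
Lemma integral_derive_eq0 (F f : R -> R) (K : R) :
  (forall x : R, is_derive x 1 F (f x)) -> continuous f ->
  leb.-integrable setT (EFin \o f) -> (forall x, `|F x| * `|x| <= K) ->
  \int[leb]_x f x = 0.
Proof.
move=> dF cf fi FK.
have mf : measurable_fun setT f by exact: continuous_measurable_fun.
have cF : continuous F.
  by move=> x; apply/differentiable_continuous/derivable1_diffP; case: (dF x).
pose I n : set (measurableTypeR R) := `[- n.+1%:R, n.+1%:R]%classic.
pose g n := f \_ (I n).
have mI n : measurable (I n) by exact: measurable_itv.
have gE n : \int[leb]_x g n x = F n.+1%:R - F (- n.+1%:R).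
  rewrite -Rintegral_mkcond /I /Rintegral (@continuous_FTC2 R f F)//.
  - by rewrite (lt_trans (y := 0)) ?oppr_lt0 ?ltr0n.
  - exact: continuous_subspaceT.
  - split; [by move=> x _; case: (dF x)|exact/cvg_at_right_filter/cF|exact/cvg_at_left_filter/cF].
  - by move=> x _; rewrite derive1E; case: (dF x).
have lim1 : \int[leb]_x g n x @[n --> \oo] --> \int[leb]_x f x.
  apply: (@Rintegral_dominated_cvg _ _ _ leb g f (fun x => `|f x|)) => //.
  - by move=> n; apply/(measurable_restrictT _ _).1 => //; exact: measurable_funTS.
  - move=> x; apply: cvg_near_cst; near=> n; rewrite /g patchE mem_set//=.
    rewrite /I/= in_itv/= -ler_norml; apply: ltW; apply: (lt_le_trans (y := n%:R)); last by rewrite ler_nat.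
    by near: n; exact: nbhs_infty_gtr.
  - exact: integrable_norm.
  - by move=> n x; rewrite /g patchE; case: ifP => // _; rewrite normr0.
have lim2 : \int[leb]_x g n x @[n --> \oo] --> (0 : R).
  under eq_fun do rewrite gE.
  apply: (@squeeze_cvgr _ _ _ _ (fun n => - (2 * K * n.+1%:R^-1)) (fun n => 2 * K * n.+1%:R^-1)).
  - near=> n; rewrite -ler_norml.
    have n0 : (0 : R) < n.+1%:R by rewrite ltr0n.
    rewrite ler_pdivlMr//; have h1 := FK n.+1%:R; have h2 := FK (- n.+1%:R).
    rewrite (gtr0_norm n0) in h1; rewrite normrN (gtr0_norm n0) in h2.
    apply: (le_trans (ler_wpM2r (ltW n0) (ler_normB _ _))).
    by rewrite mulrDl; lra.
  - rewrite -oppr0 -(mulr0 (2 * K)); apply: cvgN; apply: cvgMr; exact: cvg_harmonic.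
  - rewrite -(mulr0 (2 * K)); apply: cvgMr; exact: cvg_harmonic.
by rewrite (cvg_unique _ lim1 lim2).
Unshelve. all: by end_near. Qed.

Lemma is_derive_normal_pdf m s x : s != 0 ->
  is_derive x (1 : R) (normal_pdf m s) (- ((x - m) / s ^+ 2) * normal_pdf m s x).
Proof.
move=> s0; rewrite normal_pdfE//.
rewrite /normal_fun.
apply: is_derive_eq.
rewrite !scaler0 !add0r; rewrite /GRing.scale/=; by field.
Qed.

(** Against Lebesgue measure the integrand is the derivative of [h * normal_pdf m s]. The choices
    [h = 1], [h = id] and [h = sin (a * x + y)] yield the mean, the variance and the characteristic
    function. *)
Lemma stein m s (h h' : R -> R) (C : R) : s != 0 ->
  (forall x : R, is_derive x 1 h (h' x)) -> continuous h' ->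
  (forall x, `|h x| <= 1 + `|x|) -> (forall x, `|h' x| <= C) ->
  \int[normal_prob m s]_x (h' x - h x * ((x - m) / s ^+ 2)) = 0.
Proof.
move=> s0 dh ch' hb hC; set k := fun x => _.
have s2 : 0 < s ^+ 2 by rewrite exprn_even_gt0.
have ch : continuous h.
  by move=> x; apply/differentiable_continuous/derivable1_diffP; case: (dh x).
have ck : continuous k.
  move=> x; apply: cvgB; first exact: ch'.
  apply: cvgM; first exact: ch.
  by apply: cvgMl; apply: cvgB; [exact: cvg_id|exact: cvg_cst].
have mk : measurable_fun setT k by exact: continuous_measurable_fun.
have xb (x : R) : `|x| <= 1 + x ^+ 2.
  have := sqr_ge0 (`|x| - 1); rewrite sqrrB1 real_normK ?num_real//.
  by have := normr_ge0 x; lra.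
have ki : (normal_prob m s).-integrable setT (EFin \o k).
  pose c0 := 2 * (1 + `|m|) / s ^+ 2.
  apply: (@integrable_dominated _ _ _ _ _
    (fun x : measurableTypeR R => C + c0 * (1 + x ^+ 2) : R)) => //.
    move=> x; apply: (le_trans (ler_normB _ _)); apply: lerD => //.
    rewrite !normrM normfV (gtr0_norm s2) mulrA /c0 [leRHS]mulrAC ler_pM2r ?invr_gt0//.
    have h1 : `|x - m| <= `|x| + `|m| by exact: ler_normB.
    have m0 := normr_ge0 m; have x0 := normr_ge0 x.
    apply: (le_trans (ler_pM (normr_ge0 _) (normr_ge0 _) (hb x) h1)).
    rewrite -[x ^+ 2]real_normK ?num_real//.
    by have := sqr_ge0 (`|x| - 1); nra.
  apply: (@integrableD _ _ _ _ _ measurableT (EFin \o cst C)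
    (EFin \o (fun x : measurableTypeR R => c0 * (1 + x ^+ 2) : R))) => //.
    exact: finite_measure_integrable_cst.
  apply: (@integrableZl _ _ _ _ _ measurableT c0
    (EFin \o (fun x : measurableTypeR R => 1 + x ^+ 2 : R))).
  apply: (@integrableD _ _ _ _ _ measurableT (EFin \o cst 1)
    (EFin \o (fun x : measurableTypeR R => x ^+ 2 : R))).
    exact: finite_measure_integrable_cst.
  exact: integrable_sqr_normal_prob.
rewrite (Rintegral_normal_prob mk ki).
have kpi := (integrable_normal_probP m s mk).1 ki.
pose p := normal_pdf m s.
have p0 x : 0 <= p x by exact: normal_pdf_ge0.
have dp x := is_derive_normal_pdf m x s0.
(* Indeed [|h x| * |x| <= 1 + 4 * exp x + 4 * exp (- x)]; tilting turns each exponential times the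
   density into a constant times a shifted density, and every density is at most [normal_peak s]. *)
pose K1 := normal_peak s * (1 + 4 * expR (m * 1 + s ^+ 2 * 1 ^+ 2 / 2) +
                        4 * expR (m * (-1) + s ^+ 2 * (-1) ^+ 2 / 2)).
apply: (@integral_derive_eq0 (fun x => h x * p x) (fun x => k x * p x) K1).
- move=> x; apply: is_derive_eq; rewrite /k /p /GRing.scale/=; ring.
- by move=> x; apply: cvgM; [exact: ck|exact: continuous_normal_pdf].
- exact: kpi.
- move=> x; rewrite normrM (ger0_norm (p0 x)).
  apply: (@le_trans _ _ ((1 + 4 * expR (1 * x) + 4 * expR ((-1) * x)) * p x)).
    rewrite mulrAC; apply: ler_wpM2r => //; rewrite mul1r mulN1r.
    have h1 := ler_wpM2r (normr_ge0 x) (hb x).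
    have h2 := sqr_le_expR x; have h3 := xb x.
    rewrite mulrDl mul1r -expr2 real_normK ?num_real// in h1.
    by move: h1 h2 h3; lra.
  have -> : (1 + 4 * expR (1 * x) + 4 * expR ((-1) * x)) * p x =
    p x + 4 * (expR (1 * x) * p x) + 4 * (expR ((-1) * x) * p x) by ring.
  rewrite /p (expR_normal_pdf m 1 x s0) (expR_normal_pdf m (-1) x s0) /K1.
  have u1 := @normal_pdf_ub R m s x s0.
  have u2 := @normal_pdf_ub R (m + s ^+ 2 * 1) s x s0.
  have u3 := @normal_pdf_ub R (m + s ^+ 2 * -1) s x s0.
  have e1 := expR_ge0 (m * 1 + s ^+ 2 * 1 ^+ 2 / 2).
  have e2 := expR_ge0 (m * (-1) + s ^+ 2 * (-1) ^+ 2 / 2).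
  have h2 := ler_wpM2l e1 u2; have h3 := ler_wpM2l e2 u3.
  by move: u1 h2 h3; lra.
Qed.

Lemma normal_prob_mean m s : s != 0 -> \int[normal_prob m s]_x x = m.
Proof.
move=> s0; have s2 : 0 < s ^+ 2 by rewrite exprn_even_gt0.
have := @stein m s (cst 1) (cst 0) 0 s0 (fun x => is_derive_cst _ _ _).
move=> /(_ (fun x => cvg_cst _)) H.
have {H}: \int[normal_prob m s]_x (- (s ^+ 2)^-1 * (x - m)) = 0.
  rewrite -[RHS]H; first by apply: eq_Rintegral => x _ /=; field.
    by move=> x /=; rewrite normr1 lerDl.
  by move=> x /=; rewrite normr0.
have idi := @integrable_id_normal_prob R m s s0.
have ci : (normal_prob m s).-integrable setT (EFin \o cst m).
  exact: finite_measure_integrable_cst.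
rewrite RintegralZl//; last exact: (integrableB measurableT idi ci).
move/eqP; rewrite mulf_eq0 oppr_eq0 invr_eq0 (gt_eqF s2)/=.
by rewrite RintegralB// (Rintegral_probability_cst (normal_prob m s)) subr_eq0 => /eqP.
Qed.

Lemma normal_prob_second_moment s : s != 0 ->
  \int[normal_prob 0 s]_x (x ^+ 2) = s ^+ 2.
Proof.
move=> s0; have s2 : 0 < s ^+ 2 by rewrite exprn_even_gt0.
have := @stein 0 s id (cst 1) 1 s0 (fun x => is_derive_id _ _).
move=> /(_ (fun x => cvg_cst _)) H.
have {H}: \int[normal_prob 0 s]_x (1 - (s ^+ 2)^-1 * x ^+ 2) = 0.
  rewrite -[RHS]H; first by apply: eq_Rintegral => x _ /=; field.
    by move=> x /=; rewrite lerDr.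
  by move=> x /=; rewrite normr1.
have sqi := @integrable_sqr_normal_prob R 0 s s0.
rewrite RintegralB//; last 2 first.
- exact: finite_measure_integrable_cst.
- exact: (integrableZl measurableT _ sqi).
rewrite RintegralZl// (Rintegral_probability_cst (normal_prob 0 s)).
move/eqP; rewrite subr_eq0 => /eqP h.
by apply: (mulfI (invr_neq0 (lt0r_neq0 s2))); rewrite -h mulVf// gt_eqF.
Qed.

Lemma integrable_cos_normal_prob m s t y :
  (normal_prob m s).-integrable setT (EFin \o (fun x => cos (t * x + y))).
Proof.
apply: (@integrable_dominated _ _ _ _ _ (cst 1)) => //.
- by apply: continuous_measurable_fun => x; apply: continuous_comp;
    [apply: cvgD; [apply: cvgMr; exact: cvg_id|exact: cvg_cst]|exact: continuous_cos].
- by move=> x /=; rewrite ler_norml cos_geN1 cos_le1.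
- exact: finite_measure_integrable_cst.
Qed.

(** As a function [F] of [t], the integral satisfies [F' = - s^2 * t * F], by differentiation under
    the integral and Stein's identity for the sine; hence [exp (s^2 * t^2 / 2) * F] is constant. The
    phase [y] makes room for a second variable when Fubini's theorem is applied later. *)
Lemma normal_prob_cos s t y : s != 0 ->
  \int[normal_prob 0 s]_x cos (t * x + y) =
  cos y * expR (- (s ^+ 2 * t ^+ 2 / 2)).
Proof.
move=> s0; pose F t := \int[normal_prob 0 s]_x cos (t * x + y).
have s2 : 0 < s ^+ 2 by rewrite exprn_even_gt0.
have dcos (a x : R) : is_derive (a : R) (1 : R) (fun a => cos (a * x + y)) (- (x * sin (a * x + y))).
  by apply: is_derive_eq; rewrite /GRing.scale/=; ring.
have dF (a : R) : is_derive (a : R) (1 : R) F (- (s ^+ 2 * a) * F a).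
  have E := @differentiation_under_integral R _ _ (normal_prob 0 s)
    (fun a x => cos (a * x + y)) setT measurableT a (a - 1) (a + 1).
  have D := @derivable_under_integral R _ _ (normal_prob 0 s)
    (fun a x => cos (a * x + y)) setT measurableT a (a - 1) (a + 1).
  have aI : `](a - 1), (a + 1)[%classic a by rewrite /= in_itv/= ltrBlDr ltrDl ltr01.
  have intf (x : R) : `](a - 1), (a + 1)[%classic x -> (normal_prob 0 s).-integrable
      [set: measurableTypeR R] (EFin \o (fun z => cos (x * z + y))).
    by move=> _; exact: integrable_cos_normal_prob.
  have p1 x z : partial1of2 (fun a x => cos (a * x + y)) x z = - (z * sin (x * z + y)).
    by rewrite partial1of2E; have [_ ->] := dcos x z.
  have {}E := E aI intf (fun x z _ _ => @ex_derive _ _ _ _ _ _ _ (dcos x z))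
    (fun z => `|z|) (fun z => normr_ge0 z).
  have {}D := D aI intf (fun x z _ _ => @ex_derive _ _ _ _ _ _ _ (dcos x z))
    (fun z => `|z|) (fun z => normr_ge0 z).
  have ni : (normal_prob 0 s).-integrable [set: measurableTypeR R] (EFin \o (fun z => `|z|)).
    by apply: integrable_norm; exact: integrable_id_normal_prob.
  have bd (x z : R) : `](a - 1), (a + 1)[%classic x -> [set: R] z ->
      `|partial1of2 (fun a x => cos (a * x + y)) x z| <= `|z|.
    move=> _ _; rewrite p1 normrN normrM ler_piMr//.
    by rewrite ler_norml sin_geN1 sin_le1.
  apply: DeriveDef; first exact: D ni bd.
  rewrite -derive1E (E ni bd).
  have dsin (x : R) : is_derive (x : R) (1 : R) (fun x => sin (a * x + y)) (a * cos (a * x + y)).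
    by apply: is_derive_eq; rewrite /GRing.scale/=; ring.
  have cc : continuous (fun x => a * cos (a * x + y)).
    move=> x; apply: cvgMr; apply: continuous_comp; last exact: continuous_cos.
    by apply: cvgD; [apply: cvgMr; exact: cvg_id|exact: cvg_cst].
  have h1 (x : R) : `|sin (a * x + y)| <= 1 + `|x|.
    have : `|sin (a * x + y)| <= 1 by rewrite ler_norml sin_geN1 sin_le1.
    by have := normr_ge0 x; lra.
  have h2 (x : R) : `|a * cos (a * x + y)| <= `|a|.
    by rewrite normrM ler_piMr// ler_norml cos_geN1 cos_le1.
  have ci := integrable_cos_normal_prob 0 s a y.
  have si : (normal_prob 0 s).-integrable [set: measurableTypeR R]
      (EFin \o (fun z => - (z * sin (a * z + y)))).
    apply: (integrable_dominated _ _ ni) => [|z].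
      apply: continuous_measurable_fun => x; apply: cvgN; apply: cvgM; first exact: cvg_id.
      by apply: differentiable_continuous; apply/derivable1_diffP; case: (dsin x).
    by rewrite -p1; apply: bd aI _.
  have := stein 0 s0 dsin cc h1 h2.
  have -> : \int[normal_prob 0 s]_x (a * cos (a * x + y) - sin (a * x + y) * ((x - 0) / s ^+ 2))
     = \int[normal_prob 0 s]_x (a * cos (a * x + y) + (s ^+ 2)^-1 * (- (x * sin (a * x + y)))).
    by apply: eq_Rintegral => x _; field.
  rewrite RintegralD//; last 2 first.
  - exact: (integrableZl measurableT _ ci).
  - exact: (integrableZl measurableT _ si).
  rewrite RintegralZl// RintegralZl// -/(F a) => hF.
  under eq_Rintegral do rewrite p1.
  apply: (mulfI (invr_neq0 (lt0r_neq0 s2))); move: hF.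
  set I1 := \int[_]_x - _; move=> /eqP; rewrite addr_eq0 => /eqP hF.
  by rewrite mulrA mulrN mulNr mulrA mulVf ?gt_eqF// mul1r hF opprK.
have dG (a : R) : is_derive (a : R) (1 : R) (fun a => expR (s ^+ 2 * a ^+ 2 / 2) * F a) 0.
  have dFa := dF a.
  apply: is_derive_eq; rewrite /GRing.scale/=.
  by rewrite !mulr0 add0r !mulr1; move: (expR _) (F a) => X Y; field.
have := is_derive_0_is_cst t 0 dG.
rewrite expr0n/= mulr0 mul0r expR0 mul1r => h.
rewrite /F in h.
have -> : cos y = \int[normal_prob 0 s]_x cos (0 * x + y).
  under eq_Rintegral do rewrite mul0r add0r.
  by rewrite (Rintegral_probability_cst (normal_prob 0 s)).
by rewrite -h mulrAC -expRD subrr expR0 mul1r.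
Qed.

End stein.

Section gaussian_integral.
Context {R : realType}.
Local Notation leb := (@lebesgue_measure R).

Lemma measurable_expR_quadratic (A B C : R) :
  measurable_fun [set: R] (fun x : R => expR (- ((A + 2 * B * x + C * x ^+ 2) / 2))).
Proof.
apply: continuous_measurable_fun => x.
apply: continuous_comp; last exact: continuous_expR.
apply: cvgN; apply: cvgMl; apply: cvgD; last by apply: cvgMr; exact: exprn_continuous.
by apply: cvgD; [exact: cvg_cst|apply: cvgMr; exact: cvg_id].
Qed.

(** Completing the square makes the integrand times the standard density a multiple of the normal
    density of mean [- B / (1 + C)] and variance [1 / (1 + C)]. *)
Lemma normal_prob_expR_quadratic (A B C : R) : 0 <= C ->
  \int[normal_prob 0 1]_x expR (- ((A + 2 * B * x + C * x ^+ 2) / 2)) =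
  (Num.sqrt (1 + C))^-1 * expR (- ((A - B ^+ 2 / (1 + C)) / 2)).
Proof.
move=> C0; have C1 : 0 < 1 + C by lra.
set K := RHS; pose sg := (Num.sqrt (1 + C))^-1.
have sg0 : 0 < sg by rewrite invr_gt0 sqrtr_gt0.
have sg2 : sg ^+ 2 = (1 + C)^-1 by rewrite exprVn sqr_sqrtr// ltW.
have pt x : expR (- ((A + 2 * B * x + C * x ^+ 2) / 2)) * normal_pdf 0 1 x =
    K * normal_pdf (- B / (1 + C)) sg x.
  rewrite !normal_pdfE ?oner_neq0 ?gt_eqF//.
  have -> : normal_peak (1 : R) = sg * normal_peak sg.
    rewrite /normal_peak expr1n mul1r -mulrnAr sqrtrM ?sqr_ge0// sqrtr_sqr gtr0_norm//.
    by rewrite invfM mulVKf// gt_eqF.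
  rewrite mulrCA -!mulrA; congr (_ * _); rewrite [RHS]mulrCA; congr (_ * _).
  rewrite /normal_fun -!expRD; congr expR.
  by rewrite subr0 expr1n sg2; field; rewrite gt_eqF.
rewrite /Rintegral ge0_integral_normal_prob//; last exact: measurable_expR_quadratic.
under eq_integral do rewrite pt EFinM.
rewrite integralZl//; last exact: integrable_normal_pdf.
by rewrite integral_normal_pdf mule1.
Qed.

End gaussian_integral.

Section gaussian_variables.
Context {R : realType} {disp : measure_display} {Omega : measurableType disp}.
Variable P : probability Omega R.

Lemma Rintegral_pushforward (Y : Omega -> R) (f : R -> R)
    (nu : {measure set (measurableTypeR R) -> \bar R}) :
  measurable_fun setT Y -> measurable_fun setT f ->
  (forall A : set (measurableTypeR R), measurable A -> pushforward P Y A = nu A) ->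
  nu.-integrable setT (EFin \o f) ->
  P.-integrable setT (EFin \o (f \o Y)) /\ \int[P]_w f (Y w) = \int[nu]_x f x.
Proof.
move=> mY mf YE fi.
have mYf : measurable_fun setT (f \o Y) by exact: measurableT_comp.
have E (g : R -> \bar R) : measurable_fun [set: measurableTypeR R] g -> (forall x, 0 <= g x)%E ->
    (\int[nu]_x g x = \int[P]_w g (Y w))%E.
  move=> mg g0.
  rewrite -[RHS](@ge0_integral_pushforward _ _ _ (measurableTypeR R) R Y mY P setT g)//.
  by apply: eq_measure_integral => A mA _; exact: (esym (YE A mA)).
have Yi : P.-integrable setT (EFin \o (f \o Y)).
  apply/integrableP; split; first exact/measurable_EFinP.
  move/integrableP : fi => [_].
  by rewrite (E (fun x => `|(f x)%:E|)%E)//; apply: measurableT_comp => //; exact/measurable_EFinP.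
split=> //.
rewrite /Rintegral; congr fine.
transitivity (\int[pushforward P (Y : Omega -> measurableTypeR R)]_x (f x)%:E)%E.
  by rewrite integral_pushforward//; exact/measurable_EFinP.
by apply: eq_measure_integral => A mA _; exact: (YE A mA).
Qed.

(** The degenerate laws obey the same formula, since a centered Dirac law sits at 0. Linear
    combinations of variance zero therefore need no separate treatment later. *)
Lemma gaussian_variable_centered (Y : Omega -> R) : gaussian_variable P Y ->
  P.-integrable setT (EFin \o Y) /\
  P.-integrable setT (EFin \o (fun w => Y w ^+ 2)) /\
  (('E_P[Y] = 0)%E ->
   \int[P]_w cos (Y w) = expR (- (\int[P]_w (Y w ^+ 2) / 2))).
Proof.
move=> [mY [[m [s [s0 YE]]]|[c YE]]].
- have s0' : s != 0 by rewrite gt_eqF.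
  have [i1 e1] := Rintegral_pushforward mY (@measurable_id _ _ _) YE
    (integrable_id_normal_prob m s0').
  have [i2 e2] := Rintegral_pushforward mY (exprn_measurable 2) YE
    (integrable_sqr_normal_prob m s0').
  split=> //; split=> //; rewrite unlock => EY.
  have m0 : m = 0 by apply: (etrans (esym (etrans e1 (normal_prob_mean m s0')))); rewrite /Rintegral EY.
  rewrite m0 in YE e2.
  have mc : measurable_fun setT (cos : R -> R).
    by apply: continuous_measurable_fun; exact: continuous_cos.
  have ci : (normal_prob 0 s).-integrable setT (EFin \o (cos : R -> R)).
    have := integrable_cos_normal_prob 0 s 1 0.
    by under eq_fun do rewrite /= mul1r addr0.
  have [_ e3] := Rintegral_pushforward mY mc YE ci.
  have e2' := etrans e2 (normal_prob_second_moment s0').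
  apply: (etrans e3); rewrite [X in _ = expR (- (X / 2))]e2'.
  have := normal_prob_cos 1 0 s0'; rewrite cos0 mul1r expr1n mulr1 => <-.
  by apply: eq_Rintegral => x _; rewrite mul1r addr0.
- have dirac_int (f : R -> R) : measurable_fun setT f ->
      (\d_ (c : measurableTypeR R)).-integrable setT (EFin \o f) /\
      \int[\d_ (c : measurableTypeR R)]_x f x = f c.
    move=> mf; split.
      apply/integrableP; split; first exact/measurable_EFinP.
      rewrite integral_dirac//; last by apply: measurableT_comp => //; exact/measurable_EFinP.
      by rewrite diracT mul1e ltry.
    rewrite /Rintegral integral_dirac//; last exact/measurable_EFinP.
    by rewrite diracT mul1e.
  have pushE := Rintegral_pushforward (nu := \d_ (c : measurableTypeR R)) mY _ YE.
  have [d1 d1'] := dirac_int id (@measurable_id _ _ _).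
  have [d2 d2'] := dirac_int _ (exprn_measurable 2).
  have mc : measurable_fun setT (cos : R -> R).
    by apply: continuous_measurable_fun; exact: continuous_cos.
  have [d3 d3'] := dirac_int _ mc.
  have [i1 e1] := pushE _ (@measurable_id _ _ _) d1.
  have [i2 e2] := pushE _ (exprn_measurable 2) d2.
  have [i3 e3] := pushE _ mc d3.
  split=> //; split=> //; rewrite unlock => EY.
  have c0 : c = 0 by apply: (etrans (esym (etrans e1 d1'))); rewrite /Rintegral EY.
  apply: (etrans e3); apply: (etrans d3').
  rewrite [X in _ = expR (- (X / 2))](etrans e2 d2') c0 cos0 expr0n/= mul0r.
  by rewrite oppr0 expR0.
Qed.

End gaussian_variables.

(** * Laplace transforms in Gaussian spaces *)

Section gaussian_space.
Context {R : realType} {disp : measure_display} {Omega : measurableType disp}.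
Variable P : probability Omega R.
Implicit Types (u v y z : Omega -> R) (zs : seq (Omega -> R)) (t : R).

(** The last clause is the characteristic function at 1 only; closure under linear combinations
    extends it to every argument and every finite family. Joint densities are avoided, so degenerate
    families are allowed. *)
Definition gaussian_space (H : set (Omega -> R)) : Prop :=
  [/\ H 0,
      forall u v t, H u -> H v -> H (u + t *: v),
      forall u, H u -> measurable_fun setT u,
      forall u, H u -> P.-integrable setT (EFin \o (fun w => u w ^+ 2))
    & forall u, H u ->
      \int[P]_w cos (u w) = expR (- (\int[P]_w (u w ^+ 2) / 2))].

Definition inner u v : R := \int[P]_w (u w * v w).

Lemma innerC u v : inner u v = inner v u.
Proof. by rewrite /inner; under eq_Rintegral do rewrite mulrC. Qed.

Lemma inner_ge0 u : 0 <= inner u u.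
Proof. by apply: Rintegral_ge0 => w _; rewrite -expr2 sqr_ge0. Qed.

Variable H : set (Omega -> R).
Hypothesis gH : gaussian_space H.

Let H0 : H 0. Proof. by case: gH. Qed.
Let HD u v t : H u -> H v -> H (u + t *: v). Proof. by case: gH => _ + _ _ _; apply. Qed.
Let Hm u : H u -> measurable_fun setT u. Proof. by case: gH => _ _ + _ _; apply. Qed.
Let Hi u : H u -> P.-integrable setT (EFin \o (fun w => u w ^+ 2)).
Proof. by case: gH => _ _ _ + _; apply. Qed.

Lemma gaussian_space_sum (I : Type) (s : seq I) (c : I -> R) (Z : I -> Omega -> R) :
  (forall i, H (Z i)) -> H (\sum_(i <- s) c i *: Z i).
Proof.
move=> HZ; elim: s => [|i s IH]; first by rewrite big_nil.
by rewrite big_cons addrC; exact: HD.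
Qed.

Lemma integrable_inner u v : H u -> H v ->
  P.-integrable setT (EFin \o (fun w => u w * v w)).
Proof.
move=> Hu Hv.
apply: (@integrable_dominated _ _ _ _ _ (fun w => u w ^+ 2 + v w ^+ 2)).
- by apply: measurable_funM; exact: Hm.
- move=> w; rewrite ler_norml; have := sqr_ge0 (u w + v w).
  by have := sqr_ge0 (u w - v w); rewrite !expr2; nra.
- exact: (integrableD measurableT (Hi Hu) (Hi Hv)).
Qed.

Lemma innerDl u v (w : Omega -> R) t : H u -> H v -> H w ->
  inner (u + t *: v) w = inner u w + t * inner v w.
Proof.
move=> Hu Hv Hw; rewrite /inner.
rewrite -RintegralZl//; last exact: integrable_inner.
rewrite -RintegralD//; last 2 first.
- exact: integrable_inner.
- by apply: (integrableZl measurableT t (f := EFin \o (fun x => v x * w x))); exact: integrable_inner.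
by apply: eq_Rintegral => x _; rewrite /= mulrDl mulrA.
Qed.

(* [resid zs] is the covariance of the Gaussian space under the probability
   with density proportional to [exp (- (1/2) \sum_(z <- zs) z ^+ 2)]. *)
Fixpoint resid zs : (Omega -> R) -> (Omega -> R) -> R :=
  if zs is z :: zs' then
    fun u v => resid zs' u v - resid zs' u z * resid zs' v z / (1 + resid zs' z z)
  else inner.

(** This is [det (I + G)^(-1/2)] for the Gram matrix [G] of [zs], expanded by successive Schur
    complements. *)
Fixpoint laplace_cst zs : R :=
  if zs is z :: zs' then laplace_cst zs' * (Num.sqrt (1 + resid zs' z z))^-1
  else 1.

Fixpoint lspan zs : set (Omega -> R) :=
  if zs is z :: zs' then [set u | exists t, lspan zs' (u + t *: z)]
  else [set 0].

Definition allH zs := forall z, List.In z zs -> H z.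

Lemma residC zs u v : resid zs u v = resid zs v u.
Proof.
elim: zs u v => [|z zs IH] u v /=; first exact: innerC.
by rewrite (IH u v) [_ * resid zs v z]mulrC.
Qed.

Lemma residDl zs u v (w : Omega -> R) t : allH zs -> H u -> H v -> H w ->
  resid zs (u + t *: v) w = resid zs u w + t * resid zs v w.
Proof.
elim: zs u v w => [|z zs IH] u v w aH Hu Hv Hw /=; first exact: innerDl.
have Hz : H z by apply: aH; left.
have {}IH := IH _ _ _ (fun z zi => aH z (or_intror zi)) Hu Hv.
rewrite (IH _ Hw) (IH _ Hz); ring.
Qed.

Lemma residDr zs u v (w : Omega -> R) t : allH zs -> H u -> H v -> H w ->
  resid zs w (u + t *: v) = resid zs w u + t * resid zs w v.
Proof. by move=> *; rewrite !(residC zs w); exact: residDl. Qed.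

Lemma resid_sqrD zs u v t : allH zs -> H u -> H v ->
  resid zs (u + t *: v) (u + t *: v) =
  resid zs u u + 2 * resid zs u v * t + resid zs v v * t ^+ 2.
Proof.
move=> aH Hu Hv; have Huv := HD t Hu Hv.
by rewrite residDl// !residDr// (residC zs v u); ring.
Qed.

(** The value [resid zs y y] is the minimum of [|y + t1 z1 + ... |^2 + t1^2 + ...] over all
    coefficients; dropping the squares of the coefficients leaves a squared distance to the span of
    [zs]. *)
Lemma resid_ge zs y b : allH zs -> H y ->
  (forall u, lspan zs u -> b <= inner (y + u) (y + u)) -> b <= resid zs y y.
Proof.
elim: zs y b => [|z zs IH] y b aH Hy yb.
  by have := yb 0 erefl; rewrite addr0.
have Hz : H z by apply: aH; left.
have aH' : allH zs by move=> z' zi; apply: aH; right.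
have qz : 0 <= resid zs z z by apply: IH => // u _; exact: inner_ge0.
have qz1 : 1 + resid zs z z != 0 by rewrite gt_eqF// ltr_pwDl.
(* The minimizer of [resid zs (y + t *: z) (y + t *: z) + t ^+ 2]. *)
pose t := - (resid zs y z / (1 + resid zs z z)).
have -> : resid (z :: zs) y y = resid zs (y + t *: z) (y + t *: z) + t ^+ 2.
  by rewrite resid_sqrD//= /t; field.
rewrite -[b]addr0; apply: lerD; last exact: sqr_ge0.
apply: IH => //; first exact: HD.
move=> u su; rewrite -addrA; apply: yb; exists (- t).
rewrite /=; suff -> : t *: z + u + - t *: z = u by [].
by rewrite [t *: z + u]addrC (scaleNr t z) addrK.
Qed.

Lemma resid_ge0 zs z : allH zs -> H z -> 0 <= resid zs z z.
Proof. by move=> aH Hz; apply: resid_ge => // u _; exact: inner_ge0. Qed.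

Lemma resid_le zs y : allH zs -> H y -> resid zs y y <= inner y y.
Proof.
elim: zs => [|z zs IH] aH Hy //=.
have Hz : H z by apply: aH; left.
have aH' : allH zs by move=> z' zi; apply: aH; right.
apply: le_trans (IH aH' Hy); rewrite gerBl -expr2 divr_ge0 ?sqr_ge0//.
by rewrite addr_ge0// resid_ge0.
Qed.

Lemma laplace_cst_ge0 zs : 0 <= laplace_cst zs.
Proof. by elim: zs => //= z zs IH; rewrite mulr_ge0// invr_ge0 sqrtr_ge0. Qed.

End gaussian_space.

Lemma integrable_bounded {d} {T : measurableType d} {R : realType}
    (P : probability T R) (f : T -> R) (M : R) :
  measurable_fun setT f -> (forall x, `|f x| <= M) ->
  P.-integrable setT (EFin \o f).
Proof.
move=> mf fM; apply: (integrable_dominated mf fM).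
exact: finite_measure_integrable_cst.
Qed.

Lemma Rintegral_Fubini_bounded {d1 d2} {T1 : measurableType d1}
    {T2 : measurableType d2} {R : realType}
    (P1 : probability T1 R) (P2 : probability T2 R) (f : T1 * T2 -> R) (M : R) :
  measurable_fun setT f -> (forall x, `|f x| <= M) ->
  \int[P1]_x \int[P2]_y f (x, y) = \int[P2]_y \int[P1]_x f (x, y).
Proof.
move=> mf fM.
have i12 : (P1 \x P2)%E.-integrable setT (EFin \o f).
  apply: (integrable_dominated mf fM).
  apply/integrableP; split; first exact: measurable_cst.
  rewrite (_ : (fun x => _) = cst `|M|%:E)// integral_cst// -setXTT.
  rewrite [X in (_ * X)%E](_ : _ = 1%E) ?mule1 ?ltry//.
  transitivity (P1 setT * P2 setT)%E; first exact: product_measure1E.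
  exact: (etrans (congr2 mule (probability_setT P1) (probability_setT P2)) (mule1 _)).
have i1 x : P2.-integrable setT (EFin \o (fun y => f (x, y))).
  apply: (@integrable_bounded _ _ _ P2 (fun y => f (x, y)) M) => //.
  exact: measurableT_comp.
have i2 y : P1.-integrable setT (EFin \o (fun x => f (x, y))).
  apply: (@integrable_bounded _ _ _ P1 (fun x => f (x, y)) M) => //.
  exact: measurableT_comp.
rewrite /Rintegral; congr fine.
under eq_integral => x _ do rewrite fineK ?(integrable_fin_num measurableT (i1 x))//.
under [RHS]eq_integral => y _ do rewrite fineK ?(integrable_fin_num measurableT (i2 y))//.
exact: (Fubini i12).
Qed.

Section laplace.
Context {R : realType} {disp : measure_display} {Omega : measurableType disp}.
Variables (P : probability Omega R) (H : set (Omega -> R)).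
Hypothesis gH : gaussian_space P H.
Implicit Types (u v y z : Omega -> R) (zs : seq (Omega -> R)) (t : R).

Let HD u v t : H u -> H v -> H (u + t *: v). Proof. by case: gH => _ + _ _ _; apply. Qed.
Let Hm u : H u -> measurable_fun setT u. Proof. by case: gH => _ _ + _ _; apply. Qed.

Lemma measurable_expR_sqr zs : allH H zs ->
  measurable_fun setT (fun w => expR (- \sum_(z <- zs) z w ^+ 2 / 2)).
Proof.
move=> aH; apply: measurableT_comp => //; apply: measurable_funN.
elim: zs aH => [|z zs IH] aH.
  by under eq_fun do rewrite big_nil; exact: measurable_cst.
under eq_fun do rewrite big_cons.
apply: measurable_funD; last by apply: IH => z' zi; apply: aH; right.
apply: measurable_funM => //; apply: measurable_funX; apply: Hm; apply: aH; by left.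
Qed.

(* A factor [expR (- z ^+ 2 / 2)] is [\int cos (g * z)] over a standard normal [g];
   by Fubini it amounts to shifting [y] by [g *: z] and integrating over [g]. *)
Lemma gaussian_laplace_cos zs y : allH H zs -> H y ->
  \int[P]_w (expR (- \sum_(z <- zs) z w ^+ 2 / 2) * cos (y w)) =
  laplace_cst P zs * expR (- (resid P zs y y / 2)).
Proof.
elim: zs y => [|z zs IH] y aH Hy.
  rewrite /= mul1r; have [_ _ _ _ /(_ y Hy) <-] := gH.
  by apply: eq_Rintegral => w _; rewrite big_nil oppr0 expR0 mul1r.
have Hz : H z by apply: aH; left.
have aH' : allH H zs by move=> z' zi; apply: aH; right.
have mzs := measurable_expR_sqr aH'.
pose E w := expR (- \sum_(z <- zs) z w ^+ 2 / 2).
pose g : probability (measurableTypeR R) R := normal_prob 0 1.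
pose f (p : Omega * measurableTypeR R) : R := E p.1 * cos (z p.1 * p.2 + y p.1).
have E1 w : `|E w| <= 1.
  rewrite ger0_norm ?expR_ge0// -expR0 ler_expR oppr_le0.
  by apply: sumr_ge0 => i _; rewrite divr_ge0 ?sqr_ge0.
have f1 p : `|f p| <= 1.
  rewrite normrM; apply: mulr_ile1 => //.
  by rewrite ler_norml cos_geN1 cos_le1.
have mf : measurable_fun setT f.
  apply: measurable_funM; first exact: measurableT_comp.
  have mc : measurable_fun setT (cos : R -> R).
    by apply: continuous_measurable_fun; exact: continuous_cos.
  apply: measurableT_comp => //; apply: measurable_funD.
    apply: measurable_funM; last exact: measurable_snd.
    by apply: measurableT_comp; [exact: Hm|exact: measurable_fst].
  by apply: measurableT_comp; [exact: Hm|exact: measurable_fst].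
transitivity (\int[P]_w \int[g]_x f (w, x)).
  apply: eq_Rintegral => w _; rewrite /f/= RintegralZl//; last first.
    exact: integrable_cos_normal_prob.
  rewrite (normal_prob_cos _ _ (oner_neq0 _)) expr1n mul1r big_cons.
  rewrite mulrCA [RHS]mulrC; congr (_ * _); rewrite /E -expRD; congr expR.
  by rewrite opprD addrC.
rewrite (Rintegral_Fubini_bounded _ _ mf f1).
transitivity (\int[g]_x (laplace_cst P zs *
   expR (- ((resid P zs y y + 2 * resid P zs y z * x + resid P zs z z * x ^+ 2) / 2)))).
  apply: eq_Rintegral => x _; rewrite -(resid_sqrD gH)// -IH//; last exact: HD.
  apply: eq_Rintegral => w _; rewrite /f/=; congr (_ * cos _).
  by rewrite addrC mulrC.
have q0 := resid_ge0 gH aH' Hz.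
rewrite RintegralZl//; last first.
  apply: (@integrable_bounded _ _ _ g _ 1); first exact: measurable_expR_quadratic.
  move=> x; rewrite ger0_norm ?expR_ge0// -[leRHS]expR0 ler_expR oppr_le0 divr_ge0//.
  by rewrite -(resid_sqrD gH)// (resid_ge0 gH)//; exact: HD.
by rewrite (normal_prob_expR_quadratic _ _ q0) /= mulrA expr2.
Qed.

Lemma gaussian_laplace zs : allH H zs ->
  \int[P]_w expR (- \sum_(z <- zs) z w ^+ 2 / 2) = laplace_cst P zs.
Proof.
have Hz0 : H 0 by case: gH.
move=> aH; have := gaussian_laplace_cos aH Hz0.
have -> : resid P zs 0 0 = 0.
  apply/eqP; rewrite eq_le (resid_ge0 gH aH Hz0) andbT.
  apply: le_trans (resid_le gH aH Hz0) _; rewrite /inner.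
  by under eq_Rintegral do rewrite mul0r; rewrite (Rintegral_probability_cst P).
rewrite mul0r oppr0 expR0 mulr1 => <-.
by apply: eq_Rintegral => w _; rewrite cos0 mulr1.
Qed.

(** Hadamard's inequality: each Schur complement is at most the corresponding diagonal entry, by
    [resid_le]. *)
Lemma gaussian_laplace_ge (I : Type) (s : seq I) (Z : I -> Omega -> R) :
  (forall i, H (Z i)) ->
  \prod_(i <- s) (Num.sqrt (1 + inner P (Z i) (Z i)))^-1 <=
  \int[P]_w expR (- \sum_(i <- s) Z i w ^+ 2 / 2).
Proof.
move=> HZ; have aH s' : allH H [seq Z i | i <- s'].
  by elim: s' => [|i s' IH] z //= [<-|/IH].
under eq_Rintegral do rewrite -(big_map Z xpredT (fun z => z _ ^+ 2 / 2)).
rewrite (gaussian_laplace (aH s)).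
elim: s => [|i s IH] /=; first by rewrite big_nil.
rewrite big_cons mulrC ler_pM//.
- by apply: prodr_ge0 => j _; rewrite invr_ge0 sqrtr_ge0.
- have q0 := resid_ge0 gH (aH s) (HZ i); have p0 := inner_ge0 P (Z i).
  rewrite lef_pV2 ?posrE ?sqrtr_gt0 ?ltr_pwDl//.
  by rewrite ler_wsqrtr// lerD2l (resid_le gH).
Qed.

Lemma lspan_map (I : eqType) (s : seq I) (Z : I -> Omega -> R) u : uniq s ->
  lspan [seq Z i | i <- s] u -> exists c : I -> R, u = \sum_(i <- s) c i *: Z i.
Proof.
elim: s u => [|i s IH] u /=.
  by move=> _ ->; exists (fun=> 0); rewrite big_nil.
move=> /andP[si us] [t /(IH _ us)[c uE]].
exists (fun j => if j == i then - t else c j); rewrite big_cons eqxx.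
rewrite (eq_big_seq (fun j => c j *: Z j)) => [|j js].
  by rewrite -uE scaleNr addrC addrK.
by case: eqP => // ji; rewrite -ji js in si.
Qed.

(** A diagonal minorant of the Gram form also bounds the leftover variances: with coefficient 1 at
    [i], the form is at least [v i] whatever the other coefficients are, so [resid_ge] applies. *)
Lemma gaussian_laplace_le (I : eqType) (s : seq I) (Z : I -> Omega -> R) (v : I -> R) :
  uniq s -> (forall i, H (Z i)) -> (forall i, 0 <= v i) ->
  (forall c : I -> R, \sum_(i <- s) c i ^+ 2 * v i <=
     inner P (\sum_(i <- s) c i *: Z i) (\sum_(i <- s) c i *: Z i)) ->
  \int[P]_w expR (- \sum_(i <- s) Z i w ^+ 2 / 2) <=
  \prod_(i <- s) (Num.sqrt (1 + v i))^-1.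
Proof.
move=> us HZ v0; have aH s' : allH H [seq Z i | i <- s'].
  by elim: s' => [|i s' IH] z //= [<-|/IH].
under eq_Rintegral do rewrite -(big_map Z xpredT (fun z => z _ ^+ 2 / 2)).
rewrite (gaussian_laplace (aH s)).
elim: s us => [|i s IH] /=; first by rewrite big_nil.
move=> /andP[si us] hv.
rewrite big_cons [leRHS]mulrC; apply: ler_pM.
- exact: laplace_cst_ge0.
- by rewrite invr_ge0 sqrtr_ge0.
(* The tail inherits the minorant by taking coefficient 0 at [i]. *)
- apply: IH => // c; pose c' j := if j == i then 0 else c j.
  have c'E (V : lmodType R) (f : R -> I -> V) :
      (forall j, f 0 j = 0) -> \sum_(j <- i :: s) f (c' j) j = \sum_(j <- s) f (c j) j.
    move=> f0; rewrite big_cons /c' eqxx f0 add0r; apply: eq_big_seq => j js.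
    by case: eqP => // ji; rewrite -ji js in si.
  have := hv c'.
  rewrite (c'E R^o (fun x j => x ^+ 2 * v j)); last by move=> j; rewrite expr0n mul0r.
  by rewrite (c'E _ (fun x j => x *: Z j)) => [//|j]; rewrite scale0r.
- have q : v i <= resid P [seq Z i | i <- s] (Z i) (Z i).
    apply: (resid_ge gH (aH s) (HZ i)) => u /(lspan_map us)[c ->].
    pose c' j := if j == i then 1 else c j.
    have ci : c' i = 1 by rewrite /c' eqxx.
    have cs : \sum_(j <- s) c' j *: Z j = \sum_(j <- s) c j *: Z j.
      by apply: eq_big_seq => j js; rewrite /c'; case: eqP => // ji; rewrite -ji js in si.
    have := hv c'; rewrite !big_cons cs ci expr1n mul1r scale1r.
    apply: le_trans; rewrite lerDl; apply: sumr_ge0 => j _.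
    by rewrite mulr_ge0 ?sqr_ge0.
  have q0 := le_trans (v0 i) q.
  rewrite lef_pV2 ?posrE ?sqrtr_gt0 ?ltr_pwDl//.
  by rewrite ler_wsqrtr// lerD2l.
Qed.

End laplace.

(** * Increments of the listed processes *)

Section gaussian_span.
Context {R : realType} {disp : measure_display} {Omega : measurableType disp}.
Variable P : probability Omega R.

Definition gaussian_span (D : set R) (X : R -> Omega -> R) : set (Omega -> R) :=
  [set u | exists k (t c : 'I_k -> R), (forall i, D (t i)) /\
           u = fun w => \sum_(i < k) c i * X (t i) w].

Lemma gaussian_spanT D X t : D t -> gaussian_span D X (X t).
Proof.
move=> Dt; exists 1%N, (fun=> t), (fun=> 1); split=> //.
by apply/funext => w; rewrite big_ord1 mul1r.
Qed.

Lemma gaussian_span_space D K X : centered_gaussian_process P D K X ->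
  gaussian_space P (gaussian_span D X).
Proof.
move=> [gX EX _]; split.
- exists 0%N, (fun=> 0), (fun=> 0); split; first by case.
  by apply/funext => w; rewrite big_ord0.
- move=> u v a [k [t [c [Dt ->]]]] [l [t' [c' [Dt' ->]]]].
  exists (k + l)%N, (fun i => match fintype.split i with inl i => t i | inr i => t' i end),
    (fun i => match fintype.split i with inl i => c i | inr i => a * c' i end).
  split; first by move=> i; case: (fintype.split i).
  apply/funext => w.
  transitivity (\sum_(i < k) c i * X (t i) w + a * \sum_(i < l) c' i * X (t' i) w) => //.
  rewrite big_split_ord/= mulr_sumr; congr (_ + _).
    by apply: eq_bigr => i _; rewrite (unsplitK (inl _ i)).
  by apply: eq_bigr => i _; rewrite (unsplitK (inr _ i)) mulrA.
- by move=> u [k [t [c [Dt ->]]]]; have [] := gX k t c Dt.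
- by move=> u [k [t [c [Dt ->]]]]; have [_ []] := gaussian_variable_centered (gX k t c Dt).
- move=> u [k [t [c [Dt ->]]]]; have [_ [_]] := gaussian_variable_centered (gX k t c Dt).
  apply; rewrite unlock.
  have iX i : P.-integrable setT (EFin \o X (t i)).
    have gXi : gaussian_variable P (X (t i)).
      have := gX 1%N (fun=> t i) (fun=> 1) (fun=> Dt i).
      by congr (gaussian_variable P); apply/funext => w; rewrite big_ord1 mul1r.
    by have [] := gaussian_variable_centered gXi.
  under eq_integral => w _ do rewrite -sumEFin.
  rewrite (@integral_sum _ _ _ P setT measurableT _ (fun i w => (c i * X (t i) w)%:E)); last first.
    by move=> i; apply: (integrableZl measurableT (c i) (iX i)).
  rewrite big1// => i _.
  under eq_integral => w _ do rewrite EFinM.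
  rewrite (integralZl measurableT (iX i)).
  have := EX (t i) (Dt i); rewrite unlock => ->.
  by rewrite mule0.
Qed.

Lemma centered_gaussian_inner D K X s t : centered_gaussian_process P D K X ->
  D s -> D t -> inner P (X s) (X t) = K s t.
Proof.
move=> [_ EX cX] Ds Dt; have := cX s t Ds Dt.
rewrite covariance.unlock EX// EX// => h; rewrite /inner /Rintegral.
suff -> : (\int[P]_w (X s w * X t w)%:E)%E = (K s t)%:E by [].
rewrite -h expectation.unlock; apply: eq_integral => w _ /=.
by rewrite fctE/= !subr0.
Qed.

End gaussian_span.

(** * Covariance functions with nearly Brownian increments *)

Section quasi_brownian_covariance.
Context {R : realType}.
Implicit Types (K : R -> R -> R) (kappa s t b : R).

(* On [0,1] the increments of a process with covariance [K] have variance
   [kappa * (t - s)] up to a quadratic error, and those over nonoverlapping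
   intervals are correlated at most like the product of the lengths. *)
Definition quasi_brownian_cov K kappa := exists C : R, [/\ 0 <= C,
  (forall s t, 0 <= s -> s <= t -> t <= 1 ->
    `|K t t - K s t - K t s + K s s - kappa * (t - s)| <= C * (t - s) ^+ 2),
  (forall s t s' t', 0 <= s -> s <= t -> t <= s' -> s' <= t' -> t' <= 1 ->
    `|K t t' - K s t' - K t s' + K s s'| <= C * ((t - s) * (t' - s')))
  & forall s, 0 <= s -> s <= 1 -> `|K s s| <= C].

(** Here [kappa] may have any sign. The listed covariances are combinations of pieces with [kappa]
    equal to 1, -2, [- (2 * b)] or 0, and positivity is needed only for the total. *)
Lemma quasi_brownian_cov_lin K1 K2 kappa1 kappa2 a b :
  quasi_brownian_cov K1 kappa1 -> quasi_brownian_cov K2 kappa2 ->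
  quasi_brownian_cov (fun s t => a * K1 s t + b * K2 s t) (a * kappa1 + b * kappa2).
Proof.
move=> [C1 [C10 h1 h1' h1'']] [C2 [C20 h2 h2' h2'']].
have tri x y X Y : `|x| <= X -> `|y| <= Y -> `|a * x + b * y| <= `|a| * X + `|b| * Y.
  move=> xX yY; apply: (le_trans (ler_normD _ _)); rewrite !normrM.
  by apply: lerD; apply: ler_wpM2l.
exists (`|a| * C1 + `|b| * C2); split.
- by rewrite addr_ge0 ?mulr_ge0.
- move=> s t s0 st t1; have := tri _ _ _ _ (h1 s t s0 st t1) (h2 s t s0 st t1).
  by congr (`|_| <= _); ring.
- move=> s t s' t' s0 st ts' st' t1.
  have := tri _ _ _ _ (h1' s t s' t' s0 st ts' st' t1) (h2' s t s' t' s0 st ts' st' t1).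
  by congr (`|_| <= _); ring.
- by move=> s s0 s1; exact: tri (h1'' s s0 s1) (h2'' s s0 s1).
Qed.

Lemma eq_quasi_brownian_cov K1 K2 kappa : K1 =2 K2 ->
  quasi_brownian_cov K1 kappa -> quasi_brownian_cov K2 kappa.
Proof. by move=> h; have -> : K1 = K2 by apply/funext => s; apply/funext => t. Qed.

Lemma quasi_brownian_cov_min : quasi_brownian_cov Num.min 1.
Proof.
exists 1; split => //.
- move=> s t s0 st t1; rewrite !minxx (min_l st) (min_r st).
  by rewrite (_ : _ - _ = 0) ?normr0 ?mul1r ?sqr_ge0//; ring.
- move=> s t s' t' s0 st ts' st' t1.
  have ss' : s <= s' by lra.
  have tt' : t <= t' by lra.
  have st'' : s <= t' by lra.
  rewrite (min_l ss') (min_l tt') (min_l ts') (min_l st'').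
  rewrite (_ : _ + _ = 0) ?normr0 ?mul1r ?mulr_ge0 ?subr_ge0//; ring.
- by move=> s s0 s1; rewrite minxx ger0_norm.
Qed.

Lemma quasi_brownian_cov_dist : quasi_brownian_cov (fun s t => `|s - t|) (- 2).
Proof.
exists 1; split => //.
- move=> s t s0 st t1; rewrite !subrr normr0 (ler0_norm (_ : s - t <= 0)) ?subr_le0//.
  rewrite (ger0_norm (_ : 0 <= t - s)) ?subr_ge0//.
  by rewrite (_ : _ - _ = 0) ?normr0 ?mul1r ?sqr_ge0//; ring.
- move=> s t s' t' s0 st ts' st' t1.
  have ss' : s - s' <= 0 by lra.
  have tt' : t - t' <= 0 by lra.
  have ts'' : t - s' <= 0 by lra.
  have st'' : s - t' <= 0 by lra.
  rewrite (ler0_norm ss') (ler0_norm tt') (ler0_norm ts'') (ler0_norm st'').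
  rewrite (_ : _ + _ = 0) ?normr0 ?mul1r ?mulr_ge0 ?subr_ge0//; ring.
- by move=> s s0 s1; rewrite subrr normr0 normr0.
Qed.

(* Products of Lipschitz functions contribute only to the error terms. *)
Lemma quasi_brownian_cov_prod (f : R -> R) (C : R) : 0 <= C ->
  (forall s t, 0 <= s -> s <= t -> t <= 1 -> `|f t - f s| <= C * (t - s)) ->
  (forall s, 0 <= s -> s <= 1 -> `|f s| <= C) ->
  quasi_brownian_cov (fun s t => f s * f t) 0.
Proof.
move=> C0 lip fC; exists (C ^+ 2); split; first exact: sqr_ge0.
- move=> s t s0 st t1.
  rewrite (_ : _ - _ = (f t - f s) * (f t - f s)); last by ring.
  rewrite normrM -exprMn [leRHS]expr2.
  by apply: ler_pM => //; exact: lip.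
- move=> s t s' t' s0 st ts' st' t1.
  rewrite (_ : _ + _ = (f t - f s) * (f t' - f s')); last by ring.
  rewrite normrM (_ : C ^+ 2 * _ = (C * (t - s)) * (C * (t' - s'))); last by ring.
  by apply: ler_pM => //; apply: lip => //; lra.
- by move=> s s0 s1; rewrite normrM expr2; apply: ler_pM => //; exact: fC.
Qed.

Lemma expR_sub1_bound (x : R) : `|expR x - 1| <= `|x| * expR `|x|.
Proof.
have e0 := expR_ge1Dx x.
have e1 : expR x - 1 <= x * expR x.
  have := expR_ge1Dx (- x); rewrite -(ler_pM2l (expR_gt0 x)) expRxMexpNx_1.
  by lra.
have [x0|x0] := leP 0 x.
  by rewrite !ger0_norm//; lra.
have g0 : 1 <= expR (- x) by have := expR_ge1Dx (- x); lra.
have g1 : expR x <= 1 by rewrite -[leRHS]expR0 ler_expR ltW.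
by rewrite ler0_norm ?(ltr0_norm x0); [nra|lra].
Qed.

Lemma expR_taylor2_bound (x : R) : `|expR x - 1 - x| <= x ^+ 2 * expR `|x|.
Proof.
have e0 := expR_ge1Dx x.
have e1 : expR x - 1 <= x * expR x.
  have := expR_ge1Dx (- x); rewrite -(ler_pM2l (expR_gt0 x)) expRxMexpNx_1.
  by lra.
rewrite ger0_norm; last by lra.
apply: (@le_trans _ _ (x * (expR x - 1))); first by lra.
apply: (le_trans (ler_norm _)); rewrite normrM -real_normK ?num_real// expr2 -mulrA.
by apply: ler_wpM2l => //; exact: expR_sub1_bound.
Qed.

Lemma quasi_brownian_cov_expRD b :
  quasi_brownian_cov (fun s t => expR (b * (s + t))) 0.
Proof.
apply: (@eq_quasi_brownian_cov (fun s t => expR (b * s) * expR (b * t))).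
  by move=> s t; rewrite -expRD mulrDr.
pose C := (1 + `|b|) * expR `|b| * expR `|b|.
have B s : 0 <= s -> s <= 1 -> `|b * s| <= `|b|.
  by move=> s0 s1; rewrite normrM ler_piMr// ger0_norm.
have E s : 0 <= s -> s <= 1 -> expR (b * s) <= expR `|b|.
  by move=> s0 s1; rewrite ler_expR; apply: le_trans (ler_norm _) (B s s0 s1).
have e1 : 1 <= expR `|b| by rewrite -[leLHS]expR0 ler_expR.
have b0 := normr_ge0 b.
apply: (@quasi_brownian_cov_prod _ C).
- by rewrite !mulr_ge0 ?expR_ge0 ?addr_ge0.
- move=> s t s0 st t1.
  rewrite (_ : _ - _ = expR (b * s) * (expR (b * (t - s)) - 1)); last first.
    by rewrite mulrBr mulr1 -expRD; congr (expR _ - _); ring.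
  rewrite normrM ger0_norm ?expR_ge0//.
  apply: (@le_trans _ _ (expR `|b| * (`|b| * (t - s) * expR `|b|))).
    apply: ler_pM => //; first exact: E s0 (le_trans st t1).
    apply: le_trans (expR_sub1_bound _) _.
    rewrite normrM (ger0_norm (_ : 0 <= t - s)) ?subr_ge0//; apply: ler_wpM2l.
      by rewrite mulr_ge0 ?subr_ge0.
    by rewrite ler_expR ler_piMr//; lra.
  rewrite /C (_ : expR `|b| * _ = `|b| * (expR `|b| * expR `|b| * (t - s))); last by ring.
  rewrite (_ : (1 + `|b|) * _ * _ * _ = (1 + `|b|) * (expR `|b| * expR `|b| * (t - s))); last by ring.
  by apply: ler_wpM2r; [rewrite !mulr_ge0 ?expR_ge0 ?subr_ge0|lra].
- move=> s s0 s1; rewrite ger0_norm ?expR_ge0//; apply: (le_trans (E s s0 s1)).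
  by rewrite /C -mulrA; nra.
Qed.

(** The kink on the diagonal gives [kappa]. Off the diagonal the mixed difference factors as [- exp
    (b (s' - t)) (exp (b (t - s)) - 1) (exp (b (t' - s')) - 1)], which is of the order of the
    product of the lengths. *)
Lemma quasi_brownian_cov_expR_dist b :
  quasi_brownian_cov (fun s t => expR (b * `|s - t|)) (- (2 * b)).
Proof.
pose A := expR `|b|.
have A1 : 1 <= A by rewrite -[leLHS]expR0 ler_expR.
have A0 : 0 <= A by lra.
have b0 := normr_ge0 b.
have B s : 0 <= s -> s <= 1 -> `|b * s| <= `|b|.
  by move=> s0 s1; rewrite normrM ler_piMr// ger0_norm.
have E s : 0 <= s -> s <= 1 -> `|expR (b * s) - 1| <= `|b| * A * s.
  move=> s0 s1; apply: (le_trans (expR_sub1_bound _)).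
  rewrite normrM (ger0_norm s0) mulrAC; apply: ler_wpM2r => //.
  apply: ler_wpM2l => //; rewrite ler_expR ler_piMr//.
exists (1 + 2 * `|b| ^+ 2 * A ^+ 3); split.
- by rewrite addr_ge0 ?mulr_ge0 ?exprn_ge0.
- move=> s t s0 st t1; rewrite !subrr normr0 mulr0 expR0 (distrC s t).
  rewrite (ger0_norm (_ : 0 <= t - s)) ?subr_ge0//.
  have u0 : 0 <= t - s by rewrite subr_ge0.
  have u1 : t - s <= 1 by lra.
  rewrite (_ : _ - _ = - (2 * (expR (b * (t - s)) - 1 - b * (t - s)))); last by ring.
  rewrite normrN normrM (ger0_norm (_ : 0 <= 2))//.
  have := expR_taylor2_bound (b * (t - s)).
  have : expR `|b * (t - s)| <= A ^+ 3.
    apply: (@le_trans _ _ A); first by rewrite ler_expR; exact: B.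
    by rewrite exprS ler_peMr// exprn_ege1.
  rewrite exprMn -[b ^+ 2]real_normK ?num_real// => h1 h2.
  have := ler_wpM2l (mulr_ge0 (sqr_ge0 `|b|) (sqr_ge0 (t - s))) h1.
  by have := sqr_ge0 (t - s); lra.
- move=> s t s' t' s0 st ts' st' t1.
  have ss' : s - s' <= 0 by lra.
  have tt' : t - t' <= 0 by lra.
  have ts'' : t - s' <= 0 by lra.
  have st'' : s - t' <= 0 by lra.
  rewrite (ler0_norm ss') (ler0_norm tt') (ler0_norm ts'') (ler0_norm st'').
  have u0 : 0 <= t - s by rewrite subr_ge0.
  have v0 : 0 <= t' - s' by rewrite subr_ge0.
  have u1 : t - s <= 1 by lra.
  have v1 : t' - s' <= 1 by lra.
  rewrite (_ : _ + _ = - (expR (b * (s' - t)) * (expR (b * (t - s)) - 1) *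
                       (expR (b * (t' - s')) - 1))); last first.
    rewrite (_ : b * - (t - t') = b * (s' - t) + b * (t' - s')); last by ring.
    rewrite (_ : b * - (s - t') = b * (s' - t) + b * (t - s) + b * (t' - s')); last by ring.
    rewrite (_ : b * - (s - s') = b * (s' - t) + b * (t - s)); last by ring.
    rewrite (_ : b * - (t - s') = b * (s' - t)); last by ring.
    by rewrite !expRD; ring.
  rewrite normrN !normrM (ger0_norm (expR_ge0 _)).
  have h0 : expR (b * (s' - t)) <= A.
    rewrite ler_expR; apply: le_trans (ler_norm _) _; apply: B; lra.
  apply: (@le_trans _ _ (A * (`|b| * A * (t - s)) * (`|b| * A * (t' - s')))).
    apply: ler_pM; rewrite ?mulr_ge0 ?expR_ge0//; last exact: E.
    by apply: ler_pM; rewrite ?expR_ge0//; exact: E.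
  rewrite (_ : A * _ * _ = (`|b| ^+ 2 * A ^+ 3) * ((t - s) * (t' - s'))); last by ring.
  apply: ler_wpM2r; first by rewrite mulr_ge0.
  have : 0 <= `|b| ^+ 2 * A ^+ 3 by rewrite mulr_ge0 ?exprn_ge0.
  by lra.
- move=> s _ _; rewrite subrr normr0 mulr0 expR0 normr1 lerDl.
  by rewrite !mulr_ge0 ?exprn_ge0.
Qed.

End quasi_brownian_covariance.

Lemma Rintegral_sum {d} {T : measurableType d} {R : realType}
    (mu : {measure set T -> \bar R}) (I : Type) (s : seq I) (f : I -> T -> R) :
  (forall i, mu.-integrable setT (EFin \o f i)) ->
  \int[mu]_x (\sum_(i <- s) f i x) = \sum_(i <- s) \int[mu]_x f i x.
Proof.
move=> fi; rewrite /Rintegral; under eq_integral => x _ do rewrite -sumEFin.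
rewrite (@integral_sum _ _ _ mu setT measurableT _ (fun i x => (f i x)%:E))//.
rewrite (eq_bigr (fun i => (\int[mu]_x f i x)%:E)) ?sumEFin// => i _.
by rewrite /Rintegral fineK//; apply: integrable_fin_num => //; exact: fi.
Qed.

(** * Time integrals as limits of Riemann sums *)

Section riemann_sum.
Context {R : realType}.
Local Notation leb := (@lebesgue_measure R).

Lemma within_itv_continuousP (f : R -> R) (a b x : R) :
  {within `[a, b], continuous f} -> a <= x <= b -> forall eps, 0 < eps ->
  exists2 r, 0 < r & forall y, a <= y <= b -> `|x - y| < r -> `|f x - f y| < eps.
Proof.
move=> /subspace_continuousP cf xab eps eps0.
have /cf /cvgrPdist_lt /(_ _ eps0) : `[a, b]%classic x by rewrite /= in_itv.
rewrite near_withinE => /nbhs_ballP[r /= r0 hr].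
by exists r => // y yab xy; apply: hr => //=; rewrite in_itv.
Qed.

(** The Riemann sum is the integral of the step function [g n] that samples [f] at left endpoints;
    these step functions converge pointwise on [[0, 1[] and are bounded by [M], so dominated
    convergence applies. *)
Lemma riemann_sum_cvg (f : R -> R) : {within `[0, 1], continuous f} ->
  \sum_(i < n.+1) n.+1%:R^-1 * f (i%:R / n.+1%:R) @[n --> \oo] -->
  \int[leb]_(s in `[0, 1]) f s.
Proof.
move=> cf.
have [M Mf] : exists M : R, forall t : R, 0 <= t <= 1 -> `|f t| <= M.
  have [c _ hc] := EVT_max (@ler01 R) cf.
  have [c' _ hc'] := EVT_min (@ler01 R) cf.
  exists (`|f c| + `|f c'|) => t t01.
  have := hc t; rewrite in_itv/= => /(_ t01) h1.
  have := hc' t; rewrite in_itv/= => /(_ t01) h2.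
  rewrite ler_norml; have := ler_norm (f c); have := ler_norm (- f c').
  by rewrite normrN; have := normr_ge0 (f c); have := normr_ge0 (f c'); lra.
pose I n i : set (measurableTypeR R) := `[(i%:R / n.+1%:R), (i.+1%:R / n.+1%:R)[%classic.
pose g n (x : measurableTypeR R) : R := \sum_(i < n.+1) f (i%:R / n.+1%:R) * \1_(I n i) x.
have mI n i : measurable (I n i) by exact: measurable_itv.
have N0 n : (0 : R) < n.+1%:R by rewrite ltr0n.
have intI n i : \int[leb]_x (\1_(I n i) x) = n.+1%:R^-1.
  rewrite /Rintegral integral_indic// setIT.
  rewrite [X in fine X](@lebesgue_measure_itv R `[(i%:R / n.+1%:R), (i.+1%:R / n.+1%:R)[)/= lte_fin.
  by rewrite ltr_pM2r ?invr_gt0// ltr_nat ltnSn -EFinB/= -mulrBl -natrB// subSnn mul1r.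
have iI n i : leb.-integrable setT (EFin \o (\1_(I n i) : _ -> R)).
  exact: integrable_indic_itv.
have gE n : \int[leb]_x g n x = \sum_(i < n.+1) n.+1%:R^-1 * f (i%:R / n.+1%:R).
  rewrite /g (Rintegral_sum _ (f := fun (i : 'I_n.+1) x => f (i%:R / n.+1%:R) * \1_(I n i) x)).
    by apply: eq_bigr => i _; rewrite RintegralZl// intI mulrC.
  by move=> i; apply: (integrableZl measurableT _ (iI n i)).
have gx n x : 0 <= x < 1 -> exists2 i : nat, (0 <= (i%:R / n.+1%:R : R) <= 1) /\
    `|x - i%:R / n.+1%:R| <= n.+1%:R^-1 & g n x = f (i%:R / n.+1%:R).
  move=> /andP[x0 x1]; pose i := Num.trunc (x * n.+1%:R).
  have xn0 : 0 <= x * n.+1%:R by rewrite mulr_ge0// ltW.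
  have /andP[i1 i2] := truncn_itv xn0.
  have iN : (i < n.+1)%N by rewrite truncn_lt_nat// gtr_pMl.
  exists i.
    split.
      rewrite divr_ge0 ?ler0n ?(ltW (N0 n))//= ler_pdivrMr// mul1r ler_nat.
      exact: ltnW.
    rewrite ler_norml; apply/andP; split.
      rewrite -(ler_pM2r (N0 n)) mulrBl divfK ?gt_eqF// mulNr mulVf ?gt_eqF//.
      by rewrite -/i in i1; lra.
    rewrite -(ler_pM2r (N0 n)) mulrBl divfK ?gt_eqF// mulVf ?gt_eqF//.
    by move: i2; rewrite -/i -natr1; lra.
  rewrite /g (bigD1 (Ordinal iN))//= big1 => [|j ji].
    rewrite addr0 indicE mem_set ?mulr1// /I/= in_itv/= ler_pdivrMr// ltr_pdivlMr//.
    by rewrite i1.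
  rewrite indicE memNset ?mulr0// /I/= in_itv/= ler_pdivrMr// ltr_pdivlMr// => hj.
  by move/eqP: ji; apply; apply/val_inj; rewrite /= -(truncn_def hj).
have g0 n x : ~~ (0 <= x < 1) -> g n x = 0.
  move=> x01; rewrite /g big1// => i _; rewrite indicE memNset ?mulr0//.
  rewrite /I/= in_itv/= => /andP[h1 h2]; move/negP: x01; apply.
  rewrite (le_trans _ h1) ?divr_ge0 ?ler0n ?(ltW (N0 n))//= (lt_le_trans h2)//.
  by rewrite ler_pdivrMr// mul1r ler_nat.
pose J : set (measurableTypeR R) := `[0, 1[%classic.
have JE (x : R) : (x \in J) = (0 <= x < 1).
  by apply/idP/idP => [/set_mem|h]; [|apply/mem_set]; rewrite /J/= in_itv.
have mf : measurable_fun (`[0, 1]%classic : set (measurableTypeR R)) f.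
  by apply: subspace_continuous_measurable_fun => //; exact: measurable_itv.
have mJ : measurable J by exact: measurable_itv.
have mf' : measurable_fun J f.
  by apply: measurable_funS mf => // x; rewrite /J/= !in_itv/= => /andP[-> /ltW].
have cJ : leb.-integrable setT (EFin \o (fun x => M * \1_J x)).
  have jI : leb.-integrable setT (EFin \o (\1_J : _ -> R)) by exact: integrable_indic_itv.
  exact: (integrableZl measurableT M jI).
have lim : \sum_(i < n.+1) n.+1%:R^-1 * f (i%:R / n.+1%:R) @[n --> \oo] --> \int[leb]_x (f \_ J) x.
  under eq_fun do rewrite -gE.
  apply: (@Rintegral_dominated_cvg _ _ _ leb g (f \_ J) (fun x => M * \1_J x)) => //.
  - move=> n; apply: measurable_sum => i.
    by apply: measurable_funM => //; exact: measurable_indic.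
  - exact/(measurable_restrictT _ _).1.
  - move=> x; rewrite patchE JE; case: ifPn => [x01|x01]; last first.
      by under eq_fun do rewrite g0//; exact: cvg_cst.
    apply/cvgrPdist_lt => eps eps0.
    have xI : 0 <= x <= 1 by case/andP: x01 => -> /ltW.
    have [r r0 hr] := within_itv_continuousP cf xI eps0.
    have : \forall n \near \oo, n.+1%:R^-1 < r.
      have /cvgrPdist_lt/(_ _ r0) := @cvg_harmonic R.
      by apply: filterS => n; rewrite sub0r normrN gtr0_norm ?invr_gt0.
    apply: filterS => n nr.
    by have [i [i01 xi] ->] := gx n x x01; apply: hr => //; exact: le_lt_trans nr.
  - move=> n x; case: (boolP (0 <= x < 1)) => x01.
      have [i [i01 xi] ->] := gx n x x01.
      by rewrite indicE JE x01 mulr1; exact: Mf.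
    by rewrite g0// indicE JE (negbTE x01) normr0 mulr0.
rewrite -Rintegral_mkcond (@Rintegral_itv_bndo_bndc R (BLeft 0) 1 f) in lim.
  exact: lim.
apply/integrable_mkcond => //; rewrite restrict_EFin.
apply: (@integrable_dominated _ _ _ _ (f \_ J) (fun x => M * \1_J x)) => //.
  exact/(measurable_restrictT _ _).1.
move=> x; rewrite patchE indicE JE; case: ifPn => [/andP[x0 x1]|_].
  by rewrite mulr1 Mf// x0 ltW.
by rewrite normr0 mulr0.
Qed.

End riemann_sum.

(** * The listed processes have nearly Brownian increments *)

Section quasi_brownian.
Context {R : realType} {disp : measure_display} {Omega : measurableType disp}.
Variable P : probability Omega R.
Implicit Types (X Y W : R -> Omega -> R) (H : set (Omega -> R)).

Lemma inner_suml H (I : Type) (s : seq I) (c : I -> R) (Z : I -> Omega -> R) v :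
  gaussian_space P H -> (forall i, H (Z i)) -> H v ->
  inner P (\sum_(i <- s) c i *: Z i) v = \sum_(i <- s) c i * inner P (Z i) v.
Proof.
move=> gH HZ Hv; elim: s => [|i s IH].
  rewrite !big_nil /inner; under eq_Rintegral do rewrite mul0r.
  exact: (Rintegral_probability_cst P).
rewrite !big_cons addrC (innerDl gH)// ?IH; first by rewrite addrC.
exact: (gaussian_space_sum gH).
Qed.

Lemma inner_sum H (I : Type) (s : seq I) (c : I -> R) (Z : I -> Omega -> R) :
  gaussian_space P H -> (forall i, H (Z i)) ->
  inner P (\sum_(i <- s) c i *: Z i) (\sum_(i <- s) c i *: Z i) =
  \sum_(i <- s) \sum_(j <- s) c i * c j * inner P (Z i) (Z j).
Proof.
move=> gH HZ; rewrite (inner_suml _ _ gH)//; last exact: (gaussian_space_sum gH).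
apply: eq_bigr => i _; rewrite innerC (inner_suml _ _ gH)// mulr_sumr.
by apply: eq_bigr => j _; rewrite mulrA innerC.
Qed.

Lemma inner_lin2 H u v u' v' t t' : gaussian_space P H ->
  H u -> H v -> H u' -> H v' ->
  inner P (u + t *: v) (u' + t' *: v') =
  inner P u u' + t' * inner P u v' + t * inner P v u' + t * t' * inner P v v'.
Proof.
move=> gH Hu Hv Hu' Hv'.
have HD : H (u' + t' *: v') by case: gH => _ + _ _ _; apply.
rewrite (innerDl gH)// (innerC P u) (innerC P v) !(innerDl gH)//.
by rewrite !(innerC P u') !(innerC P v'); ring.
Qed.

Lemma inner_bound H u v : gaussian_space P H -> H u -> H v ->
  `|inner P u v| <= (inner P u u + inner P v v) / 2.
Proof.
move=> gH Hu Hv.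
have E t : inner P (u + t *: v) (u + t *: v) =
    inner P u u + 2 * t * inner P u v + t ^+ 2 * inner P v v.
  by rewrite (inner_lin2 _ _ gH)// (innerC P v u); ring.
have := inner_ge0 P (u + 1 *: v); have := inner_ge0 P (u + (-1) *: v).
by rewrite !E ler_norml; lra.
Qed.

(** Only increments are required to lie in [H]. A centered process involves a time integral, which
    is no finite linear combination; its values are therefore only pointwise limits of elements of
    [H] with bounded second moments, which suffices for measurability and for Laplace transforms. *)
Definition quasi_brownian X := exists H kappa C,
  [/\ gaussian_space P H, 0 < kappa, 0 <= C &
  [/\ forall s t, 0 <= s <= 1 -> 0 <= t <= 1 -> H (X t - X s),
      forall s t, 0 <= s -> s <= t -> t <= 1 ->
        `|inner P (X t - X s) (X t - X s) - kappa * (t - s)| <= C * (t - s) ^+ 2,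
      forall s t s' t', 0 <= s -> s <= t -> t <= s' -> s' <= t' -> t' <= 1 ->
        `|inner P (X t - X s) (X t' - X s')| <= C * ((t - s) * (t' - s'))
    & forall x, 0 <= x <= 1 -> exists U : nat -> Omega -> R,
        [/\ forall n, H (U n), forall n, inner P (U n) (U n) <= C
          & forall w, U n w @[n --> \oo] --> X x w]]].

Section from_covariance.
Variables (H : set (Omega -> R)) (Y : R -> Omega -> R) (K : R -> R -> R) (kappa : R).
Hypotheses (gH : gaussian_space P H) (k0 : 0 < kappa).
Hypothesis HY : forall t, 0 <= t <= 1 -> H (Y t).
Hypothesis YK : forall s t, 0 <= s <= 1 -> 0 <= t <= 1 -> inner P (Y s) (Y t) = K s t.
Hypothesis qK : quasi_brownian_cov K kappa.

Let HB s t : 0 <= s <= 1 -> 0 <= t <= 1 -> H (Y t - Y s).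
Proof.
by move=> s1 t1; rewrite -scaleN1r; case: gH => _ + _ _ _; apply; apply: HY.
Qed.

Let innerB s t s' t' : 0 <= s <= 1 -> 0 <= t <= 1 -> 0 <= s' <= 1 -> 0 <= t' <= 1 ->
  inner P (Y t - Y s) (Y t' - Y s') = K t t' - K s t' - K t s' + K s s'.
Proof.
move=> s1 t1 s1' t1'; have E (u v : Omega -> R) : u - v = u + (-1) *: v by rewrite scaleN1r.
by rewrite !E (inner_lin2 _ _ gH) ?YK//; [ring|exact: HY..].
Qed.

Let increments C : 0 <= C ->
  (forall s t, 0 <= s -> s <= t -> t <= 1 ->
    `|K t t - K s t - K t s + K s s - kappa * (t - s)| <= C * (t - s) ^+ 2) ->
  (forall s t s' t', 0 <= s -> s <= t -> t <= s' -> s' <= t' -> t' <= 1 ->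
    `|K t t' - K s t' - K t s' + K s s'| <= C * ((t - s) * (t' - s'))) ->
  (forall s t, 0 <= s -> s <= t -> t <= 1 ->
    `|inner P (Y t - Y s) (Y t - Y s) - kappa * (t - s)| <= C * (t - s) ^+ 2) /\
  (forall s t s' t', 0 <= s -> s <= t -> t <= s' -> s' <= t' -> t' <= 1 ->
    `|inner P (Y t - Y s) (Y t' - Y s')| <= C * ((t - s) * (t' - s'))).
Proof.
move=> C0 h1 h2; split.
- move=> s t s0 st t1; rewrite innerB;
    [exact: h1|by apply/andP; split; lra..].
- move=> s t s' t' s0 st ts' st' t1; rewrite innerB;
    [exact: h2|by apply/andP; split; lra..].
Qed.

Lemma quasi_brownian_from_cov : quasi_brownian Y.
Proof.
have [C [C0 h1 h2 h3]] := qK; have [i1 i2] := increments C0 h1 h2.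
exists H, kappa, C; split => //; split => // x x1.
exists (fun=> Y x); split.
- by move=> _; exact: HY.
- by move=> _; rewrite YK//; case/andP: x1 => x0 x1; exact: le_trans (ler_norm _) (h3 x x0 x1).
- by move=> w; exact: cvg_cst.
Qed.

(* Centering does not change the increments; the time average is the limit of
   Riemann sums, which stay in the Gaussian space. *)
Lemma quasi_brownian_center_path :
  (forall w, {within `[0, 1], continuous (fun t => Y t w)}) ->
  quasi_brownian (center_path Y).
Proof.
move=> cY; have [C [C0 h1 h2 h3]] := qK; have [i1 i2] := increments C0 h1 h2.
have cB s t : center_path Y t - center_path Y s = Y t - Y s.
  apply/funext => w; rewrite /center_path.
  by rewrite -[LHS]/(_ - _ - (_ - _)) -[RHS]/(_ - _); ring.
(* A value [Y x] and a Riemann sum each have second moment at most [C], so their difference has at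
   most [4 * C]. *)
have C4 : 0 <= 4 * C by rewrite mulr_ge0.
exists H, kappa, (4 * C); split => //; split.
- by move=> s t s1 t1; rewrite cB; exact: HB.
- move=> s t s0 st t1; rewrite cB; apply: (le_trans (i1 s t s0 st t1)).
  by rewrite ler_wpM2r ?sqr_ge0//; lra.
- move=> s t s' t' s0 st ts' st' t1; rewrite !cB.
  apply: (le_trans (i2 s t s' t' s0 st ts' st' t1)).
  by rewrite ler_wpM2r ?mulr_ge0 ?subr_ge0//; lra.
- move=> x x1.
  pose Z n (i : 'I_n.+1) := Y (i%:R / n.+1%:R).
  pose A n := \sum_(i < n.+1) n.+1%:R^-1 *: Z n i.
  have N0 n : (0 : R) < n.+1%:R by rewrite ltr0n.
  have g01 n (i : 'I_n.+1) : 0 <= (i%:R / n.+1%:R : R) <= 1.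
    rewrite divr_ge0 ?ler0n ?(ltW (N0 n))//= ler_pdivrMr// mul1r ler_nat.
    exact/ltnW/ltn_ord.
  have HA n : H (A n) by apply: (gaussian_space_sum gH) => i; exact: HY.
  have YC y : 0 <= y <= 1 -> inner P (Y y) (Y y) <= C.
    by move=> y01; rewrite YK//; case/andP: y01 => y0 y1; exact: le_trans (ler_norm _) (h3 y y0 y1).
  have AC n : inner P (A n) (A n) <= C.
    rewrite (inner_sum _ _ gH); last by move=> i; exact: HY.
    have -> : C = \sum_(i < n.+1) \sum_(j < n.+1) n.+1%:R^-1 * n.+1%:R^-1 * C.
      under eq_bigr do rewrite sumr_const card_ord -mulrnAl -mulrnAr -[_^-1 *+ _]mulr_natr mulVf ?gt_eqF// mulr1.
      by rewrite sumr_const card_ord -mulrnAl -mulr_natr mulVf ?gt_eqF// mul1r.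
    apply: ler_sum => i _; apply: ler_sum => j _; apply: ler_wpM2l.
      by rewrite mulr_ge0// invr_ge0 ltW.
    apply: le_trans (ler_norm _) _.
    apply: le_trans (inner_bound gH (HY (g01 n i)) (HY (g01 n j))) _.
    by have := YC _ (g01 n i); have := YC _ (g01 n j); rewrite /Z; lra.
  have HU n : H (Y x + (-1) *: A n) by case: (gH) => _ + _ _ _; apply => //; exact: HY.
  exists (fun n => Y x + (-1) *: A n); split=> //.
  + move=> n; rewrite (inner_lin2 _ _ gH)//; try exact: HY.
    have := inner_bound gH (HY x1) (HA n); rewrite ler_norml (innerC P (A n) (Y x)).
    by have := YC _ x1; have := AC n; lra.
  + move=> w; rewrite /center_path.
    have -> : (fun n => (Y x + (-1) *: A n) w) =
        (fun n => Y x w - \sum_(i < n.+1) n.+1%:R^-1 * Y (i%:R / n.+1%:R) w).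
      apply/funext => n; rewrite scaleN1r /A fct_sumE.
      by [].
    by apply: cvgB; [exact: cvg_cst|exact: riemann_sum_cvg].
Qed.

End from_covariance.

Lemma quasi_brownian_listed X : listed_process P X -> quasi_brownian X.
Proof.
have itv01 (t : R) : 0 <= t <= 1 -> `[0, 1]%classic t by rewrite /= in_itv.
have wie W T : wiener_process P T W -> 1 <= T ->
    let H := gaussian_span (`[0, T]%classic : set R) W in
    [/\ gaussian_space P H, forall t, 0 <= t <= T -> H (W t) &
      forall s t, 0 <= s <= T -> 0 <= t <= T -> inner P (W s) (W t) = Num.min s t].
  move=> [cW _] T1; split.
  - exact: gaussian_span_space cW.
  - by move=> t t1; apply: gaussian_spanT; rewrite /= in_itv.
  - by move=> s t s1 t1; apply: centered_gaussian_inner cW _ _; rewrite /= in_itv.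
have cov K Y : centered_gaussian_process P (`[0, 1]%classic : set R) K Y ->
    quasi_brownian_cov K 1 -> quasi_brownian Y.
  move=> cY qK; apply: (quasi_brownian_from_cov (gaussian_span_space cY) (@ltr01 R) _ _ qK).
  - by move=> t t1; apply: gaussian_spanT; exact: itv01.
  - by move=> s t s1 t1; apply: centered_gaussian_inner cY _ _; exact: itv01.
(* The bridge is the case [u = 1]. The term added to [min s t] is a multiple of the smooth product
   [s * t] and leaves [kappa] equal to 1. *)
have elong W u : wiener_process P 1 W ->
    let H := gaussian_span (`[0, 1]%classic : set R) W in
    let Y t := W t + (- (u * t)) *: W 1 in
    let K s t := 1 * Num.min s t + (u ^+ 2 - 2 * u) * (s * t) in
    [/\ gaussian_space P H, forall t, 0 <= t <= 1 -> H (Y t),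
      forall s t, 0 <= s <= 1 -> 0 <= t <= 1 -> inner P (Y s) (Y t) = K s t &
      quasi_brownian_cov K 1].
  move=> wW H Y K; have [gH HW WK] := wie W 1 wW (lexx _).
  have i1 : 0 <= (1 : R) <= 1 by rewrite ler01 lexx.
  have HY t : 0 <= t <= 1 -> H (Y t).
    by move=> t1; case: (gH) => _ + _ _ _; apply; exact: HW.
  split=> //.
  - move=> s t s1 t1; rewrite /Y (inner_lin2 _ _ gH)//; try exact: HW.
    rewrite !WK//.
    rewrite (min_l (proj2 (andP s1))) (min_r (proj2 (andP t1))) minxx.
    by rewrite /K; ring.
  - have <- : 1 * 1 + (u ^+ 2 - 2 * u) * 0 = 1 :> R by ring.
    apply: quasi_brownian_cov_lin; first exact: quasi_brownian_cov_min.
    apply: (@quasi_brownian_cov_prod _ id 1) => //.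
    + by move=> s t _ st _; rewrite mul1r ger0_norm// subr_ge0.
    + by move=> s s0 s1; rewrite ger0_norm.
have elongE W u : (fun t w => W t w - u * t * W 1 w) = (fun t => W t + (- (u * t)) *: W 1) :> (R -> Omega -> R).
  by apply/funext => t; apply/funext => w; rewrite scaleNr.
have bridgeE W : bridge W = (fun t => W t + (- (1 * t)) *: W 1).
  by apply/funext => t; apply/funext => w; rewrite /bridge scaleNr mul1r.
case=> {X}.
- move=> W wW; have [gH HW WK] := wie W 1 wW (lexx _).
  exact: (quasi_brownian_from_cov gH (@ltr01 R) HW WK quasi_brownian_cov_min).
- move=> W /(elong _ 1)[gH HY YK qK]; rewrite bridgeE.
  exact: (quasi_brownian_from_cov gH (@ltr01 R) HY YK qK).
- move=> W wW; have [gH HW WK] := wie W 1 wW (lexx _).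
  apply: (quasi_brownian_center_path gH (@ltr01 R) HW WK quasi_brownian_cov_min).
  by case: wW.
- move=> W wW; have [gH HY YK qK] := elong _ 1 wW; rewrite bridgeE.
  apply: (quasi_brownian_center_path gH (@ltr01 R) HY YK qK).
  case: wW => _ cW w.
  have -> : (fun t => (W t + - (1 * t) *: W 1) w) = (fun t => W t w - t * W 1 w).
    by apply/funext => t; rewrite scaleNr mul1r.
  move=> t.
  apply: cvgB; first exact: cW.
  apply: cvgMl; exact: (continuous_subspaceT (f := id) (fun t => cvg_id)).
- move=> W u wW _; have [gH HY YK qK] := elong _ u wW; rewrite elongE.
  exact: (quasi_brownian_from_cov gH (@ltr01 R) HY YK qK).
- move=> W c c1 wW; have c1' : 1 <= 1 + c by lra.
  have [gH HW WK] := wie W (1 + c) wW c1'.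
  have I1 (t : R) : 0 <= t <= 1 -> 0 <= t <= 1 + c.
    by move=> /andP[t0 t1]; apply/andP; split; lra.
  have I2 (t : R) : 0 <= t <= 1 -> 0 <= t + c <= 1 + c.
    by move=> /andP[t0 t1]; apply/andP; split; lra.
  have -> : (fun t w => W (t + c) w - W t w) = (fun t => W (t + c) + (-1) *: W t) :> (R -> Omega -> R).
    by apply/funext => t; apply/funext => w; rewrite scaleN1r.
  have HY t : 0 <= t <= 1 ->
      gaussian_span `[0, (1 + c)]%classic W (W (t + c) + (-1) *: W t).
    by move=> t1; case: (gH) => _ + _ _ _; apply; apply: HW; [exact: I2|exact: I1].
  (* As [c >= 1], any two windows [[s, s + c]] and [[t, t + c]] overlap in length [c - |s - t|];
     both ends of the window move, whence [kappa = 2]. *)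
  apply: (@quasi_brownian_from_cov _ _ (fun s t => c * (1 * 1) + (-1) * `|s - t|) 2 gH) => //.
  + move=> s t s1 t1; rewrite (inner_lin2 _ _ gH)//; try by apply: HW; rewrite ?I2 ?I1.
    rewrite !WK ?I2 ?I1//.
    move/andP: s1 => [s0 s1]; move/andP: t1 => [t0 t1].
    have st : t <= s + c by lra.
    have ts : s <= t + c by lra.
    rewrite (min_r st) (min_l ts).
    have [h|h] := orP (le_total s t).
      rewrite (ler0_norm (_ : s - t <= 0)) ?subr_le0// (min_l h).
      by rewrite (min_l (_ : s + c <= t + c)) ?lerD2r//; ring.
    rewrite (ger0_norm (_ : 0 <= s - t)) ?subr_ge0// (min_r h).
    by rewrite (min_r (_ : t + c <= s + c)) ?lerD2r//; ring.
  + have <- : c * 0 + (-1) * (- 2) = 2 :> R by ring.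
    apply: quasi_brownian_cov_lin; last exact: quasi_brownian_cov_dist.
    apply: (@quasi_brownian_cov_prod _ (fun=> 1) 1) => //.
    * by move=> s t _ st _; rewrite subrr normr0 mul1r subr_ge0.
    * by move=> *; rewrite normr1.
- move=> X a a0 cX; apply: (cov _ _ cX).
  have <- : (2 * a)^-1 * (- (2 * - a)) + 0 * 0 = 1 :> R by field; rewrite gt_eqF.
  apply: (eq_quasi_brownian_cov _ (quasi_brownian_cov_lin (2 * a)^-1 0
    (quasi_brownian_cov_expR_dist (- a)) (quasi_brownian_cov_expRD 0))).
  by move=> s t; rewrite /ou_cov mul0r addr0 mulrC.
- move=> X a a0 cX; apply: (cov _ _ cX).
  have <- : (2 * a)^-1 * (- (2 * - a)) + (- (2 * a)^-1) * 0 = 1 :> R by field.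
  apply: (eq_quasi_brownian_cov _ (quasi_brownian_cov_lin (2 * a)^-1 (- (2 * a)^-1)
    (quasi_brownian_cov_expR_dist (- a)) (quasi_brownian_cov_expRD (- a)))).
  by move=> s t; rewrite /ou0_cov; ring.
- move=> X a a0 cX; apply: (cov _ _ cX).
  have e0 : expR a - 1 != 0 by rewrite gt_eqF// subr_gt0 -[ltLHS]expR0 ltr_expR.
  (* The growing exponential contributes [- 2 * a * c] to [kappa] and the decaying one
     [2 * a * c * exp a]; their sum is 1. *)
  pose c := (2 * a)^-1 / (expR a - 1).
  have <- : c * (- (2 * a)) + (c * expR a) * (- (2 * - a)) = 1 :> R.
    by rewrite /c; field; rewrite e0 gt_eqF.
  apply: (eq_quasi_brownian_cov _ (quasi_brownian_cov_lin c (c * expR a)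
    (quasi_brownian_cov_expR_dist a) (quasi_brownian_cov_expR_dist (- a)))).
  by move=> s t; rewrite /bogolyubov_cov expRD -mulNr /c; ring.
Qed.

End quasi_brownian.

(** * Atoms of a degenerate self-similar measure *)

(* Only the atoms [x J k] with [0 < k] and the intervals [lo J k, hi J k] with
   [k != m] matter; [x0] is the accumulation point of the atoms. *)
Record geometric_atoms {R : realType} {n : nat}
    (mu : probability (measurableTypeR R) R) (m : 'I_n) (delta a : R)
    (x w lo hi : nat -> 'I_n -> R) (x0 p : R) : Prop := GeometricAtoms {
  ga_delta : 0 < delta < 1;
  ga_a : 0 < a < 1;
  ga_p : 0 < p;
  ga_x0 : 0 <= x0 <= 1;
  ga_integral : forall g : R -> R, (forall t, 0 <= g t) ->
    (\int[mu]_(t in `[0%R, 1%R]) (g t)%:E =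
     \sum_(J <oo) (\sum_(k < n | (0 < k)%N) w J k * g (x J k))%:E)%E;
  ga_x : forall J (k : 'I_n), (0 < k)%N -> 0 <= x J k <= 1;
  ga_w : forall J (k : 'I_n), (0 < k)%N -> 0 <= w J k <= delta ^+ J;
  ga_dist : forall J (k : 'I_n), (0 < k)%N -> `|x J k - x0| <= a ^+ J;
  ga_itv : forall J k, [/\ 0 <= lo J k, lo J k <= hi J k & hi J k <= 1];
  ga_length : forall J k, p * a ^+ J <= hi J k - lo J k <= a ^+ J;
  ga_lo : forall J k, k != m -> exists J' (k' : 'I_n),
    [/\ (0 < k')%N, lo J k = x J' k' & p * delta ^+ J <= w J' k'];
  ga_hi : forall J k, k != m -> exists J' (k' : 'I_n),
    [/\ (0 < k')%N, hi J k = x J' k' & p * delta ^+ J <= w J' k'];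
  ga_sep : forall J k J' k', k != m -> k' != m -> (J, k) != (J', k') ->
    hi J k <= lo J' k' \/ hi J' k' <= lo J k }.

(** * One-sided limits under almost everywhere equality *)

Section one_sided_limits.
Context {R : realType}.
Implicit Types (g h : R -> R) (a b t : R).

Lemma ae_witness (Q : R -> Prop) a b : a < b ->
  {ae (@lebesgue_measure R), forall x, Q x} -> exists2 x, a < x < b & Q x.
Proof.
move=> ab [N [mN N0 NQ]]; apply: contrapT => /forall2NP H.
have sub : (`]a, b[%classic : set (measurableTypeR R)) `<=` N.
  move=> x; rewrite /= in_itv/= => xab; apply: NQ => Qx.
  by case: (H x).
have N0' : (lebesgue_measure N <= 0)%E by rewrite N0.
have mab : lebesgue_measure (`]a, b[%classic : set R) = (b - a)%:E.
  by rewrite lebesgue_measure_itv/= lte_fin ab.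
have : ((b - a)%:E <= 0)%E.
  rewrite -mab; exact: (le_trans (le_measure (@lebesgue_measure R)
    (mem_set (measurable_itv `]a, b[)) (mem_set mN) sub) N0').
by rewrite lee_fin subr_le0 leNgt ab.
Qed.

Lemma ae_mono (Q Q' : R -> Prop) : {ae (@lebesgue_measure R), forall x, Q x} ->
  (forall x, Q x -> Q' x) -> {ae (@lebesgue_measure R), forall x, Q' x}.
Proof.
move=> [N [mN N0 NQ]] QQ'; exists N; split=> // x Q'x.
by apply: NQ => /QQ'.
Qed.

(** An almost everywhere identity holds at points arbitrarily close to [t] on the left. This turns
    the fixed-point equation, known only almost everywhere, into identities at every point. *)
Lemma ae_eq_left_lim g h a t (l1 l2 : R) : a < t ->
  {ae (@lebesgue_measure R), forall x, a < x < t -> g x = h x} ->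
  g x @[x --> t^'-] --> l1 -> h x @[x --> t^'-] --> l2 -> l1 = l2.
Proof.
move=> at_ gh gl hl; apply/eqP; rewrite -subr_eq0 -normr_le0.
apply/ler_addgt0Pr => eps eps0; rewrite add0r.
have e2 : 0 < eps / 2 by rewrite divr_gt0.
have /cvgrPdist_lt /(_ _ e2) gl' := gl; have /cvgrPdist_lt /(_ _ e2) hl' := hl.
have : \forall x \near t^'-, `|l1 - g x| < eps / 2 /\ `|l2 - h x| < eps / 2.
  by near=> x; split; near: x.
move=> /nbhs_ballP[r /= r0 hr].
have [x /andP[x1 x2] /= ghx] : exists2 x, Num.max a (t - r) < x < t & (a < x < t -> g x = h x).
  by apply: (ae_witness _ gh); rewrite gt_max at_ ltrBlDr ltrDl.
move: x1; rewrite gt_max => /andP[ax trx].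
have [|h1 h2] := hr x _ x2.
  by rewrite /ball/= ltr_norml; apply/andP; split; lra.
rewrite -(ghx (introT andP (conj ax x2))) in h2.
have -> : l1 - l2 = (l1 - g x) - (l2 - g x) by ring.
by apply: le_trans (ler_normB _ _) _; lra.
Unshelve. all: by end_near. Qed.

Lemma ae_eq_right_lim g h t b (l1 l2 : R) : t < b ->
  {ae (@lebesgue_measure R), forall x, t < x < b -> g x = h x} ->
  g x @[x --> t^'+] --> l1 -> h x @[x --> t^'+] --> l2 -> l1 = l2.
Proof.
move=> tb gh gl hl; apply/eqP; rewrite -subr_eq0 -normr_le0.
apply/ler_addgt0Pr => eps eps0; rewrite add0r.
have e2 : 0 < eps / 2 by rewrite divr_gt0.
have /cvgrPdist_lt /(_ _ e2) gl' := gl; have /cvgrPdist_lt /(_ _ e2) hl' := hl.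
have : \forall x \near t^'+, `|l1 - g x| < eps / 2 /\ `|l2 - h x| < eps / 2.
  by near=> x; split; near: x.
move=> /nbhs_ballP[r /= r0 hr].
have [x /andP[x1 x2] /= ghx] : exists2 x, t < x < Num.min b (t + r) & (t < x < b -> g x = h x).
  by apply: (ae_witness _ gh); rewrite lt_min tb ltrDl.
move: x2; rewrite lt_min => /andP[xb xtr].
have [|h1 h2] := hr x _ x1.
  by rewrite /ball/= ltr_norml; apply/andP; split; lra.
rewrite -(ghx (introT andP (conj x1 xb))) in h2.
have -> : l1 - l2 = (l1 - g x) - (l2 - g x) by ring.
by apply: le_trans (ler_normB _ _) _; lra.
Unshelve. all: by end_near. Qed.

Lemma cvg_affine_incr_left c b t : 0 < c -> (c * x + b) @[x --> t^'-] --> (c * t + b)^'-.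
Proof.
move=> c0 A [r /= r0 hA]; exists (r / c) => /=; first by rewrite divr_gt0.
move=> x; rewrite /ball/= => xt xlt; apply: hA => /=; last by rewrite ltrD2r ltr_pM2l.
rewrite /ball/= (_ : _ - _ = c * (t - x)); last by ring.
by rewrite normrM gtr0_norm// mulrC -ltr_pdivlMr.
Qed.

Lemma cvg_affine_incr_right c b t : 0 < c -> (c * x + b) @[x --> t^'+] --> (c * t + b)^'+.
Proof.
move=> c0 A [r /= r0 hA]; exists (r / c) => /=; first by rewrite divr_gt0.
move=> x; rewrite /ball/= => xt xlt; apply: hA => /=; last by rewrite ltrD2r ltr_pM2l.
rewrite /ball/= (_ : _ - _ = c * (t - x)); last by ring.
by rewrite normrM gtr0_norm// mulrC -ltr_pdivlMr.
Qed.

Lemma cvg_affine_decr_left c b t : c < 0 -> (c * x + b) @[x --> t^'-] --> (c * t + b)^'+.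
Proof.
move=> c0 A [r /= r0 hA]; exists (r / - c) => /=; first by rewrite divr_gt0// oppr_gt0.
move=> x; rewrite /ball/= => xt xlt; apply: hA => /=; last by rewrite ltrD2r ltr_nM2l.
rewrite /ball/= (_ : _ - _ = c * (t - x)); last by ring.
by rewrite normrM ltr0_norm// mulrC -ltr_pdivlMr// oppr_gt0.
Qed.

Lemma cvg_affine_decr_right c b t : c < 0 -> (c * x + b) @[x --> t^'+] --> (c * t + b)^'-.
Proof.
move=> c0 A [r /= r0 hA]; exists (r / - c) => /=; first by rewrite divr_gt0// oppr_gt0.
move=> x; rewrite /ball/= => xt xlt; apply: hA => /=; last by rewrite ltrD2r ltr_nM2l.
rewrite /ball/= (_ : _ - _ = c * (t - x)); last by ring.
by rewrite normrM ltr0_norm// mulrC -ltr_pdivlMr// oppr_gt0.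
Qed.

End one_sided_limits.

(** * The fixed point and the measure that it defines *)

Section self_similar_measure.
Context {R : realType} {n : nat}.
Variables (alpha : 'I_n.+1 -> R) (e : 'I_n -> bool) (d beta : 'I_n -> R) (m : 'I_n).
Variable mu : probability (measurableTypeR R) R.
Variable f : R -> R.

Implicit Types (s t x y : R) (k : 'I_n) (j J : nat).

Local Notation l := (lknot alpha).
Local Notation r := (rknot alpha).
Local Notation S := (simmap alpha e m).
Local Notation T := (simmap_inv alpha e m).

Hypothesis n2 : (2 <= n)%N.
Hypothesis alpha0 : alpha ord0 = 0.
Hypothesis alpha1 : alpha ord_max = 1.
Hypothesis alpha_lt : forall i j : 'I_n.+1, (i < j)%N -> alpha i < alpha j.
Hypothesis dm0 : d m != 0.
Hypothesis dk0 : forall k, k != m -> d k = 0.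
Hypothesis dm1 : `|d m| < 1.
Hypothesis mu01 : mu `[0, 1]%classic = 1%E.
Hypothesis f_ae : {ae (@lebesgue_measure R),
  forall t, 0 < t < 1 -> simop alpha e d beta f t = f t}.
Hypothesis f_left : forall t : R, 0 < t <= 1 -> f x @[x --> t^'-] --> f t.
Hypothesis f_0 : f x @[x --> 0^'+] --> f 0.
Hypothesis f_jump : forall k : 'I_n.+1, (0 < k < n)%N ->
  right_value f (alpha k) != f (alpha k).
Hypothesis f_mu : forall a b : R, 0 <= a -> a <= b -> b <= 1 ->
  mu `[a, b]%classic = (right_value f b - f a)%:E.

Lemma alpha_le (i j : 'I_n.+1) : (i <= j)%N -> alpha i <= alpha j.
Proof.
rewrite leq_eqVlt => /predU1P[ij|/alpha_lt/ltW//].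
by rewrite (val_inj ij).
Qed.

Lemma lknot_lt_rknot k : l k < r k.
Proof. exact: alpha_lt. Qed.

Lemma gap_gt0 k : 0 < gap alpha k.
Proof. by rewrite subr_gt0 lknot_lt_rknot. Qed.

Lemma lknot_ge0 k : 0 <= l k.
Proof. by rewrite -alpha0 alpha_le. Qed.

Lemma rknot_le1 k : r k <= 1.
Proof. by rewrite -alpha1 alpha_le//= -ltnS ltn_ord. Qed.

Lemma rknot_le_lknot (k k' : 'I_n) : (k < k')%N -> r k <= l k'.
Proof. by move=> kk; apply: alpha_le. Qed.

Lemma lknot_gt0 (k : 'I_n) : (0 < k)%N -> 0 < l k.
Proof. by move=> k0; rewrite -alpha0; exact: alpha_lt. Qed.

Lemma lknot_lt1 (k : 'I_n) : l k < 1.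
Proof. exact: lt_le_trans (lknot_lt_rknot k) (rknot_le1 k). Qed.

Lemma gap_itv_inj k k' x : l k < x < r k -> l k' < x < r k' -> k = k'.
Proof.
move=> /andP[h1 h2] /andP[h3 h4]; apply/val_inj/eqP; case: ltngtP => // kk.
  by have := rknot_le_lknot kk; lra.
by have := rknot_le_lknot kk; lra.
Qed.

Lemma simop_gap k x : l k < x < r k ->
  simop alpha e d beta f x = d k * f (simmap_inv alpha e k x) + beta k.
Proof.
move=> xk; rewrite /simop (bigD1 k)//= big1 => [|k' kk'].
  by rewrite addr0 indicE mem_set ?mulr1//= in_itv.
rewrite indicE memNset ?mulr0//= in_itv/= => xk'.
by move/eqP: kk'; apply; exact: gap_itv_inj xk' xk.
Qed.

Lemma f_gap_ae k : {ae (@lebesgue_measure R), forall x, l k < x < r k ->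
  f x = d k * f (simmap_inv alpha e k x) + beta k}.
Proof.
apply: (ae_mono f_ae) => x hx xk; rewrite -(simop_gap xk) hx//.
have [x1 x2] := andP xk.
by rewrite (le_lt_trans (lknot_ge0 k) x1) (lt_le_trans x2 (rknot_le1 k)).
Qed.

Lemma right_value1 : right_value f 1 = f 1.
Proof. by rewrite /right_value ltxx. Qed.

Lemma f_nondecreasing s t : 0 <= s -> s <= t -> t <= 1 -> f s <= f t.
Proof.
move=> s0 st t1; have s1 := le_trans st t1; have t0 := le_trans s0 st.
have ms := f_mu s0 s1 (lexx _); have mt := f_mu t0 t1 (lexx _).
rewrite right_value1 in ms mt.
have : (mu `[t, 1%R]%classic <= mu `[s, 1%R]%classic)%E.
  apply: le_measure; rewrite ?inE; try exact: measurable_itv.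
  by move=> x /=; rewrite !in_itv/= => /andP[tx ->]; rewrite (le_trans st).
by rewrite ms mt lee_fin; lra.
Qed.

(** [right_value] is built on [lim], which is meaningful only when the limit exists; it does because
    [f] is monotone, the measure being nonnegative. *)
Lemma f_right t : 0 <= t < 1 -> f x @[x --> t^'+] --> right_value f t.
Proof.
move=> /andP[t0 t1]; rewrite /right_value t1.
apply: (@nondecreasing_at_right_is_cvgr R f t).
  near=> b => x y; rewrite !in_itv/= => /andP[tx xb] /andP[ty yb] xy.
  have b1 : b <= 1 by near: b; exact: nbhs_right_le.
  by apply: f_nondecreasing => //; lra.
near=> b; exists (f t) => _ [x + <-]; rewrite /= in_itv/= => /andP[tx xb].
have b1 : b <= 1 by near: b; exact: nbhs_right_le.
by apply: f_nondecreasing => //; lra.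
Unshelve. all: by end_near. Qed.

Lemma f_gap_cst k t : k != m -> l k < t <= r k -> f t = beta k.
Proof.
move=> km /andP[lt tr].
have t01 : 0 < t <= 1.
  by rewrite (le_lt_trans (lknot_ge0 k) lt) (le_trans tr (rknot_le1 k)).
apply: (ae_eq_left_lim lt _ (f_left t01) (cvg_cst _)).
apply: (ae_mono (f_gap_ae k)) => x hx /andP[lx xt].
by rewrite hx ?(dk0 km) ?mul0r ?add0r// lx (lt_le_trans xt).
Qed.

Lemma f_gap_cst_right k t : k != m -> l k <= t < r k -> right_value f t = beta k.
Proof.
move=> km /andP[lt tr].
have t01 : 0 <= t < 1.
  by rewrite (le_trans (lknot_ge0 k) lt) (lt_le_trans tr (rknot_le1 k)).
apply: (ae_eq_right_lim tr _ (f_right t01) (cvg_cst _)).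
apply: (ae_mono (f_gap_ae k)) => x hx /andP[tx xr].
by rewrite hx ?(dk0 km) ?mul0r ?add0r// (le_lt_trans lt) .
Qed.

Let am0 : 0 < gap alpha m. Proof. exact: gap_gt0. Qed.
Let STK : cancel S T. Proof. exact: simmapK (lknot_lt_rknot m). Qed.
Let TSK : cancel T S. Proof. exact: simmap_invK (lknot_lt_rknot m). Qed.

Lemma simmap_gap t : 0 < t < 1 -> l m < S t < r m.
Proof.
move=> /andP[t0 t1]; rewrite /simmap.
have rE : r m = gap alpha m + l m by rewrite /gap subrK.
have h1 : 0 < gap alpha m * t by rewrite mulr_gt0.
have h2 : gap alpha m * t < gap alpha m by rewrite gtr_pMr.
by case: (e m); rewrite rE; apply/andP; split; lra.
Qed.

Lemma simmap_gapE t : (l m < S t < r m) = (0 < t < 1).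
Proof.
apply/idP/idP; last exact: simmap_gap.
have rE : r m = gap alpha m + l m by rewrite /gap subrK.
rewrite /simmap rE; move: am0; set a := gap alpha m => a0.
by case: (e m) => /andP[h1 h2]; apply/andP; split;
  rewrite -(ltr_pM2l a0) ?mulr0 ?mulr1; lra.
Qed.

Lemma T_affine : exists b, forall x, T x = (if e m then - 1 else 1) / gap alpha m * x + b.
Proof.
exists ((if e m then r m else - l m) / gap alpha m) => x.
by rewrite /simmap_inv; case: (e m); ring.
Qed.

(** If [S] reverses orientation, approaching [S t] from the left means approaching [t] from the
    right, so the two one-sided values are exchanged. *)
Lemma f_self_similar t : 0 < t < 1 ->
  f (S t) = d m * (if e m then right_value f t else f t) + beta m /\
  right_value f (S t) = d m * (if e m then f t else right_value f t) + beta m.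
Proof.
move=> t01; have St := simmap_gap t01; have /andP[St1 St2] := St.
have /andP[t0 t1] := t01.
have S01 : 0 < S t < 1.
  by rewrite (le_lt_trans (lknot_ge0 m) St1) (lt_le_trans St2 (rknot_le1 m)).
have /andP[S0 S1] := S01.
have ft : f x @[x --> t^'-] --> f t by apply: f_left; rewrite t0 ltW.
have ft' : f x @[x --> t^'+] --> right_value f t by apply: f_right; rewrite t1 ltW.
have fS : f x @[x --> (S t)^'-] --> f (S t) by apply: f_left; rewrite S0 ltW.
have fS' : f x @[x --> (S t)^'+] --> right_value f (S t) by apply: f_right; rewrite S1 ltW.
have aeL : {ae (@lebesgue_measure R), forall x, l m < x < S t -> f x = d m * f (T x) + beta m}.
  apply: (ae_mono (f_gap_ae m)) => x hx /andP[lx xt].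
  by apply: hx; rewrite lx (lt_trans xt).
have aeR : {ae (@lebesgue_measure R), forall x, S t < x < r m -> f x = d m * f (T x) + beta m}.
  apply: (ae_mono (f_gap_ae m)) => x hx /andP[lx xt].
  by apply: hx; rewrite xt (lt_trans St1).
have [b TE] := T_affine.
have Tt : T (S t) = t by exact: STK.
have lin (F : set_system R) (L : R) : Filter F -> f (T x) @[x --> F] --> L ->
    d m * f (T x) + beta m @[x --> F] --> d m * L + beta m.
  by move=> FF h; apply: cvgD; [exact: cvgMr|exact: cvg_cst].
have Tfun : T = (fun x => (if e m then - 1 else 1) / gap alpha m * x + b) by exact/funext.
case em : (e m); rewrite em in Tfun TE.
- have c0 : -1 / gap alpha m < 0 by rewrite mulN1r oppr_lt0 invr_gt0.
  have TL : T x @[x --> (S t)^'-] --> t^'+.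
    by rewrite -[in X in _ --> X]Tt TE Tfun; exact: cvg_affine_decr_left.
  have TR : T x @[x --> (S t)^'+] --> t^'-.
    by rewrite -[in X in _ --> X]Tt TE Tfun; exact: cvg_affine_decr_right.
  split.
  + apply: (ae_eq_left_lim St1 aeL fS); apply: lin; exact: cvg_comp TL ft'.
  + apply: (ae_eq_right_lim St2 aeR fS'); apply: lin; exact: cvg_comp TR ft.
- have c0 : 0 < 1 / gap alpha m by rewrite mul1r invr_gt0.
  have TL : T x @[x --> (S t)^'-] --> t^'-.
    by rewrite -[in X in _ --> X]Tt TE Tfun; exact: cvg_affine_incr_left.
  have TR : T x @[x --> (S t)^'+] --> t^'+.
    by rewrite -[in X in _ --> X]Tt TE Tfun; exact: cvg_affine_incr_right.
  split.
  + apply: (ae_eq_left_lim St1 aeL fS); apply: lin; exact: cvg_comp TL ft.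
  + apply: (ae_eq_right_lim St2 aeR fS'); apply: lin; exact: cvg_comp TR ft'.
Qed.

Definition jump t : R := right_value f t - f t.

Lemma mu_jump t : 0 <= t <= 1 -> mu [set t] = (jump t)%:E.
Proof. by move=> /andP[t0 t1]; rewrite -set_itv1 f_mu. Qed.

Lemma increment_ge0 s t : 0 <= s -> s <= t -> t <= 1 -> 0 <= right_value f t - f s.
Proof. by move=> s0 st t1; rewrite -lee_fin -f_mu. Qed.

Lemma increment_le1 s t : 0 <= s -> s <= t -> t <= 1 -> right_value f t - f s <= 1.
Proof. by move=> s0 st t1; rewrite -lee_fin -f_mu//; exact: probability_le1. Qed.

Lemma jump_ge0 t : 0 <= t <= 1 -> 0 <= jump t.
Proof. by move=> /andP[t0 t1]; exact: increment_ge0. Qed.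

Lemma jump_le1 t : 0 <= t <= 1 -> jump t <= 1.
Proof. by move=> /andP[t0 t1]; exact: increment_le1. Qed.

(** The factor by which [S] multiplies masses, the sign accounting for a reversed orientation. *)
Let sigma := if e m then - d m else d m.

(** The endpoints are existential because the orientation decides which image is the left one;
    keeping them strictly inside []0, 1[] allows iteration. *)
Lemma preimage_simmap_inv s t : 0 < s -> s <= t -> t < 1 ->
  exists s' t', [/\ T @^-1` `[s, t]%classic = `[s', t']%classic,
    0 < s', s' <= t', t' < 1 &
    right_value f t' - f s' = sigma * (right_value f t - f s)].
Proof.
move=> s0 st t1; have s01 : 0 < s < 1 by rewrite s0 (le_lt_trans st).
have t01 : 0 < t < 1 by rewrite t1 (lt_le_trans s0).
have [fs rs] := f_self_similar s01; have [ft rt] := f_self_similar t01.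
have /andP[ls sr] := simmap_gap s01; have /andP[lt tr] := simmap_gap t01.
have l0 := lknot_ge0 m; have r1 := rknot_le1 m.
have TE' y : (s <= y <= t) = (if e m then S t <= S y <= S s else S s <= S y <= S t).
  rewrite /simmap; case: (e m).
    by rewrite !lerD2l !lerN2 !ler_pM2l// andbC.
  by rewrite !lerD2r !ler_pM2l.
have TE x : (s <= T x <= t) = (if e m then S t <= x <= S s else S s <= x <= S t).
  by rewrite TE' TSK.
have preE a b : (forall x, (s <= T x <= t) = (a <= x <= b)) ->
    T @^-1` `[s, t]%classic = `[a, b]%classic.
  by move=> h; apply/seteqP; split=> x /=; rewrite !in_itv/= h.
rewrite /sigma; case: (e m) TE fs rs ft rt => TE fs rs ft rt.
- exists (S t), (S s); split; [exact: preE|lra| |lra|by rewrite ft rs; ring].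
  have : s <= T (S t) <= t by rewrite STK st lexx.
  by rewrite TE => /andP[].
- exists (S s), (S t); split; [exact: preE|lra| |lra|by rewrite fs rt; ring].
  have : s <= T (S t) <= t by rewrite STK st lexx.
  by rewrite TE => /andP[].
Qed.

Lemma jump_knot_gt0 (i : 'I_n.+1) : (0 < i < n)%N -> 0 < jump (alpha i).
Proof.
move=> /andP[i0 iN]; rewrite lt_neqAle eq_sym subr_eq0 f_jump ?i0// jump_ge0//.
by rewrite -{1}alpha0 -alpha1 !alpha_le//= -ltnS.
Qed.

Lemma jump_simmap t : 0 < t < 1 -> jump (S t) = sigma * jump t.
Proof.
by move=> /f_self_similar[ft rt]; rewrite /jump ft rt /sigma; case: (e m); ring.
Qed.

(** As [n >= 2] there is an inner knot, where the jump is positive; the jump at its image is [sigma]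
    times that and is nonnegative. *)
Lemma sigmaE : sigma = `|d m|.
Proof.
have n1 : (1 < n.+1)%N by rewrite ltnS ltnW.
pose i : 'I_n.+1 := Ordinal n1.
have i0 : (0 < i < n)%N by [].
have t01 : 0 < alpha i < 1.
  by rewrite -{1}alpha0 -alpha1 !alpha_lt.
have /andP[S0 S1] := simmap_gap t01.
have S01 : 0 <= S (alpha i) <= 1.
  by have := lknot_ge0 m; have := rknot_le1 m; rewrite (ltW (le_lt_trans _ S0)) ?lknot_ge0// (ltW (lt_le_trans S1 _)) ?rknot_le1.
have : 0 <= sigma.
  by have := jump_ge0 S01; rewrite jump_simmap// pmulr_lge0// jump_knot_gt0.
by move=> s0; rewrite -(ger0_norm s0) /sigma; case: (e m); rewrite ?normrN.
Qed.

Lemma measurable_iter_simmap_inv J : measurable_fun [set: measurableTypeR R] (iter J T : _ -> measurableTypeR R).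
Proof.
have cT : continuous (T : R -> R).
  have [b /funext ->] := T_affine => x.
  by apply: cvgD; [apply: cvgMr; exact: cvg_id|exact: cvg_cst].
have mT : measurable_fun [set: R] T by exact: continuous_measurable_fun.
elim: J => [|J IH]; first exact: measurable_id.
by apply: (measurableT_comp (f := T) (g := iter J T)).
Qed.

Lemma measurable_preimage_iter J (A : set (measurableTypeR R)) : measurable A ->
  measurable ((iter J T : measurableTypeR R -> _) @^-1` A).
Proof. by move=> mA; rewrite -[X in measurable X]setTI; exact: measurable_iter_simmap_inv. Qed.

Lemma mu_iter J s t : 0 < s -> s <= t -> t < 1 ->
  mu (iter J T @^-1` `[s, t]%classic) = (`|d m| ^+ J * (right_value f t - f s))%:E.
Proof.
elim: J s t => [|J IH] s t s0 st t1.
  rewrite expr0 mul1r -f_mu ?(ltW s0) ?(ltW t1)//.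
have [s' [t' [E s'0 st' t'1 inc]]] := preimage_simmap_inv s0 st t1.
have -> : iter J.+1 T @^-1` `[s, t]%classic = iter J T @^-1` (T @^-1` `[s, t]%classic) by [].
by rewrite E IH// inc sigmaE exprSr mulrA.
Qed.

Lemma mu_iter_open J (u v c : R) : 0 <= u -> u < v -> v <= 1 ->
  (forall s t, u < s -> s <= t -> t < v -> right_value f t - f s <= c) ->
  (mu (iter J T @^-1` `]u, v[%classic) <= (`|d m| ^+ J * c)%:E)%E.
Proof.
(* The denominator starts at 2 so that each closed interval [[u + w N, v - w N]] of the exhaustion
   is nonempty. *)
move=> u0 uv v1 h; pose w N : R := (v - u) / N.+2%:R.
have w0 N : 0 < w N by rewrite divr_gt0 ?subr_gt0.
have w2 N : w N <= (v - u) / 2.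
  by rewrite ler_pM2l ?subr_gt0// lef_pV2 ?posrE ?ltr0n// ler_nat.
pose F N : set (measurableTypeR R) := iter J T @^-1` `[u + w N, v - w N]%classic.
have FU : \bigcup_N F N = iter J T @^-1` `]u, v[%classic.
  apply/seteqP; split=> x /=.
    move=> [N _]; rewrite /F/= !in_itv/= => /andP[h1 h2].
    by have w0N := w0 N; apply/andP; split; lra.
  rewrite in_itv/= => /andP[h1 h2].
  pose r0 := Num.min (iter J T x - u) (v - iter J T x).
  have r00 : 0 < r0 by rewrite lt_min !subr_gt0 h1.
  have [N _ hN] : \forall N \near \oo, w N < r0.
    have [N _ hN] : \forall N \near \oo, (v - u) / r0 < N%:R by exact: nbhs_infty_gtr.
    exists N => // K NK; rewrite /w ltr_pdivrMr// mulrC -ltr_pdivrMr//.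
    by apply: lt_le_trans (hN K NK) _; rewrite ler_nat; exact: leq_trans (leqnSn _) (leqnSn _).
  exists N => //; rewrite /F/= in_itv/=; have := hN N (leqnn N).
  by rewrite /r0 lt_min => /andP[g1 g2]; apply/andP; split; lra.
have mF N : measurable (F N) by apply: measurable_preimage_iter; exact: measurable_itv.
have cv := @nondecreasing_cvg_mu _ (measurableTypeR R) R mu F mF.
have mU : measurable (\bigcup_N F N) by exact: bigcupT_measurable.
have {}cv := cv mU; rewrite FU in cv.
have ndF : {homo F : N M / (N <= M)%N >-> (N <= M)%O}.
  move=> N M NM; apply/subsetPset => x; rewrite /F/= !in_itv/= => /andP[h1 h2].
  have : w M <= w N by rewrite ler_pM2l ?subr_gt0// lef_pV2 ?posrE ?ltr0n// ler_nat.
  by move=> wMN; apply/andP; split; lra.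
have {}cv := cv ndF.
rewrite -(cvg_lim _ cv)//; apply: lime_le; first exact: cvgP cv.
near=> N; rewrite /= /F mu_iter; last 3 first.
- by have := w0 N; lra.
- by have := w2 N; lra.
- by have := w0 N; lra.
rewrite lee_fin ler_wpM2l ?exprn_ge0// h//; first by have := w0 N; lra.
- by have := w2 N; lra.
- by have := w0 N; lra.
Unshelve. all: by end_near. Qed.

Lemma knot_cases y : 0 < y < 1 ->
  (exists k, l k < y < r k) \/ (exists2 k : 'I_n, (0 < k)%N & y = l k).
Proof.
move=> /andP[y0 y1].
have n0 : (0 < n)%N by apply: ltnW.
pose k0 : 'I_n := Ordinal n0.
have lk0 : l k0 <= y.
  by rewrite (_ : l k0 = 0) ?ltW// -alpha0; congr alpha; exact: val_inj.
have [k lky kmax] := @arg_maxnP 'I_n k0 (fun k => l k <= y) val lk0.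
have yr : y < r k.
  rewrite ltNge; apply/negP => rky.
  have [kn|kn] := ltnP k.+1 n.
    have /kmax : l (Ordinal kn) <= y.
      by rewrite (_ : l _ = r k)//; congr alpha; exact: val_inj.
    by rewrite /= ltnn.
  have : r k = 1.
    rewrite -alpha1; congr alpha; apply: val_inj => /=.
    by apply/eqP; rewrite eqn_leq kn andbT ltn_ord.
  by lra.
have [lyE|ly] := eqVneq (l k) y; last first.
  by left; exists k; rewrite yr lt_neqAle ly lky.
right; exists k => //; rewrite lt0n; apply/eqP => k00.
have : l k = 0 by rewrite -alpha0; congr alpha; exact: val_inj.
by lra.
Qed.

Definition atom J k : R := iter J S (l k).

Definition inner_knots : seq 'I_n := [seq k : 'I_n <- enum 'I_n | (0 < k)%N].

Lemma mem_inner_knots (k : 'I_n) : (k \in inner_knots) = (0 < k)%N.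
Proof. by rewrite mem_filter mem_enum andbT. Qed.

Lemma inner_knots_uniq : uniq inner_knots.
Proof. exact/filter_uniq/enum_uniq. Qed.

Lemma iter_simmapK J : cancel (iter J S) (iter J T).
Proof. by elim: J => // J IH x; rewrite iterSr [iter J.+1 S x]/= STK. Qed.

Lemma iter_simmap_invK J : cancel (iter J T) (iter J S).
Proof. by elim: J => // J IH x; rewrite iterSr [iter J.+1 T x]/= TSK. Qed.

Lemma iter_simmap_itv J t : 0 < t < 1 -> 0 < iter J S t < 1.
Proof.
move=> t01; elim: J => // J /simmap_gap /= /andP[h1 h2].
by rewrite (le_lt_trans (lknot_ge0 m) h1) (lt_le_trans h2 (rknot_le1 m)).
Qed.

Lemma jump_iter J t : 0 < t < 1 -> jump (iter J S t) = `|d m| ^+ J * jump t.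
Proof.
move=> t01; elim: J => [|J IH]; first by rewrite expr0 mul1r.
by rewrite [iter J.+1 S t]/= jump_simmap ?iter_simmap_itv// IH sigmaE exprS mulrA.
Qed.

Lemma inner_knot_itv (k : 'I_n) : (0 < k)%N -> 0 < l k < 1.
Proof. by move=> k0; rewrite lknot_gt0 ?lknot_lt1. Qed.

Lemma atom_itv J (k : 'I_n) : (0 < k)%N -> 0 < atom J k < 1.
Proof. by move=> k0; apply: iter_simmap_itv; exact: inner_knot_itv. Qed.

Lemma knot_notin_gap (k k' : 'I_n) : ~~ (l k' < l k < r k').
Proof.
apply/negP => /andP[h1 h2]; have [kk|kk] := leqP k k'.
  have : l k <= l k' by exact: alpha_le.
  by lra.
by have := rknot_le_lknot kk; lra.
Qed.

Lemma lknot_inj : injective l.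
Proof.
move=> k k' E; apply/val_inj/eqP; case: ltngtP => // kk.
  by have : l k < l k' by [exact: alpha_lt]; rewrite E ltxx.
by have : l k' < l k by [exact: alpha_lt]; rewrite E ltxx.
Qed.

(** Cancelling the common iterates of [S] would equate a knot with a point of the open gap [m], into
    which [S] sends []0, 1[] and which contains no knot. *)
Lemma atom_inj J (k : 'I_n) J' (k' : 'I_n) : (0 < k)%N -> (0 < k')%N ->
  atom J k = atom J' k' -> J = J' /\ k = k'.
Proof.
have lt J1 J2 (k1 k2 : 'I_n) : (0 < k1)%N -> (0 < k2)%N -> (J1 < J2)%N -> atom J1 k1 <> atom J2 k2.
  move=> k10 k20 JJ; rewrite /atom -(subnKC JJ) addSnnS iterD => /(can_inj (iter_simmapK J1)) E.
  have := knot_notin_gap k1 m; rewrite E [iter _.+1 S _]/= simmap_gap//.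
  exact/iter_simmap_itv/inner_knot_itv.
move=> k0 k0' E; case: (ltngtP J J') => JJ.
- by case: (lt _ _ _ _ k0 k0' JJ).
- by case: (lt _ _ _ _ k0' k0 JJ).
- split=> //; move: E; rewrite JJ /atom => /(can_inj (iter_simmapK J')).
  exact: lknot_inj.
Qed.

Definition level J : set (measurableTypeR R) :=
  \big[setU/set0]_(k <- inner_knots) [set atom J k].

Definition atoms : set (measurableTypeR R) := \bigcup_J level J.

Lemma levelP J x : level J x <-> exists2 k : 'I_n, (0 < k)%N & x = atom J k.
Proof.
rewrite /level -bigcup_seq; split=> [[k /= ks ->]|[k k0 ->]].
  by exists k => //; rewrite -mem_inner_knots.
by exists k => //=; rewrite mem_inner_knots.
Qed.

Lemma measurable_set1R x : measurable ([set x] : set (measurableTypeR R)).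
Proof. exact: measurable_set1. Qed.

Lemma measurable_level J : measurable (level J).
Proof. by apply: bigsetU_measurable => k _; exact: measurable_set1R. Qed.

Lemma measurable_atoms : measurable atoms.
Proof. by apply: bigcupT_measurable => J; exact: measurable_level. Qed.

Lemma countable_atoms : countable atoms.
Proof.
apply: bigcup_countable => // J _; apply: finite_set_countable.
rewrite /level -bigcup_seq; apply: bigcup_finite => [|k _]; last exact: finite_set1.
exact: finite_seq.
Qed.

Lemma atoms_itv x : atoms x -> 0 < x < 1.
Proof. by move=> [J _ /levelP[k k0 ->]]; exact: atom_itv. Qed.

Lemma mu_residual : mu (\bigcap_J (iter J T @^-1` `]0, 1[%classic)) = 0%E.
Proof.
set A := \bigcap_J _.
have mA : measurable A.
  by apply: bigcapT_measurable => J; apply: measurable_preimage_iter; exact: measurable_itv.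
have bd J : (mu A <= (`|d m| ^+ J)%:E)%E.
  apply: (@le_trans _ _ (mu (iter J T @^-1` `]0%R, 1%R[%classic))).
    apply: le_measure; rewrite ?inE//; last by move=> x /(_ J I).
    by apply: measurable_preimage_iter; exact: measurable_itv.
  rewrite -[`|d m| ^+ J]mulr1; apply: mu_iter_open => // s t s0 st t1.
  by apply: increment_le1 => //; exact: ltW.
apply/eqP; rewrite eq_le measure_ge0 andbT.
have c0 : (`|d m| ^+ J)%:E @[J --> \oo] --> (0%:E : \bar R).
  apply: cvg_EFin; first exact: nearW.
  by apply: cvg_expr; rewrite normr_id.
apply: (@le_trans _ _ (lim ((`|d m| ^+ J)%:E @[J --> \oo]))).
  by apply: lime_ge; [exact: cvgP c0|exact: nearW].
by rewrite (cvg_lim _ c0).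
Qed.

(** Follow the orbit of a point of []0, 1[] under [T]. If it never leaves, the point belongs to the
    null set of [mu_residual]. Otherwise its last position in []0, 1[] before the first exit is
    outside the open gap [m]: it is a knot, and the point is an atom, or it lies in another gap,
    where [f] is constant. The endpoints 0 and 1 have no jump by the conventions for [f] there. *)
Lemma mu_setC_atoms : mu (~` atoms) = 0%E.
Proof.
have mI (a b : R) : measurable (`]a, b[%classic : set (measurableTypeR R)) by exact: measurable_itv.
pose gaps J (k : 'I_n) : set (measurableTypeR R) :=
  if k != m then iter J T @^-1` `]l k, r k[%classic else set0.
have neg_gaps J k : mu.-negligible (gaps J k).
  rewrite /gaps; case: ifPn => [km|_]; last exact: negligible_set0.
  apply/negligibleP; first by apply: measurable_preimage_iter; exact: mI.
  apply/eqP; rewrite eq_le measure_ge0 andbT.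
  have := @mu_iter_open J (l k) (r k) 0 (lknot_ge0 k) (lknot_lt_rknot k) (rknot_le1 k).
  rewrite mulr0; apply => s t ls st tr.
  rewrite (f_gap_cst km (_ : l k < s <= r k)) ?(f_gap_cst_right km (_ : l k <= t < r k)) ?subrr//.
    by apply/andP; split; lra.
  by apply/andP; split; lra.
have neg0 : mu.-negligible [set 0 : measurableTypeR R].
  apply/negligibleP; first exact: measurable_set1R.
  apply: etrans (@mu_jump 0 _) _; first by rewrite lexx ler01.
  rewrite /jump /right_value ltr01.
  by rewrite (cvg_lim _ f_0)// subrr.
have neg1 : mu.-negligible [set 1 : measurableTypeR R].
  apply/negligibleP; first exact: measurable_set1R.
  apply: etrans (@mu_jump 1 _) _; first by rewrite lexx ler01.
  by rewrite /jump right_value1 subrr.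
have negout : mu.-negligible (~` `[0, 1]%classic).
  apply/negligibleP; first by apply: measurableC; exact: measurable_itv.
  apply: etrans (probability_setC mu (measurable_itv `[0, 1])) _.
  transitivity (1 - 1 : \bar R)%E; last by rewrite subee.
  by congr (_ - _)%E; exact: mu01.
have negres : mu.-negligible (\bigcap_J (iter J T @^-1` `]0, 1[%classic)).
  apply/negligibleP; last exact: mu_residual.
  by apply: bigcapT_measurable => J; apply: measurable_preimage_iter; exact: mI.
have neggaps : mu.-negligible (\bigcup_J \bigcup_(k in [set: 'I_n]) gaps J k).
  apply: negligible_bigcup => J.
  have -> : \bigcup_(k in [set: 'I_n]) gaps J k = \big[setU/set0]_(k <- enum 'I_n) gaps J k.
    rewrite -bigcup_seq; apply/seteqP; split=> x [k _ gx]; exists k => //=.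
    by rewrite mem_enum.
  by apply: big_ind => [||k _]; [exact: negligible_set0|exact: negligibleU|exact: neg_gaps].
apply/negligibleP; first by apply: measurableC; exact: measurable_atoms.
apply: negligibleS (negligibleU (negligibleU negout (negligibleU neg0 neg1)) (negligibleU negres neggaps)).
move=> x nx.
have [x01|x01] := boolP (0 <= x <= 1); last by left; left; rewrite /= in_itv/=; exact/negP.
have [->|x0] := eqVneq x 0; first by left; right; left.
have [->|x1] := eqVneq x 1; first by left; right; right.
right; have {x01 x0 x1} x01 : 0 < x < 1.
  by case/andP: x01 => h1 h2; rewrite !lt_neqAle eq_sym x0 x1 h1.
have [H|] := pselect (forall J, 0 < iter J T x < 1).
  by left => J _ /=; rewrite in_itv/=.
move=> /existsNP[J0 /negP HJ0]; right.
have exJ : exists J, ~~ (0 < iter J T x < 1) by exists J0.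
case: (ex_minnP exJ) => -[|J]; first by rewrite x01.
move=> HJ minJ.
have yJ : 0 < iter J T x < 1.
  by apply: contrapT => /negP /minJ; rewrite ltnn.
exists J => //; have [[k yk]|[k k0 yk]] := knot_cases yJ; last first.
  by case: nx; exists J => //; apply/levelP; exists k => //; rewrite /atom -yk iter_simmap_invK.
exists k => //; rewrite /gaps; case: eqVneq => [km|km] /=; last by rewrite in_itv.
move: HJ; rewrite -simmap_gapE [iter J.+1 T x]/= TSK.
by move: yk; rewrite km => ->.
Qed.

Import HBNNSimple.

(** No measurability of [g] is assumed, since [g] will be the square of a path of the process. On
    the countable set of atoms every function is measurable. *)
Lemma integral_atoms (g : R -> R) : (forall t, 0 <= g t) ->
  (\int[mu]_(t in `[0%R, 1%R]) (g t)%:E =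
   \sum_(J <oo) (\sum_(k <- inner_knots) jump (atom J k) * g (atom J k))%:E)%E.
Proof.
move=> g0; have mA := measurable_atoms.
have mgA (B : set (measurableTypeR R)) : B `<=` atoms -> measurable_fun B (EFin \o g).
  move=> BA _ Y mY; apply: countable_measurable; first exact: measurable_set1R.
  by apply: sub_countable countable_atoms; apply: subset_card_le => x [/BA].
pose G : measurableTypeR R -> \bar R := (EFin \o g) \_ (`[0%R, 1%R]%classic).
pose G' : measurableTypeR R -> \bar R := (EFin \o g) \_ atoms.
have mG' : measurable_fun setT G' by apply/(measurable_restrictT _ _).1 => //; exact: mgA.
have G0 x : (0 <= G x)%E by rewrite /G patchE; case: ifP => // _; rewrite lee_fin.
have G'0 x : (0 <= G' x)%E by rewrite /G' patchE; case: ifP => // _; rewrite lee_fin.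
have GG' x : (G' x <= G x)%E.
  rewrite /G' patchE; case: ifPn => [/set_mem/atoms_itv/andP[h1 h2]|_]; last exact: G0.
  by rewrite /G patchE mem_set//= in_itv/= !ltW.
have GA x : atoms x -> G x = G' x.
  move=> Ax; rewrite /G /G' !patchE mem_set ?[x \in atoms]mem_set//=.
  by have /andP[h1 h2] := atoms_itv Ax; rewrite in_itv/= !ltW.
transitivity (\int[mu]_x G' x)%E.
  rewrite integral_mkcond; apply/eqP; rewrite eq_le; apply/andP; split.
    (* The integral of a nonnegative function is a supremum over simple functions below it; those
       are measurable, so the null complement of the atoms can be discarded from each of them. *)
    rewrite [leLHS]ge0_integralTE//; apply: ub_ereal_sup => _ [h /= hG <-].
    rewrite -integralT_nnsfun.
    have mh : measurable_fun [set: measurableTypeR R] h by exact: measurable_funPT.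
    rewrite (@ge0_negligible_integral _ _ _ mu setT (~` atoms))//; last 4 first.
    - exact: measurableC.
    - exact/measurable_EFinP.
    - by move=> x _; rewrite lee_fin.
    - exact: mu_setC_atoms.
    rewrite setTD setCK integral_mkcond; apply: ge0_le_integral => //.
    - by move=> x _; rewrite patchE; case: ifP => // _; rewrite lee_fin.
    - apply/(measurable_restrictT _ _).1 => //; apply/measurable_EFinP.
      exact: measurable_funTS.
    - move=> x _; rewrite patchE; case: ifPn => [/set_mem Ax|_]; last exact: G'0.
      by rewrite -GA//; exact: hG.
  rewrite -/G (ge0_integralTE mu G0) (ge0_integralTE mu G'0).
  apply: le_ereal_sup => _ [h /= hG <-]; exists h => //= x.
  exact: le_trans (hG x) (GG' x).
rewrite /G' -integral_mkcond /atoms ge0_integral_bigcup//; last 4 first.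
- exact: measurable_level.
- exact: mgA.
- by move=> x _; rewrite lee_fin.
- apply/trivIsetP => J J' _ _ JJ; apply/disjoints_subset => x /levelP[k k0 ->] /levelP[k' k0'].
  by case/(atom_inj k0 k0') => /eqP; rewrite (negbTE JJ).
apply: eq_eseriesr => J _.
rewrite /level ge0_integral_bigsetU//; last 4 first.
- exact: inner_knots_uniq.
- move=> k k' /= ks ks' [x [/= -> E]].
  by rewrite !mem_inner_knots in ks ks'; case: (atom_inj ks ks' E).
- by apply: mgA => x Lx; exists J.
- by move=> x _; rewrite lee_fin.
rewrite -sumEFin; apply: eq_big_seq => k; rewrite mem_inner_knots => k0.
transitivity (\int[mu]_(x in [set atom J k]) (g (atom J k))%:E)%E.
  by apply: eq_integral => x; rewrite inE => ->.
rewrite integral_cst; last exact: measurable_set1R.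
have /andP[h1 h2] := atom_itv J k0.
have mJ : mu [set atom J k] = (jump (atom J k))%:E by rewrite mu_jump ?(ltW h1) ?(ltW h2).
by rewrite [LHS](congr1 (fun z => (g (atom J k))%:E * z)%E mJ) -EFinM mulrC.
Qed.

(** * Images of the gaps under the iterates of the similarity *)

Definition at_level_le J y := exists J' (k' : 'I_n), [/\ (J' <= J)%N, (0 < k')%N & y = atom J' k'].

Lemma lknot_eq0 (k : 'I_n) : val k = 0%N -> l k = 0.
Proof. by move=> k0; rewrite -alpha0; congr alpha; exact: val_inj. Qed.

Lemma rknot_eq1 (k : 'I_n) : (n <= k.+1)%N -> r k = 1.
Proof.
move=> kn; rewrite -alpha1; congr alpha; apply: val_inj => /=.
by apply/eqP; rewrite eqn_leq kn andbT ltn_ord.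
Qed.

Lemma rknot_next (k : 'I_n) (kn : (k.+1 < n)%N) : r k = l (Ordinal kn).
Proof. by congr alpha; exact: val_inj. Qed.

Lemma simmap0 : S 0 = if e m then r m else l m.
Proof. by rewrite /simmap mulr0 subr0 add0r. Qed.

Lemma simmap1 : S 1 = if e m then l m else r m.
Proof. by rewrite /simmap mulr1 /gap subKr subrK. Qed.

(** A gap may end at 0 or 1, which are no inner knots. One application of [S] sends such an endpoint
    to an end of gap [m], possibly again 0 or 1; as [k != m], a second application reaches an inner
    knot. Hence the two spare levels. *)
Lemma lknot_at_level J k : k != m -> at_level_le J.+2 (iter J.+2 S (l k)).
Proof.
move=> km; have [k0|k0] := posnP k; last by exists J.+2, k.
have m0 : (0 < m)%N.
  by rewrite lt0n; apply: contraNneq km => m0; apply/eqP/val_inj; rewrite /= m0.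
rewrite (lknot_eq0 k0) iterSr simmap0.
case: ifPn => em; last by exists J.+1, m.
have [mn|mn] := ltnP m.+1 n; first by rewrite (rknot_next mn); exists J.+1, (Ordinal mn).
rewrite (rknot_eq1 mn) iterSr simmap1 em.
by exists J, m; split => //; exact: leq_trans (leqnSn _) (leqnSn _).
Qed.

Lemma rknot_at_level J k : k != m -> at_level_le J.+2 (iter J.+2 S (r k)).
Proof.
move=> km; have [kn|kn] := ltnP k.+1 n.
  by rewrite (rknot_next kn); exists J.+2, (Ordinal kn).
have mn : (m.+1 < n)%N.
  rewrite ltn_neqAle ltn_ord andbT; apply: contraNneq km => mn.
  apply/eqP/val_inj/eqP; rewrite -eqSS mn eqn_leq kn andbT ltn_ord //.
rewrite (rknot_eq1 kn) iterSr simmap1.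
case: ifPn => em; last by rewrite (rknot_next mn); exists J.+1, (Ordinal mn).
have [m0|m0] := posnP m; last by exists J.+1, m.
rewrite (lknot_eq0 m0) iterSr simmap0 em (rknot_next mn).
by exists J, (Ordinal mn); split => //; exact: leq_trans (leqnSn _) (leqnSn _).
Qed.

(** The constant is the product of the jumps at all inner knots; as each is positive and at most 1,
    the product is below every one of them. *)
Lemma jump_at_level : exists2 p, 0 < p & forall J y, at_level_le J y ->
  p * `|d m| ^+ J <= jump y.
Proof.
pose kn := fun i : 'I_n.+1 => (0 < i < n)%N.
have a01 (i : 'I_n.+1) : 0 <= alpha i <= 1.
  by rewrite -{1}alpha0 -alpha1 !alpha_le//= -ltnS.
exists (\prod_(i | kn i) jump (alpha i)).
  by apply: prodr_gt0 => i; exact: jump_knot_gt0.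
move=> J y [J' [k [JJ k0 ->]]]; rewrite jump_iter ?inner_knot_itv// mulrC.
have p0 : 0 <= \prod_(i | kn i) jump (alpha i).
  by apply: prodr_ge0 => i _; exact: jump_ge0.
apply: ler_pM => //.
  by rewrite ler_wiXn2l// ltW.
have ik : kn (widen_ord (leqnSn n) k) by rewrite /kn/= k0 ltn_ord.
rewrite (bigD1 _ ik)/= ler_piMr ?jump_ge0//.
apply: prodr_ile1 => i _; rewrite jump_ge0//=; exact: jump_le1.
Qed.

Lemma gap_lt1 : gap alpha m < 1.
Proof.
rewrite /gap; have l0 := lknot_ge0 m; have r1 := rknot_le1 m.
have [m0|m0] := posnP m; last by have := lknot_gt0 m0; lra.
have mn : (m.+1 < n)%N by rewrite m0.
by rewrite (rknot_next mn); have := lknot_lt1 (Ordinal mn); lra.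
Qed.

Lemma simmap_dist x y : `|S x - S y| = gap alpha m * `|x - y|.
Proof.
rewrite -[X in X * _](gtr0_norm am0) -normrM /simmap; case: (e m); last by congr (`|_|); ring.
by rewrite -normrN; congr (`|_|); ring.
Qed.

Lemma iter_simmap_dist J x y : `|iter J S x - iter J S y| = gap alpha m ^+ J * `|x - y|.
Proof.
elim: J => [|J IH]; first by rewrite expr0 mul1r.
by rewrite [iter J.+1 S x]/= [iter J.+1 S y]/= simmap_dist IH exprS mulrA.
Qed.

Lemma simmap_itv x : 0 <= x <= 1 -> l m <= S x <= r m.
Proof.
move=> /andP[x0 x1]; rewrite /simmap.
have rE : r m = gap alpha m + l m by rewrite /gap subrK.
have h1 : 0 <= gap alpha m * x by rewrite mulr_ge0// ltW.
have h2 : gap alpha m * x <= gap alpha m by rewrite ger_pMr.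
by case: (e m); rewrite rE; apply/andP; split; lra.
Qed.

Lemma iter_simmap_itv_closed J x : 0 <= x <= 1 -> 0 <= iter J S x <= 1.
Proof.
move=> x01; elim: J => // J /simmap_itv /= /andP[h1 h2].
by rewrite (le_trans (lknot_ge0 m) h1) (le_trans h2 (rknot_le1 m)).
Qed.

Lemma simmap_fixpoint : exists2 x, 0 <= x <= 1 & forall J, iter J S x = x.
Proof.
have a0 := am0; have a1 := gap_lt1; have l0 := lknot_ge0 m; have r1 := rknot_le1 m.
have rE : r m = gap alpha m + l m by rewrite /gap subrK.
suff [x x01 Sx] : exists2 x, 0 <= x <= 1 & S x = x.
  by exists x => //; elim=> // J IH; rewrite /= IH.
case em : (e m); rewrite /simmap em.
- have h : 0 < 1 + gap alpha m by lra.
  exists (r m / (1 + gap alpha m)).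
    rewrite divr_ge0 ?(ltW h)//=; last by lra.
    by rewrite ler_pdivrMr//; lra.
  by field; rewrite gt_eqF.
- have h : 0 < 1 - gap alpha m by lra.
  exists (l m / (1 - gap alpha m)).
    by rewrite divr_ge0 ?(ltW h)//= ler_pdivrMr//; lra.
  by field; rewrite gt_eqF.
Qed.

(** The minimum and maximum absorb the orientation of the iterate. *)
Definition lo J k := Num.min (iter J S (l k)) (iter J S (r k)).
Definition hi J k := Num.max (iter J S (l k)) (iter J S (r k)).

Lemma lknot_itv k : 0 <= l k <= 1.
Proof. by rewrite lknot_ge0 (le_trans (ltW (lknot_lt_rknot k)) (rknot_le1 k)). Qed.

Lemma rknot_itv k : 0 <= r k <= 1.
Proof. by rewrite rknot_le1 (le_trans (lknot_ge0 k) (ltW (lknot_lt_rknot k))). Qed.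

Lemma iter_simmap_mono J : {mono iter J S : x y / x <= y} \/ {mono iter J S : x y /~ x <= y}.
Proof.
elim: J => [|J IH]; first by left.
case em : (e m).
  have Sm : {mono S : x y /~ x <= y}.
    by move=> x y; rewrite /simmap em lerD2l lerN2 ler_pM2l.
  by case: IH => IH; [right|left] => x y; rewrite /= Sm IH.
have Sm : {mono S : x y / x <= y}.
  by move=> x y; rewrite /simmap em lerD2r ler_pM2l.
by case: IH => IH; [left|right] => x y; rewrite /= Sm IH.
Qed.

Lemma hi_lo_sep J (a b a' b' : R) : a <= b -> b <= a' -> a' <= b' ->
  Num.max (iter J S a) (iter J S b) <= Num.min (iter J S a') (iter J S b') \/
  Num.max (iter J S a') (iter J S b') <= Num.min (iter J S a) (iter J S b).
Proof.
move=> ab ba ab'; have [Sm|Sm] := iter_simmap_mono J; [left|right];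
  by rewrite le_min !ge_max !Sm; apply/andP; split; apply/andP; split; lra.
Qed.

(** At one level these are monotone images of distinct gaps. If [J < J'], the finer interval lies in
    the image of gap [m] under the [J]-th iterate, whereas the coarser one is the image of gap [k],
    different from [m]. *)
Lemma simmap_intervals_sep J k J' k' : k != m -> k' != m -> (J, k) != (J', k') ->
  hi J k <= lo J' k' \/ hi J' k' <= lo J k.
Proof.
wlog : J k J' k' / (J <= J')%N => [W|JJ km km' JkJk].
  move=> km km' ne; have [JJ|/ltnW JJ] := leqP J J'; first exact: W.
  by case: (W J' k' J k JJ km' km) => [|h|h]; [rewrite eq_sym|right|left].
have lr k1 := ltW (lknot_lt_rknot k1).
rewrite /hi /lo; move: JJ; rewrite leq_eqVlt => /predU1P[JJ|JJ].
  rewrite -JJ; have kk : k != k' by apply: contraNneq JkJk => ->; rewrite JJ.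
  have [h|h|h] := ltngtP k k'.
  - exact: hi_lo_sep (lr k) (rknot_le_lknot h) (lr k').
  - have := hi_lo_sep J (lr k') (rknot_le_lknot h) (lr k).
    by case; [right|left].
  - by move: kk; rewrite (val_inj h) eqxx.
have E x : iter J' S x = iter J S (S (iter (J' - J).-1 S x)).
  by rewrite -{1}(subnKC JJ) addSnnS iterD -subnS.
rewrite !E.
set u := S _; set v := S (iter _ _ (r k')).
have /andP[u1 u2] : l m <= u <= r m by exact/simmap_itv/iter_simmap_itv_closed/lknot_itv.
have /andP[v1 v2] : l m <= v <= r m by exact/simmap_itv/iter_simmap_itv_closed/rknot_itv.
have sep : r k <= l m \/ r m <= l k.
  have [h|h|h] := ltngtP k m; [left; exact: rknot_le_lknot|right; exact: rknot_le_lknot|].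
  by move: km; rewrite (val_inj h) eqxx.
have [uv|uv] := orP (le_total u v); case: sep => sep.
- exact: hi_lo_sep (lr k) (le_trans sep u1) uv.
- by have := hi_lo_sep J uv (le_trans v2 sep) (lr k); case; [right|left].
- by rewrite [Num.max (iter J S u) _]maxC [Num.min (iter J S u) _]minC; exact: hi_lo_sep (lr k) (le_trans sep v1) uv.
- rewrite [Num.max (iter J S u) _]maxC [Num.min (iter J S u) _]minC.
  by have := hi_lo_sep J uv (le_trans u2 sep) (lr k); case; [right|left].
Qed.

Lemma hi_sub_lo J k : hi J k - lo J k = gap alpha m ^+ J * gap alpha k.
Proof.
transitivity `|iter J S (r k) - iter J S (l k)|.
  rewrite /hi /lo; have [h|h] := orP (le_total (iter J S (l k)) (iter J S (r k))).
    by rewrite (max_r h) (min_l h) ger0_norm// subr_ge0.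
  by rewrite (max_l h) (min_r h) distrC ger0_norm// subr_ge0.
by rewrite iter_simmap_dist -/(gap alpha k) gtr0_norm// gap_gt0.
Qed.

Lemma lo_hi_itv J k : [/\ 0 <= lo J k, lo J k <= hi J k & hi J k <= 1].
Proof.
have /andP[l0 l1] := iter_simmap_itv_closed J (lknot_itv k).
have /andP[r0 r1] := iter_simmap_itv_closed J (rknot_itv k).
rewrite /lo /hi le_min l0 r0 ge_max l1 r1; split => //.
by rewrite le_max ge_min lexx.
Qed.

Lemma lo_at_level J k : k != m -> at_level_le J.+2 (lo J.+2 k).
Proof.
by move=> km; rewrite /lo; case: leP => _; [exact: lknot_at_level|exact: rknot_at_level].
Qed.

Lemma hi_at_level J k : k != m -> at_level_le J.+2 (hi J.+2 k).
Proof.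
by move=> km; rewrite /hi; case: leP => _; [exact: rknot_at_level|exact: lknot_at_level].
Qed.

Lemma self_similar_geometric_atoms :
  exists (x w lo hi : nat -> 'I_n -> R) (x0 p : R),
  geometric_atoms mu m `|d m| (gap alpha m) x w lo hi x0 p.
Proof.
have [x0 x01 Sx0] := simmap_fixpoint; have [p p0 pjump] := jump_at_level.
pose g := \prod_k gap alpha k.
have g0 : 0 < g by apply: prodr_gt0 => k _; exact: gap_gt0.
have gap1 k : 0 <= gap alpha k <= 1.
  by rewrite (ltW (gap_gt0 k)) /gap; have := lknot_ge0 k; have := rknot_le1 k; lra.
have gk k : g <= gap alpha k.
  rewrite /g (bigD1 k)//= ler_piMr//; first by case/andP: (gap1 k).
  by apply: prodr_ile1 => i _; exact: gap1.
have delta0 : 0 < `|d m| by rewrite normr_gt0.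
have a0 := am0; have a1 := gap_lt1.
(* The two spare levels cost only a square of each ratio; [g] is below every gap length. *)
pose p' := Num.min (p * `|d m| ^+ 2) (gap alpha m ^+ 2 * g).
have level J y : at_level_le J.+2 y -> exists J' (k' : 'I_n),
    [/\ (0 < k')%N, y = atom J' k' & p' * `|d m| ^+ J <= jump (atom J' k')].
  move=> ly; have := pjump _ _ ly; case: ly => J' [k' [_ k'0 ->]] h.
  exists J', k'; split => //; apply: le_trans h.
  rewrite -addn2 exprD [_ ^+ J * _]mulrC mulrA ler_pM2r ?exprn_gt0//.
  by rewrite ge_min lexx.
exists atom, (fun J k => jump (atom J k)), (fun J => lo J.+2), (fun J => hi J.+2), x0, p'.
split.
- by rewrite delta0.
- by rewrite a0.
- by rewrite lt_min !mulr_gt0// exprn_gt0.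
- by [].
- move=> h h0; rewrite integral_atoms//; apply: eq_eseriesr => J _.
  by rewrite /inner_knots big_filter big_enum_cond.
- by move=> J k k0; have /andP[h1 h2] := atom_itv J k0; rewrite !ltW.
- move=> J k k0; have /andP[h1 h2] := atom_itv J k0.
  rewrite jump_ge0 ?(ltW h1) ?(ltW h2)//= /atom jump_iter ?inner_knot_itv//.
  rewrite ler_piMr ?exprn_ge0// jump_le1// lknot_itv//.
- move=> J k k0; rewrite /atom -{1}(Sx0 J) iter_simmap_dist ler_piMr ?exprn_ge0 ?(ltW a0)//.
  by rewrite ler_norml; have /andP[? ?] := lknot_itv k; case/andP: x01 => ? ?; lra.
- by move=> J k; exact: lo_hi_itv.
- move=> J k; rewrite hi_sub_lo; have aJ : 0 < gap alpha m ^+ J by rewrite exprn_gt0.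
  have a2 : 0 < gap alpha m ^+ 2 by rewrite exprn_gt0.
  have a21 : gap alpha m ^+ 2 <= 1 by rewrite exprn_ile1// ltW.
  rewrite -addn2 exprD -mulrA; apply/andP; split.
    rewrite mulrC ler_pM2l//; apply: (@le_trans _ _ (gap alpha m ^+ 2 * g)).
      by rewrite ge_min lexx orbT.
    by rewrite ler_pM2l.
  rewrite ler_piMr ?(ltW aJ)//; have /andP[h1 h2] := gap1 k.
  by rewrite mulr_ile1// ltW.
- by move=> J k km; apply: level; exact: lo_at_level.
- by move=> J k km; apply: level; exact: hi_at_level.
- move=> J k J' k' km k'm ne; exact: simmap_intervals_sep.
Qed.

End self_similar_measure.

Lemma degenerate_geometric_atoms {R : realType} {n : nat}
    (alpha : 'I_n.+1 -> R) (e : 'I_n -> bool) (d beta : 'I_n -> R) (m : 'I_n)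
    (mu : probability (measurableTypeR R) R) :
  degenerate_self_similar alpha e d beta m mu ->
  (2 <= n)%N /\ exists x w lo hi x0 p,
    geometric_atoms mu m `|d m| (gap alpha m) x w lo hi x0 p.
Proof.
move=> [n2 [al0 al1 al] [dm0 dk0 dm1] mu1 [f [[fae _ fl f0] fj fmu]]]; split => //.
exact: (self_similar_geometric_atoms n2 al0 al1 al dm0 dk0 dm1 mu1 fae fl f0 fj fmu).
Qed.

(** * Small ball probabilities *)

(** By [2 |b_i b_j| <= b_i^2 + b_j^2], all error terms together are at most [C * sum h] times the
    diagonal form. Small total length thus leaves half of the diagonal. *)
Lemma nearly_orthogonal {R : realType} {disp} {Omega : measurableType disp}
    (P : probability Omega R) (H : set (Omega -> R)) (I : eqType) (s : seq I)
    (D : I -> Omega -> R) (h : I -> R) (kappa C : R) (b : I -> R) :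
  gaussian_space P H -> uniq s -> (forall i, H (D i)) -> 0 <= C ->
  (forall i, 0 <= h i) ->
  (forall i, `|inner P (D i) (D i) - kappa * h i| <= C * h i ^+ 2) ->
  (forall i j, i \in s -> j \in s -> i != j ->
    `|inner P (D i) (D j)| <= C * (h i * h j)) ->
  C * \sum_(i <- s) h i <= kappa / 2 ->
  kappa / 2 * \sum_(i <- s) b i ^+ 2 * h i <=
    inner P (\sum_(i <- s) b i *: D i) (\sum_(i <- s) b i *: D i).
Proof.
move=> gH us HD C0 h0 hvar hcov hC; rewrite (inner_sum _ _ gH)//.
set S := \sum_(i <- s) b i ^+ 2 * h i; set h1 := \sum_(i <- s) h i in hC.
have S0 : 0 <= S by apply: sumr_ge0 => i _; rewrite mulr_ge0// sqr_ge0.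
have E : \sum_(i <- s) \sum_(j <- s) ((i == j)%:R * (kappa * (b i ^+ 2 * h i)) -
    C / 2 * (b i ^+ 2 * h i * h j + h i * (b j ^+ 2 * h j))) =
    kappa * S - C * h1 * S.
  under eq_bigr do rewrite sumrB -mulr_suml -mulr_sumr big_split/= -mulr_sumr -mulr_sumr.
  rewrite sumrB -mulr_sumr big_split/= -!mulr_suml -/h1 -/S.
  have -> : \sum_(i <- s) (\sum_(i0 <- s) (i == i0)%:R) * (kappa * (b i ^+ 2 * h i)) = kappa * S.
    rewrite /S mulr_sumr; apply: eq_big_seq => i si.
    rewrite (bigD1_seq i)//= eqxx big1 ?addr0 ?mul1r// => j ji.
    by rewrite eq_sym (negPf ji).
  by field.
apply: (@le_trans _ _ (kappa * S - C * h1 * S)).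
  rewrite -mulrBl; apply: ler_wpM2r => //; lra.
rewrite -E big_seq [leRHS]big_seq; apply: ler_sum => i si.
rewrite big_seq [leRHS]big_seq; apply: ler_sum => j sj.
have [<-|ij] := eqVneq i j.
  rewrite mul1r.
  have := ler_wpM2l (sqr_ge0 (b i)) (hvar i).
  have := ler_normlW (hvar i); move: (hvar i); rewrite ler_distl => /andP[h2 _] _ _.
  have := ler_wpM2l (sqr_ge0 (b i)) h2.
  by rewrite -expr2; nra.
rewrite mul0r sub0r.
have := hcov i j si sj ij; rewrite ler_norml => /andP[g1 g2].
have hh : 0 <= C * (h i * h j) by rewrite !mulr_ge0.
have b1 : 0 <= (C * (h i * h j)) * (b i - b j) ^+ 2 by rewrite mulr_ge0// sqr_ge0.
have b2 : 0 <= (C * (h i * h j)) * (b i + b j) ^+ 2 by rewrite mulr_ge0// sqr_ge0.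
have [bb|/ltW bb] := leP 0 (b i * b j).
  have := ler_wpM2l bb g1; lra.
by have := ler_wnM2l bb g2; lra.
Qed.

Lemma exists_expr_le {R : realType} (a t : R) : 0 < a < 1 -> 0 < t ->
  exists k, a ^+ k <= t.
Proof.
move=> /andP[a0 a1] t0.
have /cvgrPdist_le/(_ t t0)[k _ hk] : (a ^+ i : R) @[i --> \oo] --> (0 : R).
  by apply: cvg_expr; rewrite gtr0_norm.
by exists k; have := hk k (leqnn k); rewrite sub0r normrN ger0_norm// exprn_ge0// ltW.
Qed.

Lemma geometric_sum_le {R : realType} (a : R) (J M : nat) : 0 < a < 1 ->
  \sum_(i <- iota J M) a ^+ i <= a ^+ J / (1 - a).
Proof.
move=> /andP[a0 a1]; rewrite ler_pdivlMr ?subr_gt0//.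
elim: M J => [|M IH] J; first by rewrite big_nil mul0r exprn_ge0// ltW.
rewrite big_cons mulrDl; have := IH J.+1; rewrite exprS.
have := exprn_gt0 J a0; move: (a ^+ J) => z; lra.
Qed.

Section probability_bounds.
Context {R : realType} {disp : measure_display} {Omega : measurableType disp}.
Variables (P : probability Omega R) (A : set Omega) (F : Omega -> R).
Hypotheses (mA : measurable A) (mF : measurable_fun setT F).
Hypothesis F01 : forall y, 0 <= F y <= 1.

Let mI : measurable_fun setT (\1_A : Omega -> R).
Proof. exact: measurable_indic. Qed.

Let I1 y : `|\1_A y : R| <= 1.
Proof. by rewrite /= indicE; case: (_ \in _); rewrite ?normr1 ?normr0. Qed.

Let F1 y : `|F y| <= 1.
Proof. by case/andP: (F01 y) => f0 f1; rewrite ger0_norm. Qed.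

Let intI : \int[P]_y \1_A y = fine (P A).
Proof. by rewrite /Rintegral (integral_indic _ measurableT mA) setIT. Qed.

Lemma Rintegral_ge_prob c : (forall y, A y -> c <= F y) ->
  c * fine (P A) <= \int[P]_y F y.
Proof.
move=> cF; have iI := integrable_bounded P mI I1.
rewrite -intI -(RintegralZl _ measurableT iI).
apply: (le_Rintegral measurableT) => [||y _].
- exact: (integrableZl measurableT c iI).
- exact: (integrable_bounded P mF F1).
- rewrite indicE; case: (boolP (y \in A)) => [/set_mem/cF|_]; first by rewrite mulr1.
  by rewrite mulr0; case/andP: (F01 y).
Qed.

Lemma Rintegral_le_prob c : 0 <= c -> (forall y, ~ A y -> F y <= c) ->
  \int[P]_y F y <= fine (P A) + c.
Proof.
move=> c0 cF; have iI := integrable_bounded P mI I1.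
have ic : P.-integrable setT (EFin \o (fun=> c)).
  by apply: (integrable_bounded P (M := c)) => [|y]; [exact: measurable_cst|rewrite ger0_norm].
rewrite -intI -[X in _ + X](Rintegral_probability_cst P c) -(RintegralD measurableT iI ic).
apply: (le_Rintegral measurableT) => [||y _].
- exact: (integrable_bounded P mF F1).
- exact: (integrableD measurableT iI ic).
- rewrite indicE; case: (boolP (y \in A)) => [_|yA].
    by apply: le_trans (_ : 1 <= _); [case/andP: (F01 y)|rewrite lerDl].
  by rewrite add0r cF// => Ay; move: yA; rewrite (mem_set Ay).
Qed.

End probability_bounds.

Lemma measurable_expR_sum_sqr {R : realType} {disp} {Omega : measurableType disp}
    (I : Type) (s : seq I) (Z : I -> Omega -> R) :
  (forall i, measurable_fun setT (Z i)) ->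
  measurable_fun setT (fun y => expR (- \sum_(i <- s) Z i y ^+ 2 / 2)) /\
  forall y, 0 <= expR (- \sum_(i <- s) Z i y ^+ 2 / 2) <= 1.
Proof.
move=> mZ; split => [|y].
  apply: measurableT_comp => //; apply: measurableT_comp => //.
  apply: measurable_sum => i; apply: measurable_funM; last exact: measurable_cst.
  exact: measurable_funX.
rewrite expR_ge0 -[leRHS]expR0 ler_expR oppr_le0 sumr_ge0// => i _.
by rewrite divr_ge0 ?sqr_ge0.
Qed.

Section small_balls.
Context {R : realType} {n : nat} {disp : measure_display} {Omega : measurableType disp}.
Variables (P : probability Omega R) (X : R -> Omega -> R).
Variables (H : set (Omega -> R)) (kappa C : R).
Hypotheses (gH : gaussian_space P H) (k0 : 0 < kappa) (C0 : 0 <= C).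
Hypothesis HB : forall s t, 0 <= s <= 1 -> 0 <= t <= 1 -> H (X t - X s).
Hypothesis varX : forall s t, 0 <= s -> s <= t -> t <= 1 ->
  `|inner P (X t - X s) (X t - X s) - kappa * (t - s)| <= C * (t - s) ^+ 2.
Hypothesis covX : forall s t s' t', 0 <= s -> s <= t -> t <= s' -> s' <= t' -> t' <= 1 ->
  `|inner P (X t - X s) (X t' - X s')| <= C * ((t - s) * (t' - s')).
Hypothesis limX : forall x, 0 <= x <= 1 -> exists U : nat -> Omega -> R,
  [/\ forall i, H (U i), forall i, inner P (U i) (U i) <= C
    & forall w, U i w @[i --> \oo] --> X x w].
Variables (mu : probability (measurableTypeR R) R) (m : 'I_n) (delta a : R).
Variables (x w lo hi : nat -> 'I_n -> R) (x0 p : R).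
Hypothesis ga : geometric_atoms mu m delta a x w lo hi x0 p.

Let measurableX t : 0 <= t <= 1 -> measurable_fun setT (X t).
Proof.
case/limX => U [HU _ cU]; have [_ _ mH _ _] := gH.
by apply: (@measurable_fun_cvg _ _ _ _ U) => [i|y _]; [exact: mH|exact: cU].
Qed.

Definition atom_energy (M : nat) (y : Omega) : R :=
  \sum_(J < M) \sum_(k < n | (0 < k)%N) w J k * X (x J k) y ^+ 2.

Lemma measurable_atom_energy M : measurable_fun setT (atom_energy M).
Proof.
apply: measurable_sum => J; under eq_fun do rewrite big_mkcond.
apply: measurable_sum => k; case: (boolP (0 < k)%N) => k1; last exact: measurable_cst.
apply: measurable_funM; first exact: measurable_cst.
by apply: measurable_funX; apply: measurableX; exact: (ga_x ga).
Qed.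

Let term_ge0 J y : 0 <= \sum_(k < n | (0 < k)%N) w J k * X (x J k) y ^+ 2.
Proof.
apply: sumr_ge0 => k k1; apply: mulr_ge0; last exact: sqr_ge0.
by case/andP: (ga_w ga J k1).
Qed.

Lemma le_atom_energy y : {homo atom_energy^~ y : i j / (i <= j)%N >-> i <= j}.
Proof.
move=> i j ij; rewrite /atom_energy -!(big_mkord xpredT (fun J =>
  \sum_(k < n | (0 < k)%N) w J k * X (x J k) y ^+ 2)).
by rewrite [leRHS](big_cat_nat (leq0n _) ij)/= lerDl sumr_ge0.
Qed.

(** Besides measurability of the event, this allows working with finitely many atoms and passing to
    the limit at the end. *)
Lemma small_ball_bigcap eps : 0 < eps ->
  [set y | (path_norm mu X y <= eps%:E)%E] =
  \bigcap_M [set y | atom_energy M y <= eps ^+ 2].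
Proof.
move=> e0; rewrite eqEsubset; split => y /=.
all: rewrite /path_norm (ga_integral ga (g := fun t => X t y ^+ 2))//;
  last by move=> t; exact: sqr_ge0.
all: rewrite poweR12_sqrt; last by apply: nneseries_ge0 => J _ _; rewrite lee_fin.
all: have -> : eps%:E = sqrte ((eps ^+ 2)%:E) by rewrite /= sqrtr_sqr gtr0_norm.
all: rewrite lee_sqrt ?lee_fin ?sqr_ge0// => h.
  move=> M _ /=; rewrite -lee_fin; apply: le_trans h.
  rewrite /atom_energy -(big_mkord xpredT (fun J =>
    \sum_(k < n | (0 < k)%N) w J k * X (x J k) y ^+ 2)) -sumEFin.
  by apply: nneseries_lim_ge => J _ _; rewrite lee_fin.
apply: lime_le; first by apply: is_cvg_nneseries => J _ _; rewrite lee_fin.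
near=> M; rewrite sumEFin lee_fin big_mkord; exact: (h M I).
Unshelve. all: by end_near. Qed.

Lemma measurable_small_ball_level M c : measurable [set y | atom_energy M y <= c].
Proof.
have := measurable_fun_le measurableT (measurable_atom_energy M) (@measurable_cst _ _ _ R setT c).
by rewrite setTI.
Qed.

Lemma measurable_small_ball eps : 0 < eps ->
  measurable [set y | (path_norm mu X y <= eps%:E)%E].
Proof.
move=> e0; rewrite small_ball_bigcap//; apply: bigcap_measurable; first by exists 0%N.
by move=> M _; exact: measurable_small_ball_level.
Qed.

Let x0_01 := ga_x0 ga.

Let pq_gt0 : 0 < delta /\ 0 < a.
Proof. by case/andP: (ga_delta ga) => ? _; case/andP: (ga_a ga). Qed.

Let endpoint_le eps y J (b : R) : 0 < eps ->
  (forall M, atom_energy M y <= eps ^+ 2) ->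
  (exists J' (k' : 'I_n), [/\ (0 < k')%N, b = x J' k' & p * delta ^+ J <= w J' k']) ->
  p * delta ^+ J * X b y ^+ 2 <= eps ^+ 2.
Proof.
move=> e0 hy [J' [k' [k1 -> wk]]]; apply: le_trans (hy J'.+1).
apply: (@le_trans _ _ (w J' k' * X (x J' k') y ^+ 2)).
  by apply: ler_wpM2r => //; exact: sqr_ge0.
rewrite /atom_energy big_ord_recr/= ler_wpDl//.
  by apply: sumr_ge0 => J1 _; exact: term_ge0.
rewrite (bigD1 k')//= lerDl; apply: sumr_ge0 => k /andP[k2 _].
by rewrite mulr_ge0 ?sqr_ge0//; case/andP: (ga_w ga J' k2).
Qed.

(* Chernoff's bound: on the event, every increment of [X] over an interval
   [lo J k, hi J k] is at most [2 * eps / sqrt (p * delta ^+ J)]. *)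
Lemma small_ball_le : exists c J0, 0 < c /\ forall eps M, 0 < eps ->
  small_ball_prob P mu X eps <=
  (\prod_(J <- iota J0 M) (expR 2^-1 *
    (Num.sqrt (1 + c * (delta * a) ^+ J / eps ^+ 2))^-1)) ^+ n.-1.
Proof.
have [d0 a0] := pq_gt0; have p0 := ga_p ga.
have a1 : a < 1 by case/andP: (ga_a ga).
(* Intervals of scales from [J0] on have total length at most [n * a ^+ J0 / (1 - a)]; the added 1
   keeps [g] positive when [C = 0]. *)
pose g := C * n%:R / (1 - a) + 1.
have Cn0 : 0 <= C * n%:R / (1 - a).
  by rewrite divr_ge0 ?mulr_ge0 ?ler0n ?subr_ge0 ?(ltW a1).
have g0 : 0 < g by rewrite /g ltr_wpDl.
have [J0 hJ0] : exists J0, a ^+ J0 <= kappa / 2 / g.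
  by apply: exists_expr_le (ga_a ga) _; rewrite !divr_gt0.
exists (p ^+ 2 * kappa / 8), J0; split; first by rewrite divr_gt0 ?mulr_gt0 ?exprn_gt0.
move=> eps M e0.
pose s := [seq (J, k) | J <- iota J0 M, k <- enum (predC1 m)].
have sP J k : (J, k) \in s -> k != m.
  by move=> /allpairsP[[J' k'] /= [_ + [_ ->]]]; rewrite mem_enum inE.
have us : uniq s.
  apply: allpairs_uniq; [exact: iota_uniq|exact: enum_uniq|].
  by move=> [? ?] [? ?] _ _ [-> ->].
(* Normalized so that [Z i ^+ 2 <= 1] on the event; each factor [expR 2^-1] of the bound pays for
   this. Half the variance of the increment, times [sg ^+ 2], produces the constant
   [p ^+ 2 * kappa / 8]. *)
pose sg (i : nat * 'I_n) : R := Num.sqrt (p * delta ^+ i.1 / (4 * eps ^+ 2)).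
pose D (i : nat * 'I_n) : Omega -> R := X (hi i.1 i.2) - X (lo i.1 i.2).
pose Z (i : nat * 'I_n) : Omega -> R := sg i *: D i.
pose h (i : nat * 'I_n) : R := hi i.1 i.2 - lo i.1 i.2.
pose v (i : nat * 'I_n) : R := p ^+ 2 * kappa / 8 * (delta * a) ^+ i.1 / eps ^+ 2.
have sg2 i : sg i ^+ 2 = p * delta ^+ i.1 / (4 * eps ^+ 2).
  rewrite sqr_sqrtr//; apply: divr_ge0; last by rewrite mulr_ge0// sqr_ge0.
  by rewrite mulr_ge0 ?(ltW p0)// exprn_ge0// ltW.
have itv J k : [/\ 0 <= lo J k, lo J k <= hi J k & hi J k <= 1] := ga_itv ga J k.
have lo01 J k : 0 <= lo J k <= 1 by case: (itv J k) => l1 l2 l3; rewrite l1 (le_trans l2 l3).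
have hi01 J k : 0 <= hi J k <= 1 by case: (itv J k) => l1 l2 l3; rewrite l3 (le_trans l1 l2).
have HD i : H (D i) by apply: HB.
have h0 i : 0 <= h i by rewrite /h subr_ge0; case: (itv i.1 i.2).
have sumh : C * \sum_(i <- s) h i <= kappa / 2.
  have sh : \sum_(i <- s) h i <= n%:R * (a ^+ J0 / (1 - a)).
    rewrite /s big_allpairs/=.
    apply: (@le_trans _ _ (\sum_(J <- iota J0 M) n%:R * a ^+ J)); last first.
      by rewrite -mulr_sumr; apply: ler_wpM2l; [rewrite ler0n|exact: geometric_sum_le (ga_a ga)].
    apply: ler_sum => J _; rewrite big_enum/= (eq_bigl (fun k => k != m))//.
    apply: (@le_trans _ _ (\sum_(k < n) a ^+ J)); last by rewrite sumr_const card_ord mulr_natl.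
    rewrite [leRHS](bigID (fun k => k != m))/= ler_wpDr ?sumr_ge0// => [k _|].
      by rewrite exprn_ge0// ltW.
    apply: ler_sum => k _; by case/andP: (ga_length ga J k).
  apply: (le_trans (ler_wpM2l C0 sh)).
  have -> : C * (n%:R * (a ^+ J0 / (1 - a))) = C * n%:R / (1 - a) * a ^+ J0 by ring.
  apply: (le_trans (ler_wpM2l Cn0 hJ0)).
  rewrite mulrCA -[leRHS]mulr1; apply: ler_wpM2l; first by rewrite divr_ge0// ltW.
  by rewrite ler_pdivrMr// mul1r /g lerDl.
have HZ i : H (Z i).
  have [H0 HDl _ _ _] := gH; rewrite -[Z i]add0r; exact: HDl.
have vle i : v i <= sg i ^+ 2 * (kappa / 2 * h i).
  rewrite sg2 /v exprMn; have := ga_length ga i.1 i.2; rewrite -/(h i) => /andP[hl _].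
  have -> : p ^+ 2 * kappa / 8 * (delta ^+ i.1 * a ^+ i.1) / eps ^+ 2 =
    p * delta ^+ i.1 / (4 * eps ^+ 2) * (kappa / 2 * (p * a ^+ i.1)).
    by field; rewrite gt_eqF.
  apply: ler_wpM2l; first by rewrite -sg2 sqr_ge0.
  by apply: ler_wpM2l => //; rewrite divr_ge0// ltW.
have v0 i : 0 <= v i.
  rewrite /v; apply: divr_ge0; last exact: sqr_ge0.
  by rewrite ltW// mulr_gt0 ?exprn_gt0 ?mulr_gt0// divr_gt0// mulr_gt0 ?exprn_gt0.
have vZ c : \sum_(i <- s) c i ^+ 2 * v i <=
    inner P (\sum_(i <- s) c i *: Z i) (\sum_(i <- s) c i *: Z i).
  have -> : \sum_(i <- s) c i *: Z i = \sum_(i <- s) (c i * sg i) *: D i.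
    by apply: eq_bigr => i _; rewrite /Z scalerA.
  have := @nearly_orthogonal _ _ _ P H _ s D h kappa C (fun i => c i * sg i) gH us HD C0 h0.
  move=> /(_ _ _ sumh) no; apply: le_trans (no _ _).
  - rewrite mulr_sumr; apply: ler_sum => i _.
    rewrite exprMn; have := ler_wpM2l (sqr_ge0 (c i)) (vle i).
    by move: (c i ^+ 2) (sg i ^+ 2) => u1 u2; lra.
  - by move=> i; rewrite /D /h; case: (itv i.1 i.2) => l1 l2 l3; exact: varX.
  - move=> [J k] [J' k'] /sP km /sP km' ne; rewrite /D /h/=.
    have [l1 l2 l3] := itv J k; have [l1' l2' l3'] := itv J' k'.
    have [sp|sp] := ga_sep ga km km' ne; first exact: covX.
    rewrite innerC [X in C * X]mulrC; exact: covX.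
have main := gaussian_laplace_le gH us HZ v0 vZ.
set A := [set y | (path_norm mu X y <= eps%:E)%E].
have mA : measurable A := measurable_small_ball e0.
have mZ i : measurable_fun setT (Z i) by case: gH => _ _ mH _ _; exact: mH.
have [mF F01] := measurable_expR_sum_sqr s mZ.
have Zexp y : A y -> \prod_(i <- s) expR (- 2^-1) <= expR (- \sum_(i <- s) Z i y ^+ 2 / 2).
  rewrite /A small_ball_bigcap// => Ay; have {}Ay K : atom_energy K y <= eps ^+ 2 := Ay K I.
  rewrite -expR_sum ler_expR -sumrN big_seq [leRHS]big_seq; apply: ler_sum => -[J k] /sP km.
  rewrite lerN2 ler_pdivrMr// mulVf//.
  have hl := endpoint_le e0 Ay (ga_lo ga J km); have hh := endpoint_le e0 Ay (ga_hi ga J km).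
  have -> : Z (J, k) y = sg (J, k) * (X (hi J k) y - X (lo J k) y) by [].
  rewrite exprMn sg2/= mulrAC ler_pdivrMr ?mulr_gt0 ?exprn_gt0// mul1r.
  have z0 : 0 <= p * delta ^+ J * (X (hi J k) y + X (lo J k) y) ^+ 2.
    by rewrite mulr_ge0 ?sqr_ge0// mulr_ge0 ?exprn_ge0// ltW.
  move: (p * delta ^+ J) (X (hi J k) y) (X (lo J k) y) hl hh z0 => z1 z2 z3; lra.
have := le_trans (Rintegral_ge_prob P mA mF F01 Zexp) main.
have B0 : 0 < \prod_(i <- s) expR (- 2^-1 : R) by apply: prodr_gt0 => i _; exact: expR_gt0.
rewrite -ler_pdivlMl// => h1; apply: (le_trans h1).
rewrite -prodfV -big_split/= /s big_allpairs -prodrXl; apply: ler_prod => J _.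
apply/andP; split.
  by apply: prodr_ge0 => k _; rewrite mulr_ge0 ?invr_ge0 ?expR_ge0 ?sqrtr_ge0.
by rewrite /v/= big_enum prodr_const cardC1 card_ord expRN invrK.
Qed.

Let varX_le t : 0 <= t <= 1 -> inner P (X t - X x0) (X t - X x0) <= (kappa + C) * `|t - x0|.
Proof.
move=> t01; case/andP: (t01) => t0 t1; case/andP: x0_01 => x00 x01.
have key s u : 0 <= s -> s <= u -> u <= 1 ->
    inner P (X u - X s) (X u - X s) <= (kappa + C) * (u - s).
  move=> s0 su u1; have := varX s0 su u1; rewrite ler_distl => /andP[_ h].
  apply: (le_trans h); rewrite mulrDl lerD2l; apply: ler_wpM2l => //.
  by rewrite expr2 ler_piMr ?subr_ge0// lerBlDr ler_wpDr.
have [tx|/ltW tx] := leP t x0.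
  rewrite distrC ger0_norm ?subr_ge0//; apply: le_trans (key _ _ t0 tx x01).
  have E (u v : Omega -> R) : u - v = 0 + (-1) *: (v - u) by rewrite add0r scaleN1r opprB.
  have H0 : H 0 by case: gH.
  have Hd : H (X x0 - X t) by apply: HB.
  rewrite E (inner_lin2 _ _ gH)//.
  have i0 v : inner P 0 v = 0.
    by rewrite /inner; under eq_Rintegral do rewrite mul0r; exact: (Rintegral_probability_cst P).
  by rewrite !(innerC P _ 0) !i0; lra.
by rewrite ger0_norm ?subr_ge0//; exact: key.
Qed.

(* The Laplace transform of the energy bounds the probability from below; the
   energy is compared with that of independent variables of the same variances
   (Hadamard's inequality), after splitting off the value of [X] at the
   accumulation point [x0] of the atoms. *)
Lemma small_ball_ge : exists c, 0 < c /\ forall eps lam b, 0 < eps -> 0 <= lam ->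
  (forall M, b <= (Num.sqrt (1 + c * lam))^-1 *
    (\prod_(J <- iota 0 M) (Num.sqrt (1 + c * lam * (delta * a) ^+ J))^-1) ^+ n.-1) ->
  b - expR (- (lam * eps ^+ 2)) <= small_ball_prob P mu X eps.
Proof.
have [d0 a0] := pq_gt0; have d1 : delta < 1 by case/andP: (ga_delta ga).
have n0 : (0 < n)%N by apply: leq_ltn_trans (ltn_ord m).
have nd : 1 <= n%:R / (1 - delta).
  rewrite ler_pdivlMr ?subr_gt0// mul1r (@le_trans _ _ 1) ?ler1n//; lra.
(* The last factor bounds the total weight [W] of the atoms and is at least 1, so the same constant
   serves for the value at [x0] and for the differences. *)
pose c := 4 * (kappa + C) * (n%:R / (1 - delta)).
have kC : 0 < kappa + C by rewrite ltr_pwDl.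
have c0 : 0 < c by rewrite /c; apply: mulr_gt0; [exact: mulr_gt0|exact: lt_le_trans nd].
exists c; split => // eps lam b e0 l0 hb.
have [U [HU UC cU]] := limX x0_01.
pose A M := [set y | atom_energy M y <= eps ^+ 2].
have mA M : measurable (A M) by exact: measurable_small_ball_level.
suff key M : b <= fine (P (A M)) + expR (- (lam * eps ^+ 2)).
  have cvgA : (P \o A) M @[M --> \oo] --> P (\bigcap_M A M).
    apply: nonincreasing_cvg_mu => //.
    - by rewrite (le_lt_trans (probability_le1 P (mA 0%N)))// ltry.
    - by apply: bigcap_measurable => //; exists 0%N.
    - move=> i j ij; apply/subsetPset => y /=; apply: le_trans.
      exact: le_atom_energy.
  have mI : measurable (\bigcap_M A M) by apply: bigcap_measurable => //; exists 0%N.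
  have bA : ((b - expR (- (lam * eps ^+ 2)))%:E <= P (\bigcap_M A M))%E.
    rewrite -(cvg_lim _ cvgA)//; apply: lime_ge; first by apply/cvg_ex; eexists; exact: cvgA.
    near=> M; rewrite /= -(fineK (fin_num_measure P _ (mA M))) lee_fin lerBlDr; exact: key.
  by rewrite /small_ball_prob small_ball_bigcap// -lee_fin fineK// fin_num_measure.
pose s := [seq (J, k) | J <- iota 0 M, k <- enum [pred k : 'I_n | (0 < k)%N]].
have sP J k : (J, k) \in s -> (0 < k)%N.
  by move=> /allpairsP[[J' k'] /= [_ + [_ ->]]]; rewrite mem_enum inE.
have energyE y : atom_energy M y = \sum_(i <- s) w i.1 i.2 * X (x i.1 i.2) y ^+ 2.
  rewrite /s big_allpairs /atom_energy -(big_mkord xpredT (fun J =>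
    \sum_(k < n | (0 < k)%N) w J k * X (x J k) y ^+ 2)) /index_iota subn0.
  by apply: eq_bigr => J _; rewrite big_enum.
(* The default [x0] keeps every index in [[0, 1]], so that all [D i] lie in [H]; indices with
   [i.2 = 0] do not occur in [s]. *)
pose xx (i : nat * 'I_n) := if (0 < i.2)%N then x i.1 i.2 else x0.
have xx01 i : 0 <= xx i <= 1.
  by rewrite /xx; case: ifP => k1; [exact: (ga_x ga)|exact: x0_01].
pose D i : Omega -> R := X (xx i) - X x0.
have HD i : H (D i) by apply: HB.
pose W := \sum_(i <- s) w i.1 i.2.
have w0 i : i \in s -> 0 <= w i.1 i.2.
  by case: i => J k /sP k1; case/andP: (ga_w ga J k1).
have W0 : 0 <= W by rewrite /W big_seq; apply: sumr_ge0 => i /w0.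
have W1 : W <= n%:R / (1 - delta).
  rewrite /W /s big_allpairs/=.
  apply: (@le_trans _ _ (\sum_(J <- iota 0 M) n%:R * delta ^+ J)); last first.
    rewrite -mulr_sumr; apply: ler_wpM2l; first by rewrite ler0n.
    by apply: (le_trans (geometric_sum_le _ _ (ga_delta ga))); rewrite expr0 div1r.
  apply: ler_sum => J _; rewrite big_enum/= (eq_bigl (fun k : 'I_n => (0 < k)%N))//.
  apply: (@le_trans _ _ (\sum_(k < n) delta ^+ J)); last by rewrite sumr_const card_ord mulr_natl.
  rewrite [leRHS](bigID (fun k : 'I_n => (0 < k)%N))/= ler_wpDr ?sumr_ge0// => [k _|].
    by rewrite exprn_ge0// ltW.
  apply: ler_sum => k k1; by case/andP: (ga_w ga J k1).
(* From [X(x)^2 <= 2 (X(x) - X(x0))^2 + 2 X(x0)^2], with [None] collecting the common value at [x0].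
   Since [X x0] may lie outside [H], it is replaced by its approximation [U N] until the Laplace
   bound has been proved. *)
pose Z N (o : option (nat * 'I_n)) : Omega -> R :=
  if o is Some i then Num.sqrt (4 * lam * w i.1 i.2) *: D i
  else Num.sqrt (4 * lam * W) *: U N.
have HZ N o : H (Z N o).
  have [H0 HDl _ _ _] := gH.
  by rewrite -[Z N o]add0r; case: o => [i|] /=; apply: HDl.
pose so := None :: [seq Some i | i <- s].
pose E y := 2 * lam * W * X x0 y ^+ 2 + \sum_(i <- s) 2 * lam * w i.1 i.2 * D i y ^+ 2.
pose EN N y := 2 * lam * W * U N y ^+ 2 + \sum_(i <- s) 2 * lam * w i.1 i.2 * D i y ^+ 2.
have ENE N y : \sum_(o <- so) Z N o y ^+ 2 / 2 = EN N y.
  rewrite /so big_cons big_map /EN; congr (_ + _).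
    rewrite -[Z N None y]/(Num.sqrt (4 * lam * W) * U N y) exprMn sqr_sqrtr; first by field.
    by rewrite !mulr_ge0.
  apply: eq_big_seq => i si.
  rewrite -[Z N (Some i) y]/(Num.sqrt (4 * lam * w i.1 i.2) * D i y) exprMn sqr_sqrtr; first by field.
  by rewrite !mulr_ge0// w0.
have energy_le y : lam * atom_energy M y <= E y.
  rewrite energyE /E /W mulr_sumr mulr_sumr mulr_suml -big_split/=.
  rewrite big_seq [leRHS]big_seq; apply: ler_sum => i si; rewrite -[D i y]/(X (xx i) y - X x0 y).
  have -> : xx i = x i.1 i.2 by rewrite /xx; case: i si => J k /sP /= ->.
  have lw : 0 <= lam * w i.1 i.2 by rewrite mulr_ge0 ?w0.
  have := mulr_ge0 lw (sqr_ge0 (X (x i.1 i.2) y - 2 * X x0 y)).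
  move: (X (x i.1 i.2) y) (X x0 y) (w i.1 i.2) => z1 z2 z3; lra.
have energy_ge0 y : 0 <= atom_energy M y by apply: sumr_ge0 => J _; exact: term_ge0.
have sqrt_inv_le (u v : R) : 0 <= u -> u <= v -> (Num.sqrt (1 + v))^-1 <= (Num.sqrt (1 + u))^-1.
  move=> u0 uv; have v0 := le_trans u0 uv.
  by rewrite lef_pV2 ?posrE ?sqrtr_gt0 ?ltr_pwDl// ler_wsqrtr// lerD2l.
have innerZ r u : H u -> inner P (r *: u) (r *: u) = r ^+ 2 * inner P u u.
  have [H0 _ _ _ _] := gH; move=> Hu; rewrite -[r *: u]add0r (inner_lin2 _ _ gH)//.
  have i0 v : inner P 0 v = 0.
    by rewrite /inner; under eq_Rintegral do rewrite mul0r; exact: (Rintegral_probability_cst P).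
  by rewrite (innerC P u 0) !i0; ring.
have lap N : b <= \int[P]_y expR (- EN N y).
  under eq_Rintegral do rewrite -ENE.
  apply: le_trans (gaussian_laplace_ge gH so (HZ N)); apply: (le_trans (hb M)).
  rewrite /so big_cons big_map; apply: ler_pM.
  - by rewrite invr_ge0 sqrtr_ge0.
  - by apply: exprn_ge0; apply: prodr_ge0 => J _; rewrite invr_ge0 sqrtr_ge0.
  - apply: sqrt_inv_le; first exact: inner_ge0.
    rewrite innerZ// sqr_sqrtr; last by rewrite !mulr_ge0.
    have h := ler_pM W0 (inner_ge0 P (U N)) W1 (UC N).
    have h2 : (n%:R / (1 - delta)) * C <= (n%:R / (1 - delta)) * (kappa + C).
      by rewrite ler_wpM2l ?lerDr ?(ltW k0)// (le_trans _ nd).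
    have := ler_wpM2l l0 (le_trans h h2); rewrite /c.
    by move: (n%:R / (1 - delta)) (inner P (U N) (U N)) => z1 z2; lra.
  - apply: (@le_trans _ _ (\prod_(i <- s) (Num.sqrt (1 + c * lam * (delta * a) ^+ i.1))^-1)).
      rewrite /s big_allpairs/= -prodrXl le_eqVlt; apply/orP; left; apply/eqP.
      apply: eq_bigr => J _; rewrite big_enum prodr_const; congr (_ ^+ _).
      rewrite -[in LHS](card_ord n) -(cardC1 (Ordinal n0)); apply: eq_card => k.
      by rewrite !inE -val_eqE lt0n.
    rewrite big_seq [leRHS]big_seq; apply: ler_prod => i si.
    rewrite invr_ge0 sqrtr_ge0/=; apply: sqrt_inv_le; first exact: inner_ge0.
    rewrite innerZ// sqr_sqrtr; last by rewrite !mulr_ge0// w0.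
    have h1 := varX_le (xx01 i).
    have [hd hw] : `|xx i - x0| <= a ^+ i.1 /\ w i.1 i.2 <= delta ^+ i.1.
      case: i si {h1} => J k /sP k1; rewrite /xx/= k1; split; first exact: (ga_dist ga).
      by case/andP: (ga_w ga J k1).
    have h2 := le_trans h1 (ler_wpM2l (ltW kC) hd).
    have h3 := ler_pM (w0 i si) (inner_ge0 P (D i)) hw h2.
    have aJ : 0 <= delta ^+ i.1 * ((kappa + C) * a ^+ i.1).
      by rewrite !mulr_ge0 ?exprn_ge0// ltW.
    have h4 := ler_wpM2r aJ nd; rewrite mul1r in h4.
    have := ler_wpM2l l0 (le_trans h3 h4); rewrite /c exprMn.
    move: (n%:R / (1 - delta)) (w i.1 i.2) (inner P (D i) (D i)) (delta ^+ i.1) (a ^+ i.1).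
    by move=> z1 z2 z3 z4 z5; lra.
have mZ N o : measurable_fun setT (Z N o) by case: gH => _ _ + _ _; apply; exact: HZ.
have mF N : measurable_fun setT (fun y => expR (- EN N y)).
  by under eq_fun do rewrite -ENE; case: (measurable_expR_sum_sqr so (mZ N)).
have F01 N y : 0 <= expR (- EN N y) <= 1.
  by rewrite -ENE; case: (measurable_expR_sum_sqr so (mZ N)).
have cF y : expR (- EN N y) @[N --> \oo] --> expR (- E y).
  apply: continuous_cvg; first exact: continuous_expR.
  apply: cvgN; apply: cvgD; last exact: cvg_cst.
  apply: cvgMr; rewrite expr2; under eq_fun do rewrite expr2; apply: cvgM; exact: cU.
have mE : measurable_fun setT (fun y => expR (- E y)).
  by apply: (@measurable_fun_cvg _ _ _ _ (fun N y => expR (- EN N y))) => // y _; exact: cF.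
have E01 y : 0 <= expR (- E y) <= 1.
  have : 0 <= E y by apply: le_trans (energy_le y); rewrite mulr_ge0// energy_ge0.
  by move=> Ey0; rewrite expR_ge0 -[leRHS]expR0 ler_expR oppr_le0.
have i1 : P.-integrable setT (EFin \o (fun=> 1 : R)).
  by apply: (integrable_bounded P (M := 1)) => [|y]; [exact: measurable_cst|rewrite normr1].
have cI : \int[P]_y expR (- EN N y) @[N --> \oo] --> \int[P]_y expR (- E y).
  apply: (Rintegral_dominated_cvg mF mE cF i1) => N y.
  by case/andP: (F01 N y) => f0 f1; rewrite ger0_norm.
apply: (@le_trans _ _ (\int[P]_y expR (- E y))).
  rewrite -(cvg_lim _ cI)//; apply: limr_ge; first exact: cvgP cI.
  by near=> N; exact: lap.
apply: (Rintegral_le_prob P (mA M) mE E01); first exact: expR_ge0.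
move=> y /negP; rewrite -ltNge => Ay.
rewrite ler_expR lerN2; apply: le_trans (energy_le y); apply: ler_wpM2l => //; exact: ltW.
Unshelve. all: by end_near. Qed.
End small_balls.

(** * Logarithmic asymptotics *)

Section small_ball_asymptotics.
Context {R : realType}.
Variables (q : R) (r : nat).
Hypotheses (q01 : 0 < q < 1) (r0 : (0 < r)%N).

Let Q := ln (1 / q).

Let Q0 : 0 < Q.
Proof. by case/andP: q01 => q0 q1; rewrite /Q div1r ln_gt0// invf_gt1. Qed.

Let qE J : q ^+ J = expR (- (J%:R * Q)).
Proof.
case/andP: q01 => q0 q1; rewrite /Q div1r lnV ?posrE// mulrN opprK.
by rewrite -[in LHS](lnK (x := q)) ?posrE// expRM_natl.
Qed.

Definition laplace_factor (z : R) : R := (Num.sqrt (1 + expR z))^-1.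

Lemma laplace_factor_ge0 z : 0 <= laplace_factor z.
Proof. by rewrite invr_ge0 sqrtr_ge0. Qed.

Lemma laplace_factorE c J : 0 < c ->
  (Num.sqrt (1 + c * q ^+ J))^-1 = laplace_factor (ln c - J%:R * Q).
Proof. by move=> c0; rewrite /laplace_factor expRD lnK ?posrE// qE. Qed.

Lemma laplace_factor_le z : laplace_factor z <= expR (- (z / 2)).
Proof.
rewrite /laplace_factor expRN lef_pV2 ?posrE ?sqrtr_gt0 ?expR_gt0 ?addr_gt0 ?expR_gt0//.
rewrite -[leLHS]ger0_norm ?expR_ge0// -sqrtr_sqr ler_wsqrtr//.
have -> : expR (z / 2) ^+ 2 = expR z by rewrite expr2 -expRD; congr expR; field.
by rewrite lerDr.
Qed.

Lemma le_laplace_factor z y : 1 + expR z <= expR y -> expR (- (y / 2)) <= laplace_factor z.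
Proof.
move=> zy; rewrite /laplace_factor expRN lef_pV2 ?posrE ?sqrtr_gt0 ?expR_gt0 ?addr_gt0 ?expR_gt0//.
rewrite -[leRHS]ger0_norm ?expR_ge0// -sqrtr_sqr ler_wsqrtr//.
by have -> : expR (y / 2) ^+ 2 = expR y by rewrite expr2 -expRD; congr expR; field.
Qed.

Lemma le_laplace_factor_pos z : 0 <= z -> expR (- ((z + 1) / 2)) <= laplace_factor z.
Proof.
move=> z0; apply: le_laplace_factor; rewrite expRD mulrC.
have e2 : 2 <= expR 1 :> R by have := expR_ge1Dx (1 : R).
apply: (le_trans _ (ler_wpM2r (expR_ge0 z) e2)).
by rewrite mulrDl mul1r lerD2r -expR0 ler_expR.
Qed.

(** Each factor is replaced by its asymptote [exp (- z / 2)] for large [z]; the exponents then form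
    an arithmetic progression of step [Q / 2]. *)
Lemma prod_laplace_factor_le z J M :
  \prod_(i <- iota J M) (expR 2^-1 * laplace_factor (z - i%:R * Q)) <=
  expR (M%:R / 2 * (1 - (z - J%:R * Q) + Q * (M%:R - 1) / 2)).
Proof.
elim: M J => [|M IH] J; first by rewrite big_nil !mul0r expR0.
rewrite big_cons.
have -> : M.+1%:R / 2 * (1 - (z - J%:R * Q) + Q * (M.+1%:R - 1) / 2) =
    2^-1 - (z - J%:R * Q) / 2 + M%:R / 2 * (1 - (z - J.+1%:R * Q) + Q * (M%:R - 1) / 2).
  by rewrite -(natr1 M) -(natr1 J); field.
rewrite 2!expRD; apply: ler_pM => //.
- by rewrite mulr_ge0 ?expR_ge0 ?laplace_factor_ge0.
- by apply: prodr_ge0 => i _; rewrite mulr_ge0 ?expR_ge0 ?laplace_factor_ge0.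
- by rewrite ler_pM2l ?expR_gt0// laplace_factor_le.
Qed.

Let tau := (1 - q)^-1.

Let tau0 : 0 < tau.
Proof. by case/andP: q01 => q0 q1; rewrite invr_gt0 subr_gt0. Qed.

(** Here [1 + y <= exp y] bounds the loss of each factor by [exp (z - i Q) / 2], and these losses
    form a geometric series with sum at most [tau / 2]. *)
Lemma prod_laplace_factor_ge_tail z J M : z - J%:R * Q <= 0 ->
  expR (- (tau / 2)) <= \prod_(i <- iota J M) laplace_factor (z - i%:R * Q).
Proof.
move=> zJ; apply: (@le_trans _ _ (\prod_(i <- iota J M) expR (- (expR (z - i%:R * Q) / 2)))); last first.
  apply: ler_prod => i _; rewrite expR_ge0/=; apply: le_laplace_factor.
  exact: expR_ge1Dx.
rewrite -expR_sum ler_expR sumrN lerN2 -mulr_suml ler_pM2r//.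
under eq_bigr do rewrite expRD -qE.
rewrite -mulr_sumr; apply: le_trans (ler_wpM2l (expR_ge0 z) (geometric_sum_le _ _ q01)) _.
by rewrite mulrA -/tau -[leRHS]mul1r qE -expRD ler_pM2r// -[leRHS]expR0 ler_expR.
Qed.

(* [psi z >= z + 1 + psi (z - Q)] for [z >= 0], and [psi >= tau] on [-Q, 0]. *)
Let psi z := tau + (z + Q) ^+ 2 / (2 * Q) + (z + Q) / Q.

(** In [psi] the quadratic term sums the progression of exponents, the term [(z + Q) / Q] counts the
    factors, each losing a constant, and [tau] is the tail. Steps of size [Q] from a nonnegative
    argument cannot jump over [[- Q, 0]], where the tail bound takes over. *)
Lemma prod_laplace_factor_ge z J M : - Q <= z - J%:R * Q ->
  expR (- (psi (z - J%:R * Q) / 2)) <= \prod_(i <- iota J M) laplace_factor (z - i%:R * Q).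
Proof.
have psi_ge y : - Q <= y -> tau <= psi y.
  move=> yQ; rewrite /psi -addrA lerDl addr_ge0// divr_ge0 ?sqr_ge0 ?mulr_ge0 ?(ltW Q0)//; lra.
elim: M J => [|M IH] J zJ.
  by rewrite big_nil -[leRHS]expR0 ler_expR oppr_le0 divr_ge0// (le_trans (ltW tau0))// psi_ge.
have [z0|/ltW z0] := leP (z - J%:R * Q) 0.
  apply: le_trans (prod_laplace_factor_ge_tail M.+1 z0).
  by rewrite ler_expR lerN2 ler_pM2r// psi_ge.
rewrite big_cons.
have zJ1 : z - J.+1%:R * Q = z - J%:R * Q - Q by rewrite -natr1; ring.
have IHJ : expR (- (psi (z - J%:R * Q - Q) / 2)) <=
    \prod_(i <- iota J.+1 M) laplace_factor (z - i%:R * Q).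
  by rewrite -zJ1; apply: IH; rewrite zJ1; lra.
apply: le_trans (ler_pM (expR_ge0 _) (expR_ge0 _) (le_laplace_factor_pos z0) IHJ).
rewrite -expRD ler_expR -opprD lerN2 -mulrDl ler_pM2r//.
rewrite /psi; move: (z - J%:R * Q) => y.
suff -> : tau + (y + Q) ^+ 2 / (2 * Q) + (y + Q) / Q =
  y + 1 + (tau + (y - Q + Q) ^+ 2 / (2 * Q) + (y - Q + Q) / Q) + Q / 2 by rewrite lerDl divr_ge0// ltW.
by field; rewrite gt_eqF.
Qed.

Variable p : R -> R.
Hypothesis p_le : exists c J0, 0 < c /\ forall eps M, 0 < eps ->
  p eps <= (\prod_(J <- iota J0 M) (expR 2^-1 *
    (Num.sqrt (1 + c * q ^+ J / eps ^+ 2))^-1)) ^+ r.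
Hypothesis p_ge : exists c, 0 < c /\ forall eps lam b, 0 < eps -> 0 <= lam ->
  (forall M, b <= (Num.sqrt (1 + c * lam))^-1 *
    (\prod_(J <- iota 0 M) (Num.sqrt (1 + c * lam * q ^+ J))^-1) ^+ r) ->
  b - expR (- (lam * eps ^+ 2)) <= p eps.

Let p_upper : exists K : R, 0 <= K /\ forall L, 0 <= L ->
  p (expR (- L)) <= expR (r%:R * (- (L ^+ 2 / Q) + K * L)).
Proof.
have [c [J0 [c0 hp]]] := p_le.
pose k := `|J0%:R * Q - ln c|; have k0 : 0 <= k by exact: normr_ge0.
exists (2^-1 + (1 + k) / Q); split; first by rewrite addr_ge0// divr_ge0 ?ltW// ltr_pwDl.
(* With [eps = exp (- L)], this is about the number of scales with [q ^+ J / eps ^+ 2 >= 1], and it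
   minimizes the leading part [- M * L + Q * M^2 / 4] of the exponent, giving [- L^2 / Q]. *)
move=> L L0; pose M := Num.trunc (2 * L / Q).
have LQ0 : 0 <= 2 * L / Q by rewrite divr_ge0 ?mulr_ge0// ltW.
have /andP[M1 M2] := truncn_itv LQ0; rewrite -/M in M1 M2.
have e0 : 0 < expR (- L) by exact: expR_gt0.
apply: (le_trans (hp _ M e0)); rewrite expRM_natl; apply: lerXn2r.
- by rewrite nnegrE; apply: prodr_ge0 => i _; rewrite mulr_ge0 ?expR_ge0// invr_ge0 sqrtr_ge0.
- by rewrite nnegrE expR_ge0.
have E2 : (expR (- L) ^+ 2)^-1 = expR (2 * L).
  by rewrite -expRM_natl -expRN; congr expR; ring.
rewrite E2.
under eq_bigr => i _ do
  rewrite mulrAC (laplace_factorE _ (mulr_gt0 c0 (expR_gt0 _))) lnM ?posrE ?expR_gt0// expRK.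
apply: (le_trans (prod_laplace_factor_le _ _ _)); rewrite ler_expR.
have kle : J0%:R * Q - ln c <= k := ler_norm _.
rewrite -(natr1 M) in M2; move: (M%:R : R) (ler0n R M) M1 M2 => N N0 M1 M2.
have NQ : N * Q <= 2 * L by rewrite -ler_pdivlMr.
have h1 : N / 2 * (1 - (ln c + 2 * L - J0%:R * Q) + Q * (N - 1) / 2) <= N / 2 * (1 + k - L).
  by apply: ler_wpM2l; [rewrite divr_ge0|have := Q0; lra].
have h2 : N * (1 + k) <= 2 * L / Q * (1 + k) by apply: ler_wpM2r => //; lra.
have h3 : (2 * L / Q - 1) * L <= N * L by apply: ler_wpM2r => //; rewrite lerBlDr ltW.
apply: (le_trans h1); rewrite mulrDl.
have -> : (1 + k) / Q * L = (2 * L / Q * (1 + k)) / 2 by field; rewrite gt_eqF.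
have -> : L ^+ 2 / Q = (2 * L / Q * L) / 2 by field; rewrite gt_eqF.
lra.
Qed.

Let p_lower : exists K S : R, 0 <= K /\ forall s, S <= s ->
  expR (- (r%:R * (s ^+ 4 / Q) + K * s ^+ 3)) <= p (expR (- s ^+ 2)).
Proof.
have [c [c0 hp]] := p_ge.
pose k := 1 + `|ln c| + Q.
pose K := (3 + k) / 2 + 1 + r%:R / 2 * (tau + (4 * k + k ^+ 2) / (2 * Q) + (2 + k) / Q).
have k0 : 0 <= k by rewrite !addr_ge0// ltW.
pose t1 := (4 * k + k ^+ 2) / (2 * Q); pose t2 := (2 + k) / Q.
have t10 : 0 <= t1 by rewrite divr_ge0 ?addr_ge0 ?mulr_ge0 ?sqr_ge0// ltW.
have t20 : 0 <= t2 by rewrite divr_ge0 ?addr_ge0// ltW.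
have r20 : 0 <= r%:R / 2 :> R by rewrite divr_ge0.
have K0 : 0 <= K.
  have : 0 <= r%:R / 2 * (tau + t1 + t2) by rewrite mulr_ge0// !addr_ge0// ltW.
  by rewrite /K -/t1 -/t2; lra.
(* The 120 is [5!]: beyond this threshold [s^5 / 5!], hence [exp s], exceeds the whole exponent of
   order [s^4]. *)
exists K, (Num.max 1 (Num.max `|ln c| (120 * (r%:R / Q + K)))); split => // s.
rewrite !ge_max => /andP[s1 /andP[sc sK]].
have s0 : 0 <= s by lra.
(* This is [ln (c * lambda)] for [lambda = exp (2 * s^2 + s)] and [eps = exp (- s^2)], so that
   [lambda * eps^2 = exp s]. *)
pose Lam := ln c + (2 * s ^+ 2 + s).
have cE : c * expR (2 * s ^+ 2 + s) = expR Lam by rewrite /Lam (expRD (ln c)) lnK ?posrE.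
have Lam0 : 0 <= Lam.
  have := sqr_ge0 s; have := ler_normlW sc; rewrite /Lam.
  by have := lerNnormlW sc; lra.
pose B := (Lam + 1) / 2 + r%:R / 2 * psi Lam.
have hb M : expR (- B) <= (Num.sqrt (1 + c * expR (2 * s ^+ 2 + s)))^-1 *
    (\prod_(J <- iota 0 M) (Num.sqrt (1 + c * expR (2 * s ^+ 2 + s) * q ^+ J))^-1) ^+ r.
  rewrite cE; under eq_bigr => i _ do rewrite (laplace_factorE _ (expR_gt0 _)) expRK.
  rewrite opprD expRD; apply: ler_pM; rewrite ?expR_ge0//; first exact: le_laplace_factor_pos.
  have -> : - (r%:R / 2 * psi Lam) = r%:R * (- (psi (Lam - 0%:R * Q) / 2)).
    by rewrite mul0r subr0; field.
  rewrite expRM_natl; apply: lerXn2r.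
  - by rewrite nnegrE expR_ge0.
  - by rewrite nnegrE; apply: prodr_ge0 => i _; exact: laplace_factor_ge0.
  - by apply: prod_laplace_factor_ge; rewrite mul0r subr0; have := Q0; lra.
have := hp _ _ _ (expR_gt0 (- s ^+ 2)) (expR_ge0 _) hb.
have -> : expR (2 * s ^+ 2 + s) * expR (- s ^+ 2) ^+ 2 = expR s.
  by rewrite -expRM_natl -expRD; congr expR; ring.
set D := r%:R * (s ^+ 4 / Q) + K * s ^+ 3.
have s2 : s <= s ^+ 2 by rewrite expr2 ler_peMr.
have s3 : s ^+ 2 <= s ^+ 3 by rewrite exprS ler_peMl ?sqr_ge0.
have s4 : s ^+ 3 <= s ^+ 4 by rewrite [leRHS]exprS ler_peMl ?exprn_ge0.
(* The spare 1 absorbs the subtraction: [exp (- B) >= 2 * exp (- (B + 1))], and the subtracted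
   [exp (- exp s)] is at most one of these halves. *)
have BD : B + 1 <= D.
  pose y := Lam + Q; have y0 : 0 <= y by rewrite addr_ge0// ltW.
  have y1 : y <= 2 * s ^+ 2 + k * s.
    have := ler_norm (ln c); have : 0 <= (`|ln c| + Q) * (s - 1).
      by rewrite mulr_ge0 ?subr_ge0// addr_ge0// ltW.
    by rewrite /y /Lam /k; lra.
  have y2 : y ^+ 2 <= 4 * s ^+ 4 + (4 * k + k ^+ 2) * s ^+ 3.
    have y2 := ler_pM y0 y0 y1 y1.
    have ks : k ^+ 2 * s ^+ 2 <= k ^+ 2 * s ^+ 3 by apply: ler_wpM2l => //; exact: sqr_ge0.
    apply: (le_trans y2); rewrite [leLHS](_ : _ = 4 * s ^+ 4 + 4 * k * s ^+ 3 + k ^+ 2 * s ^+ 2); last by ring.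
    lra.
  have z2 : y ^+ 2 / (2 * Q) <= 2 * (s ^+ 4 / Q) + t1 * s ^+ 3.
    have -> : 2 * (s ^+ 4 / Q) + t1 * s ^+ 3 = (4 * s ^+ 4 + (4 * k + k ^+ 2) * s ^+ 3) / (2 * Q).
      by rewrite /t1; field; rewrite gt_eqF.
    by apply: ler_wpM2r => //; rewrite invr_ge0 mulr_ge0// ltW.
  have y3 : y <= (2 + k) * s ^+ 3.
    have : k * s <= k * s ^+ 3 by apply: ler_wpM2l => //; lra.
    lra.
  have z3 : y / Q <= t2 * s ^+ 3.
    rewrite /t2 mulrAC; apply: ler_wpM2r => //; by rewrite invr_ge0 ltW.
  have ts : tau <= tau * s ^+ 3 by rewrite ler_peMr ?(ltW tau0)//; lra.
  have ps : psi Lam <= 2 * (s ^+ 4 / Q) + (tau + t1 + t2) * s ^+ 3.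
    by rewrite /psi -/y; lra.
  have := ler_wpM2l r20 ps; have Q1 := Q0; have : Lam = y - Q by rewrite /y addrK.
  rewrite /B /D /K -/t1 -/t2.
  move: (psi Lam) (s ^+ 4 / Q) (r%:R : R) => z4 z5 z6; lra.
have Ds : D <= expR s.
  have := expR_ge1Dxn 4 s0; apply: le_trans.
  have -> : (5`!%:R : R) = 120 by [].
  have h : (r%:R / Q + K) * s ^+ 4 <= s / 120 * s ^+ 4.
    by apply: ler_wpM2r; [exact: exprn_ge0|rewrite ler_pdivlMr//; lra].
  have h2 : K * s ^+ 3 <= K * s ^+ 4 by exact: ler_wpM2l.
  rewrite /D mulrCA mulrA; rewrite (_ : s / 120 * s ^+ 4 = s ^+ 5 / 120) in h; last by ring.
  lra.
move=> ple; apply: (@le_trans _ _ (expR (- (B + 1)))); first by rewrite ler_expR lerN2.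
apply: le_trans ple.
have e2 : 2 <= expR 1 :> R by have := expR_ge1Dx (1 : R).
have -> : expR (- B) = expR 1 * expR (- (B + 1)) by rewrite -expRD; congr expR; ring.
have h1 : expR (- expR s) <= expR (- (B + 1)) by rewrite ler_expR lerN2 (le_trans BD).
have := ler_wpM2r (expR_ge0 (- (B + 1))) e2; lra.
Qed.

Lemma small_ball_asymptotics :
  ln (p eps) / (- r%:R * (ln (1 / eps) ^+ 2 / Q)) @[eps --> 0^'+] --> (1 : R).
Proof.
have [K1 [K10 hu]] := p_upper; have [K2 [S [K20 hl]]] := p_lower.
have rR : 0 < r%:R :> R by rewrite ltr0n.
apply/cvgrPdist_le => t t0.
pose K := r%:R * K1 + K2; have KK : 0 <= K by rewrite addr_ge0// mulr_ge0// ltW.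
(* The error [K * s^3] relative to the main term [r * s^4 / Q] is at most [t] once [s] exceeds the
   last entry. *)
pose s0 := Num.max (Num.max S 1) (K * Q / (r%:R * t)).
near=> eps.
have e0 : 0 < eps by near: eps; exact: nbhs_right_gt.
have es : eps <= expR (- s0 ^+ 2) by near: eps; apply: nbhs_right_le; exact: expR_gt0.
pose s := Num.sqrt (ln (1 / eps)).
have s00 : 0 <= s0 by rewrite /s0 !le_max ler01 orbT.
have Ls : s0 ^+ 2 <= ln (1 / eps).
  by rewrite div1r lnV ?posrE// lerNr -(expRK (- s0 ^+ 2)) ler_ln ?posrE ?expR_gt0.
have ss0 : s0 <= s by rewrite -(ger0_norm s00) -sqrtr_sqr ler_wsqrtr.
have s2 : s ^+ 2 = ln (1 / eps) by rewrite sqr_sqrtr// (le_trans _ Ls)// sqr_ge0.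
have epsE : eps = expR (- s ^+ 2) by rewrite s2 div1r lnV ?posrE// opprK lnK ?posrE.
have Ss : S <= s by apply: le_trans ss0; rewrite /s0 !le_max lexx.
have s1 : 1 <= s by apply: le_trans ss0; rewrite /s0 !le_max lexx !orbT.
have sK : K * Q / (r%:R * t) <= s by apply: le_trans ss0; rewrite /s0 !le_max lexx !orbT.
have lo := hl s Ss; have hi := hu (s ^+ 2) (sqr_ge0 s).
rewrite -epsE in lo hi.
(* Positivity is what allows writing [p eps] as the exponential of its logarithm, [ln] having a
   default value elsewhere. *)
have pp : 0 < p eps by apply: lt_le_trans lo; exact: expR_gt0.
move: lo hi; rewrite -[X in X <= expR _ -> _](lnK (x := p eps)) ?posrE//.
rewrite -[X in _ <= X -> _](lnK (x := p eps)) ?posrE// !ler_expR => lo hi.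
rewrite -s2.
have E4 : s ^+ 2 ^+ 2 = s ^+ 4 by rewrite -exprM.
rewrite E4 in hi *.
set v := r%:R * (s ^+ 4 / Q) in lo.
have v0 : 0 < v by rewrite mulr_gt0// divr_gt0// exprn_gt0//; lra.
rewrite mulNr -/v invrN mulrN opprK.
rewrite -[X in X + _](divff (lt0r_neq0 v0)) -mulrDl normrM normfV (gtr0_norm v0).
rewrite ler_pdivrMr//; apply: (@le_trans _ _ (K * s ^+ 3)).
  have s3 : s ^+ 2 <= s ^+ 3 by rewrite exprS ler_peMl ?sqr_ge0.
  have h1 : r%:R * (K1 * s ^+ 2) <= r%:R * (K1 * s ^+ 3).
    by apply: ler_wpM2l; [exact: ltW|exact: ler_wpM2l].
  have s3_ge0 : 0 <= s ^+ 3 by apply: exprn_ge0; lra.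
  have h2 : 0 <= r%:R * (K1 * s ^+ 3) by apply: mulr_ge0; [exact: ltW|exact: mulr_ge0].
  have h3 : 0 <= K2 * s ^+ 3 by rewrite mulr_ge0.
  rewrite mulrDr mulrN -/v in hi.
  by rewrite ler_norml; apply/andP; split; rewrite /K; lra.
rewrite ler_pdivrMr ?mulr_gt0// in sK.
have -> : t * v = (s * (r%:R * t)) * s ^+ 3 / Q by rewrite /v; ring.
have -> : K * s ^+ 3 = K * Q * s ^+ 3 / Q by field; rewrite gt_eqF.
have Q1 := Q0.
apply: ler_wpM2r; first by rewrite invr_ge0 ltW.
by apply: ler_wpM2r => //; rewrite exprn_ge0//; lra.
Unshelve. all: by end_near. Qed.
End small_ball_asymptotics.

Theorem proposition4p2 (R : realType) (n : nat)
    (alpha : 'I_n.+1 -> R) (e : 'I_n -> bool) (d beta : 'I_n -> R) (m : 'I_n)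
    (mu : probability (measurableTypeR R) R)
    (hmu : degenerate_self_similar alpha e d beta m mu)
    (disp : measure_display) (Omega : measurableType disp)
    (P : probability Omega R) (X : R -> Omega -> R)
    (hX : listed_process P X) :
  ln (small_ball_prob P mu X eps) /
    (- (n%:R - 1) * (ln (1 / eps) ^+ 2 / ln (1 / (`|d m| * gap alpha m))))
    @[eps --> 0^'+] --> (1 : R).
Proof.
have [n2 [x [w [lo [hi [x0 [p ga]]]]]]] := degenerate_geometric_atoms hmu.
have [H [kappa [C [gH k0 C0 [HB varX covX limX]]]]] := quasi_brownian_listed hX.
have q01 : 0 < `|d m| * gap alpha m < 1.
  have /andP[d0 d1] := ga_delta ga; have /andP[a0 a1] := ga_a ga.
  by rewrite mulr_gt0//= mulr_ilt1// ltW.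
have r0 : (0 < n.-1)%N by rewrite -subn1 subn_gt0.
have <- : n.-1%:R = n%:R - 1 :> R by rewrite -subn1 natrB// ltnW.
apply: (small_ball_asymptotics q01 r0).
- exact: (small_ball_le gH k0 C0 HB varX covX limX ga).
- exact: (small_ball_ge gH k0 C0 HB varX limX ga).
Qed.
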